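(* Let $f\ge 0$ be a classical solution of the relativistic Landau equation $$\partial_t f+\frac{p}{\langle p\rangle}\cdot\nabla_x f=\mathcal Q_{\rm RL}(f,f)$$ on $[0,T]\times\mathbb R^3_x\times\mathbb R^3_p$ for some $T>0$, with initial data $f_{\rm in}=f(0,\cdot,\cdot):\mathbb R^3_x\times\mathbb R^3_p\to[0,\infty)$. Assume that there are $E_0,F_0>0$ such that $$E_f(t,x)\le E_0\quad\text{and}\quad \|f(t,x,\cdot)\|_{L^\infty(\mathbb R^3)}\le F_0\qquad\text{for all }(t,x)\in[0,T]\times\mathbb R^3.$$ Further, suppose that there are $k>0$ and $M_k>0$ such that $$\langle p\rangle^k f_{\rm in}(x,p)\le M_k\qquad\text{for all }(x,p)\in\mathbb R^3\times\mathbb R^3.$$ Then $$\langle p\rangle^k f(t,x,p)\le e^{\beta t}M_k\qquad\text{for all }(t,x,p)\in[0,T]\times\mathbb R^3\times\mathbb R^3,$$ for some $\beta>0$ depending only on $k$, $E_0$, and $F_0$. If, in addition, there are $\sigma,N>0$ such that $$e^{\sigma\langle p\rangle}f_{\rm in}(x,p)\le N\qquad\text{for all }(x,p)\in\mathbb R^3\times\mathbb R^3,$$ then $$e^{\sigma\langle p\rangle}f(t,x,p)\le N\exp\!\left(CNe^{Ct}t\right)\qquad\text{for all }(t,x,p)\in[0,T]\times\mathbb R^3\times\mathbb R^3,$$ for some $C>0$ depending only on $\sigma$, $E_0$, and $F_0$.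
   Context: Notation: $\langle p\rangle=\sqrt{1+|p|^2}$ for $p\in\mathbb R^3$. The energy density is $E_f(t,x)=\int_{\mathbb R^3}\langle p\rangle f(t,x,p)\,dp$. The relativistic Landau collision operator acts only in the $p$ variable and is $$\mathcal Q_{\rm RL}(f,g)(p)=\nabla_p\cdot\left(\int_{\mathbb R^3}\Phi(p,q)\big(f(q)\nabla_p g(p)-g(p)\nabla_q f(q)\big)\,dq\right),$$ where $\Phi(p,q)$ is the $3\times3$ matrix with entries $\Phi^{ij}(p,q)=\Lambda(p,q)S^{ij}(p,q)$, $$\Lambda(p,q)=\frac{(\tau-1)^2}{\langle p\rangle\langle q\rangle}[\tau(\tau-2)]^{-3/2},\qquad \tau=\langle p\rangle\langle q\rangle-p\cdot q+1,$$ $$S^{ij}(p,q)=\tau(\tau-2)\delta_{ij}-(p_i-q_i)(p_j-q_j)+(\tau-2)(p_iq_j+p_jq_i).$$ *)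

(* Defs.v *)
From HB Require Import structures.
From mathcomp Require Import all_boot all_order all_algebra.
From mathcomp Require Import all_classical all_reals all_analysis.

Set Implicit Arguments.
Unset Strict Implicit.
Unset Printing Implicit Defensive.

Import Order.TTheory GRing.Theory Num.Theory.
Import numFieldNormedType.Exports.

Local Open Scope classical_set_scope.
Local Open Scope ring_scope.

Definition dotv {R : realType} (p q : 'rV[R]_3) : R :=
  \sum_(i < 3) p 0 i * q 0 i.

Definition jbracket {R : realType} (p : 'rV[R]_3) : R :=
  Num.sqrt (1 + dotv p p).

Definition basis3 {R : realType} (i : 'I_3) : 'rV[R]_3 := delta_mx 0 i.

(* Row vectors carry no measurable structure in the library, so dp on R^3 is
   the product Lebesgue measure on R * R * R, and an integrand defined on row
   vectors is integrated after composition with [vec3]. *)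
Definition vec3 {R : realType} (z : R * R * R) : 'rV[R]_3 :=
  \row_(i < 3) [:: z.1.1; z.1.2; z.2]`_i.

Definition leb3 {R : realType} :
    {measure set (measurableTypeR R * measurableTypeR R * measurableTypeR R)%type
       -> \bar R} :=
  (((@lebesgue_measure R) \x (@lebesgue_measure R)) \x (@lebesgue_measure R))%E.

Definition tauRL {R : realType} (p q : 'rV[R]_3) : R :=
  jbracket p * jbracket q - dotv p q + 1.

(* At p = q one has tau = 2 and [powR 0 (- (3 / 2)) = 0]: the value of the
   kernel on the diagonal is irrelevant for the integrals below. *)
Definition LambdaRL {R : realType} (p q : 'rV[R]_3) : R :=
  let tau := tauRL p q in
  (tau - 1) ^+ 2 / (jbracket p * jbracket q) *
    (tau * (tau - 2)) `^ (- (3 / 2)).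

Definition SRL {R : realType} (p q : 'rV[R]_3) : 'M[R]_3 :=
  let tau := tauRL p q in
  \matrix_(i, j) (tau * (tau - 2) * (i == j)%:R
    - (p 0 i - q 0 i) * (p 0 j - q 0 j)
    + (tau - 2) * (p 0 i * q 0 j + p 0 j * q 0 i)).

Definition PhiRL {R : realType} (p q : 'rV[R]_3) : 'M[R]_3 :=
  LambdaRL p q *: SRL p q.

Definition RL_integrand {R : realType} (f g : 'rV[R]_3 -> R) (i : 'I_3)
    (p q : 'rV[R]_3) : R :=
  \sum_(j < 3) PhiRL p q i j *
    (f q * 'D_(basis3 j) g p - g p * 'D_(basis3 j) f q).

Definition RL_flux {R : realType} (f g : 'rV[R]_3 -> R) (i : 'I_3)
    (p : 'rV[R]_3) : R :=
  \int[leb3]_z RL_integrand f g i p (vec3 z).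

Definition QRL {R : realType} (f g : 'rV[R]_3 -> R) (p : 'rV[R]_3) : R :=
  \sum_(i < 3) 'D_(basis3 i) (RL_flux f g i) p.

(* Lebesgue integrals and directional derivatives are total functions in the
   library; this says that those in [QRL f g] exist. *)
Definition QRL_defined {R : realType} (f g : 'rV[R]_3 -> R) : Prop :=
  forall (p : 'rV[R]_3) (i : 'I_3),
    leb3.-integrable setT (fun z => (RL_integrand f g i p (vec3 z))%:E) /\
    derivable (RL_flux f g i) p (basis3 i).

Definition energy {R : realType} (f : R -> 'rV[R]_3 -> 'rV[R]_3 -> R)
    (t : R) (x : 'rV[R]_3) : \bar R :=
  (\int[leb3]_z (jbracket (vec3 z) * f t x (vec3 z))%:E)%E.

Definition Linfty {R : realType} (g : 'rV[R]_3 -> R) : \bar R :=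
  Lnorm leb3 +oo%E (fun z => (g (vec3 z))%:E).

Definition dt {R : realType} (f : R -> 'rV[R]_3 -> 'rV[R]_3 -> R)
    (t : R) (x p : 'rV[R]_3) : R := derive1 (fun s => f s x p) t.

Definition dx {R : realType} (i : 'I_3)
    (f : R -> 'rV[R]_3 -> 'rV[R]_3 -> R) (t : R) (x p : 'rV[R]_3) : R :=
  'D_(basis3 i) (fun y => f t y p) x.

Definition dp {R : realType} (i : 'I_3)
    (f : R -> 'rV[R]_3 -> 'rV[R]_3 -> R) (t : R) (x p : 'rV[R]_3) : R :=
  'D_(basis3 i) (f t x) p.

Definition jointly {R : realType} (f : R -> 'rV[R]_3 -> 'rV[R]_3 -> R)
    (w : R * 'rV[R]_3 * 'rV[R]_3) : R := f w.1.1 w.1.2 w.2.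

(* Continuous on the closed time interval, C^1 in (t, x) and C^2 in p on the
   open one, where the equation holds pointwise; only values of f at times in
   [0, T] matter. *)
Record classical_solution {R : realType} (T : R)
    (f : R -> 'rV[R]_3 -> 'rV[R]_3 -> R) : Prop := ClassicalSolution {
  cs_continuous :
    {within [set w | 0 <= w.1.1 <= T], continuous (jointly f)};
  cs_derivable_t : forall (t : R) (x p : 'rV[R]_3), 0 < t < T ->
    derivable (fun s => f s x p) t 1;
  cs_derivable_x : forall (t : R) (x p : 'rV[R]_3), 0 < t < T ->
    forall i : 'I_3, derivable (fun y => f t y p) x (basis3 i);
  cs_derivable_p : forall (t : R) (x p : 'rV[R]_3), 0 < t < T ->
    forall i : 'I_3, derivable (f t x) p (basis3 i);
  cs_derivable_pp : forall (t : R) (x p : 'rV[R]_3), 0 < t < T ->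
    forall i j : 'I_3, derivable (dp j f t x) p (basis3 i);
  cs_continuous_dt :
    {in [set w | 0 < w.1.1 < T], continuous (jointly (dt f))};
  cs_continuous_dx : forall i : 'I_3,
    {in [set w | 0 < w.1.1 < T], continuous (jointly (dx i f))};
  cs_continuous_dp : forall i : 'I_3,
    {in [set w | 0 < w.1.1 < T], continuous (jointly (dp i f))};
  cs_continuous_dpp : forall i j : 'I_3,
    {in [set w | 0 < w.1.1 < T], continuous (jointly (dp i (dp j f)))};
  cs_collision : forall (t : R) (x : 'rV[R]_3), 0 < t < T ->
    QRL_defined (f t x) (f t x);
  cs_equation : forall (t : R) (x p : 'rV[R]_3), 0 < t < T ->
    dt f t x p + \sum_(i < 3) (p 0 i / jbracket p) * dx i f t x p
      = QRL (f t x) (f t x) p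
}.

(* The standing assumptions, with the bounds on the energy density and on the
   sup norm. *)
Record bounded_solution {R : realType} (T E0 F0 : R)
    (f : R -> 'rV[R]_3 -> 'rV[R]_3 -> R) : Prop := BoundedSolution {
  bs_solution : classical_solution T f;
  bs_ge0 : forall (t : R) (x p : 'rV[R]_3), 0 <= t <= T -> 0 <= f t x p;
  bs_energy : forall (t : R) (x : 'rV[R]_3), 0 <= t <= T ->
    (energy f t x <= E0%:E)%E;
  bs_Linfty : forall (t : R) (x : 'rV[R]_3), 0 <= t <= T ->
    (Linfty (f t x) <= F0%:E)%E
}.

(* Main.v *)
Require Import Defs.
From HB Require Import structures.
From mathcomp Require Import all_boot all_order all_algebra.
From mathcomp Require Import all_classical all_reals all_analysis.
From mathcomp Require Import measurable_realfun ess_sup_inf ring lra.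

Set Implicit Arguments.
Unset Strict Implicit.
Unset Printing Implicit Defensive.

Import Order.TTheory GRing.Theory Num.Theory.
Import numFieldNormedType.Exports.

Local Open Scope classical_set_scope.
Local Open Scope ring_scope.

(** Both estimates are instances of one comparison principle. Let a barrier
e^(phi t) W(<p>) dominate f at time 0. Then it dominates f as long as phi'
outweighs what the collision operator can contribute at a point where f
touches the barrier from below. To see this one maximises
e^(- lam t) (f - e^(phi t) W(<p>)) - eps (<p> + <x>), which is negative at
time 0 and, since f is bounded, near infinity in (x, p). At a positive
maximum the transport term is of size eps, the time derivative is
nonnegative, and a large lam gives a contradiction ([comparison]).

What is needed is therefore an upper bound for Q(f, f)(p) at a point p where
f - W(<.>) has a local maximum ([collision_at_maximum]). With P = <p>,
Q = <q>, rho = P Q - p.q and u = rho^2 - 1, the kernel is Lambda S / (P Q),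
where Lambda = rho^2 u^(-3/2) and S is a sum of squares. In nondivergence
form the second derivatives of f may hence be replaced by those of the
barrier, and the algebra of S turns the integrand into f(q) times
  Lambda / (P Q) (W'' |p x q|^2 + 2 W' (rho - 1) (P + Q))
plus W(P) times the double divergence of the kernel. Everything is then at
most of the size 1 + sqrt(P Q) / |q - p|, which is integrable against f
because the energy controls f at infinity and the sup norm controls it near
the singularity.

The kernel is singular at q = p, so the computation is carried out for a C^1
profile L_s that agrees with Lambda for u > s^2. Integration by parts in q
moves the derivative of f(q) onto the regularised kernel; S annihilates the
gradient of rho, so that for any radial profile the divergence is explicit
and contains no derivative of the profile ([sum_dKer]). The flux is thus an
integral that can be differentiated under the integral sign plus a remainder
supported in |q - p| <= C s ([flux_split]). The remainder contains the
factor f(q) D f(p) - f(p) D f(q), which vanishes on the diagonal; this makes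
its derivative O(s^2) whenever it exists ([remainder_derive]), and it does
because the flux is differentiable. The double divergence of the regularised
kernel has a part that approximates a Dirac mass: it is O(s^-3) on a shell
u < 2 s^2 of volume O(s^3 P^2) ([div_bound], [shell_volume]). Letting s tend
to 0 gives the bound.

For the polynomial weight W(r) = M r^(-k), the gain r^-2 in W'' compensates
the factor P in front of the sup norm, and phi is linear in time. For
W(r) = N e^(- sigma r) there is no such gain, but the polynomial bound with
k = 7, available since e^(sigma r) dominates r^7, makes the energy and <p> f
at most a constant times N e^(beta t); then phi t = C N e^(beta t) t works. *)

(** * Momentum space and its Lebesgue measure *)

Section Space3.
Variable R : realType.
Notation V := 'rV[R]_3.

Definition i0 : 'I_3 := ord0.
Definition i1 : 'I_3 := lift ord0 ord0.
Definition i2 : 'I_3 := ord_max.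

Lemma vec3_0 (z : R * R * R) : vec3 z 0 i0 = z.1.1.
Proof. by rewrite mxE. Qed.
Lemma vec3_1 (z : R * R * R) : vec3 z 0 i1 = z.1.2.
Proof. by rewrite mxE. Qed.
Lemma vec3_2 (z : R * R * R) : vec3 z 0 i2 = z.2.
Proof. by rewrite mxE. Qed.

Lemma ord3P (P : 'I_3 -> Prop) : P i0 -> P i1 -> P i2 -> forall i, P i.
Proof.
move=> h0 h1 h2 [[|[|[|//]]] hi].
- by rewrite (_ : Ordinal hi = i0)//; exact: val_inj.
- by rewrite (_ : Ordinal hi = i1)//; exact: val_inj.
- by rewrite (_ : Ordinal hi = i2)//; exact: val_inj.
Qed.

Lemma sum3 (U : zmodType) (F : 'I_3 -> U) : \sum_(i < 3) F i = F i0 + F i1 + F i2.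
Proof.
rewrite !big_ord_recr big_ord0 /= add0r; congr (_ + _ + _); congr F; exact: val_inj.
Qed.

Lemma vnorm_ltP (p : V) r : 0 < r -> `|p| < r <-> forall i, `|p 0 i| < r.
Proof.
move=> r0; rewrite [`|p|]/Num.norm /= mx_normrE; split.
  move=> /bigmax_ltP[_ h] i; exact: (h (0, i)).
by move=> h; apply/bigmax_ltP; split => // -[j i] _ /=; rewrite ord1.
Qed.

Lemma vnorm_leP (p : V) r : 0 <= r -> `|p| <= r <-> forall i, `|p 0 i| <= r.
Proof.
move=> r0; rewrite [`|p|]/Num.norm /= mx_normrE; split.
  move=> /bigmax_leP[_ h] i; exact: (h (0, i)).
by move=> h; apply/bigmax_leP; split => // -[j i] _ /=; rewrite ord1.
Qed.

Lemma le_vnorm (p : V) i : `|p 0 i| <= `|p|.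
Proof. by have /(_ i) := (vnorm_leP p (normr_ge0 p)).1 (lexx _). Qed.

(** Row vectors carry no sigma-algebra, so measurability, integrability and
integrals on momentum space are stated after composition with [vec3]. *)
Definition meas3 (g : V -> R) := measurable_fun
  [set: measurableTypeR R * measurableTypeR R * measurableTypeR R] (fun z => g (vec3 z)).
Definition integ3 (g : V -> R) := leb3.-integrable setT (fun z => (g (vec3 z))%:E).
Definition int3 (g : V -> R) : R := \int[@leb3 R]_z g (vec3 z).

Local Notation T3 := (measurableTypeR R * measurableTypeR R * measurableTypeR R)%type.

Lemma cube_vec3 (p : V) r : 0 < r ->
  (@vec3 R) @^-1` [set q | `|q - p| < r] =
  (`]p 0 i0 - r, p 0 i0 + r[ `*` `]p 0 i1 - r, p 0 i1 + r[) `*` `]p 0 i2 - r, p 0 i2 + r[ .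
Proof.
move=> r0; apply/seteqP; split=> z /=.
  move=> /(vnorm_ltP _ r0) h; rewrite !in_itv /=.
  by split; [split|]; [move: (h i0)|move: (h i1)|move: (h i2)];
    rewrite !mxE/= ltr_distl.
rewrite !in_itv /= => -[[h0 h1] h2]; apply/vnorm_ltP => // i.
by elim/ord3P: i; rewrite !mxE/= ltr_distl.
Qed.

Lemma measurable_cube (p : V) r :
  measurable ((@vec3 R) @^-1` [set q | `|q - p| < r] : set T3).
Proof.
have [r0|r0] := ltP 0 r.
  by rewrite cube_vec3//; apply: measurableX => //; apply: measurableX.
rewrite (_ : _ @^-1` _ = set0)//; apply/seteqP; split => // z /= h.
by have := le_lt_trans (normr_ge0 _) (lt_le_trans h r0); rewrite ltxx.
Qed.

(** An open set is the union of the rational cubes that it contains. *)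
Lemma measurable_open3 (U : set V) : open U -> measurable ((@vec3 R) @^-1` U : set T3).
Proof.
move=> oU.
pose c (k : (rat * rat * rat * nat)) : V := vec3 (ratr k.1.1.1, ratr k.1.1.2, ratr k.1.2).
pose B (k : rat * rat * rat * nat) : set V := [set q | `|q - c k| < k.2.+1%:R^-1].
rewrite (_ : _ @^-1` U = \bigcup_(k in setT)
    (if `[< B k `<=` U >] then (@vec3 R) @^-1` B k else set0)).
  apply: countable_bigcupT_measurable; first exact: countableP.
  by move=> k; case: asboolP => // _; exact: measurable_cube.
apply/seteqP; split => z /=; last first.
  by move=> [k _]; case: asboolP => // h /= /h.
move=> Uz; have /nbhs_normP[e /= e0 eU] := oU _ Uz.
have : \forall n \near \oo, (n.+1%:R^-1 : R) < e / 2.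
  by apply: (near_infty_natSinv_lt (PosNum _)); rewrite divr_gt0.
move=> [n _ ne].
have {ne}ne := ne _ (leqnn n).
have rr (x : R) : exists q : rat, `|x - ratr q| < n.+1%:R^-1.
  have [|q] := @rat_in_itvoo _ (x - n.+1%:R^-1) (x + n.+1%:R^-1).
    by rewrite ltrBlDr -addrA ltrDl addr_gt0.
  by move=> h; exists q; rewrite distrC ltr_distl; move: h; rewrite in_itv.
have [q0 h0] := rr z.1.1; have [q1 h1] := rr z.1.2; have [q2 h2] := rr z.2.
have hc : `|vec3 z - c ((q0, q1, q2), n)| < n.+1%:R^-1.
  by apply/vnorm_ltP => // i; elim/ord3P: i; rewrite !mxE.
exists ((q0, q1, q2), n) => //.
case: asboolP => [h//|]; last first.
  move=> []; move=> q; rewrite /B /= => hq.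
  apply: eU => /=; rewrite /ball_/=.
  rewrite -(subrK (c ((q0, q1, q2), n)) (vec3 z)) -addrA.
  apply: (le_lt_trans (ler_normD _ _)); rewrite (distrC _ q).
  by rewrite [ltRHS](splitr e) ltrD// (lt_trans _ ne).
Qed.

Lemma meas3_open_preimage (g : V -> R) :
  (forall a, open [set q | a < g q]) -> meas3 g.
Proof.
move=> og; apply: (measurability _ (RGenOInfty.measurableE R)).
move=> _ [_ [a ->] <-]; rewrite setTI.
rewrite (_ : _ @^-1` _ = (@vec3 R) @^-1` [set q | a < g q]).
  exact: measurable_open3.
by apply/seteqP; split=> z /=; rewrite in_itv /= andbT.
Qed.

Lemma meas3_continuous (g : V -> R) : continuous g -> meas3 g.
Proof.
move=> cg; apply: meas3_open_preimage => a.
rewrite (_ : [set q | _] = g @^-1` `]a, +oo[).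
  by have /continuousP := cg; apply; exact: interval_open.
by apply/seteqP; split=> z /=; rewrite in_itv /= andbT.
Qed.

Lemma meas3_indic (U : set V) : open U -> meas3 (\1_U).
Proof.
move=> oU; rewrite /meas3.
rewrite (_ : (fun z => _) = \1_((@vec3 R) @^-1` U)).
  by apply: measurable_indic; exact: measurable_open3.
by [].
Qed.

Local Notation mu := (@lebesgue_measure R).
Local Notation mu2 := ((@lebesgue_measure R) \x (@lebesgue_measure R))%E.

Lemma leb3E (A : set (measurableTypeR R * measurableTypeR R)) (B : set R) :
  measurable A -> measurable B -> leb3 (A `*` B) = (mu2 A * mu B)%E.
Proof. by move=> mA mB; exact: (product_measure1E mu2 mu). Qed.

Lemma leb2E (A B : set R) : measurable A -> measurable B ->
  mu2 (A `*` B) = (mu A * mu B)%E.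
Proof. by move=> mA mB; exact: (product_measure1E mu mu). Qed.

Lemma leb_itv (x r : R) : 0 < r ->
  mu (`]x - r, x + r[%classic : set R) = (2 * r)%:E.
Proof.
move=> r0.
rewrite lebesgue_measure_itv /= lte_fin ifT; last by rewrite ltrBlDr -addrA ltrDl addr_gt0.
by rewrite -EFinB; congr EFin; ring.
Qed.

Lemma leb3_cube (p : V) r : 0 < r ->
  leb3 ((@vec3 R) @^-1` [set q | `|q - p| < r]) = ((2 * r) ^+ 3)%:E.
Proof.
move=> r0; rewrite cube_vec3// leb3E//; last exact: measurableX.
by rewrite leb2E// !leb_itv// -!EFinM; congr EFin; ring.
Qed.
End Space3.

Section Lines.
Variables (R : realType) (W : normedModType R).

(** Directional derivatives are ordinary derivatives along lines; the calculus
below is transferred from one variable through this equivalence. *)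
Lemma is_derive_line (F : W -> R) (v q : W) (s d : R) :
  is_derive (s *: v + q) v F d <-> is_derive s 1 (fun s => F (s *: v + q)) d.
Proof.
have E : (fun h => h^-1 *: ((F \o shift (s *: v + q)) (h *: v) - F (s *: v + q)))
   = (fun h => h^-1 *: (((fun s => F (s *: v + q)) \o shift s) (h *: 1) - F (s *: v + q))).
  apply/funext => h /=; congr (_ *: (F _ - _)).
  by rewrite [h *: 1]mulr1 scalerDl addrA.
split=> -[h1 h2]; apply: DeriveDef.
- by rewrite /derivable -E.
- by rewrite /derive -E.
- by rewrite /derivable E.
- by rewrite /derive E.
Qed.
End Lines.

Section Integrals.
Variable R : realType.
Notation V := 'rV[R]_3.
Local Notation T1 := (measurableTypeR R).
Local Notation T3 := (measurableTypeR R * measurableTypeR R * measurableTypeR R)%type.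
Local Notation mu := (@lebesgue_measure R).
Local Notation mu2 := ((@lebesgue_measure R) \x (@lebesgue_measure R))%E.
Implicit Types (g h : V -> R).

Lemma integ3_meas g : integ3 g -> meas3 g.
Proof. by move=> /integrableP[/measurable_EFinP]. Qed.

Lemma integ3_le g h : meas3 g -> integ3 h -> (forall q, `|g q| <= h q) -> integ3 g.
Proof.
move=> mg ih gh; apply: (le_integrable _ _ _ ih) => //; first exact/measurable_EFinP.
by move=> z _ /=; rewrite lee_fin (le_trans (gh _))// ler_norm.
Qed.

Lemma integ3D g h : integ3 g -> integ3 h -> integ3 (fun q => g q + h q).
Proof. by move=> ig ih; have := integrableD measurableT ig ih. Qed.

Lemma integ3B g h : integ3 g -> integ3 h -> integ3 (fun q => g q - h q).
Proof. by move=> ig ih; have := integrableB measurableT ig ih. Qed.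

Lemma integ3Z (k : R) g : integ3 g -> integ3 (fun q => k * g q).
Proof. by move=> ig; have := integrableZl measurableT k ig. Qed.

Lemma integ3_norm g : integ3 g -> integ3 (fun q => `|g q|).
Proof. by move=> ig; have := integrable_abse ig. Qed.

Lemma eq_integ3 g h : g =1 h -> integ3 g -> integ3 h.
Proof. by move=> /funext ->. Qed.

Lemma eq_int3 g h : g =1 h -> int3 g = int3 h.
Proof. by move=> /funext ->. Qed.

Lemma int3D g h : integ3 g -> integ3 h -> int3 (fun q => g q + h q) = int3 g + int3 h.
Proof. by move=> ig ih; rewrite /int3 RintegralD. Qed.

Lemma int3B g h : integ3 g -> integ3 h -> int3 (fun q => g q - h q) = int3 g - int3 h.
Proof. by move=> ig ih; rewrite /int3 RintegralB. Qed.

Lemma int3Z k g : integ3 g -> int3 (fun q => k * g q) = k * int3 g.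
Proof. by move=> ig; rewrite /int3 RintegralZl. Qed.

Lemma le_int3 g h : integ3 g -> integ3 h -> (forall q, g q <= h q) -> int3 g <= int3 h.
Proof. by move=> ig ih gh; rewrite /int3; apply: le_Rintegral. Qed.

Lemma int3_ge0 g : (forall q, 0 <= g q) -> 0 <= int3 g.
Proof. by move=> g0; rewrite /int3; apply: Rintegral_ge0. Qed.

Lemma norm_int3 g : integ3 g -> `|int3 g| <= int3 (fun q => `|g q|).
Proof. by move=> ig; rewrite /int3; apply: le_normr_Rintegral. Qed.

Lemma EFin_int3 g : integ3 g -> (int3 g)%:E = (\int[leb3]_z (g (vec3 z))%:E)%E.
Proof. by move=> ig; rewrite /int3 /Rintegral fineK//; exact: integrable_fin_num. Qed.

(** For nonnegative functions a bound on the extended integral already gives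
integrability. *)
Lemma integ3_ge0P g (C : R) : meas3 g -> (forall q, 0 <= g q) ->
  (\int[leb3]_z (g (vec3 z))%:E <= C%:E)%E -> integ3 g /\ int3 g <= C.
Proof.
move=> mg g0 hC.
have ig : integ3 g.
  apply/integrableP; split; first exact/measurable_EFinP.
  apply: le_lt_trans (ltry C); apply: le_trans hC.
  rewrite le_eqVlt; apply/orP; left; apply/eqP; apply: eq_integral => z _.
  by rewrite gee0_abs// lee_fin.
by split => //; rewrite -lee_fin EFin_int3.
Qed.

Lemma int3_cube (p : V) r : 0 < r ->
  integ3 (\1_[set q | `|q - p| < r]) /\ int3 (\1_[set q | `|q - p| < r]) = (2 * r) ^+ 3.
Proof.
move=> r0; have mc := measurable_cube p r.
have E : (\int[leb3]_z ((\1_[set q | `|q - p| < r] : V -> R) (vec3 z))%:E)%E = ((2 * r) ^+ 3)%:E.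
  rewrite -(leb3_cube p)// (_ : (fun z => _) =
    (fun z => (\1_((@vec3 R) @^-1` [set q | `|q - p| < r]) z)%:E))//.
  by rewrite integral_indic// setIT.
have m1 : meas3 (\1_[set q | `|q - p| < r] : V -> R).
  rewrite /meas3 (_ : (fun z => _) = \1_((@vec3 R) @^-1` [set q | `|q - p| < r]))//.
have [] := integ3_ge0P m1 _ (_ : _ <= ((2 * r) ^+ 3)%:E)%E.
- by move=> q; rewrite indicE.
- by rewrite E.
move=> ii _; split => //.
by apply/EFin_inj; rewrite EFin_int3.
Qed.

Lemma int3_cvg (G : nat -> V -> R) g h :
  (forall n, meas3 (G n)) -> integ3 h -> (forall n q, `|G n q| <= h q) ->
  (forall q, G n q @[n --> \oo] --> g q) ->
  integ3 g /\ int3 (G n) @[n --> \oo] --> int3 g.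
Proof.
move=> mG ih Gh Gg.
have mg : measurable_fun [set: T3] (fun z => (g (vec3 z))%:E).
  apply: (emeasurable_fun_cvg (fun n z => (G n (vec3 z))%:E)).
    by move=> n; apply/measurable_EFinP; exact: mG.
  by move=> z _; apply: cvg_EFin; [exact: nearW|exact: Gg].
have [|||ig _ cv] := @dominated_convergence _ _ _ (@leb3 R) setT measurableT
   (fun n z => (G n (vec3 z))%:E) (fun z => (g (vec3 z))%:E) (fun z => (h (vec3 z))%:E)
   (fun n => (measurable_EFinP _ _).2 (mG n)) mg.
- by apply/aeW => z _; apply: cvg_EFin; [exact: nearW|exact: Gg].
- exact: ih.
- by apply/aeW => z n _; rewrite /= lee_fin.
split => //; rewrite /int3 /Rintegral; apply: fine_cvg.
by move: cv; rewrite -EFin_int3// /int3 /Rintegral fineK//; exact: integrable_fin_num.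
Qed.

End Integrals.

(** * The divergence theorem for compactly supported functions *)

Section Divergence.
Variable R : realType.
Notation V := 'rV[R]_3.
Local Notation T3 := (measurableTypeR R * measurableTypeR R * measurableTypeR R)%type.
Local Notation mu := (@lebesgue_measure R).
Local Notation mu2 := ((@lebesgue_measure R) \x (@lebesgue_measure R))%E.

Lemma near_norm_gt (W : normedModType R) (s : W) (A : R) :
  A < `|s| -> \forall y \near s, A < `|y|.
Proof.
by move=> h; have := @norm_continuous _ W s; move=> /cvgr_gt; apply.
Qed.

(** The fundamental theorem of calculus on an interval that contains the support. *)
Lemma integral_derive_compact (g dg : R -> R) (A : R) : 0 < A ->
  (forall s : R, is_derive s (1:R) g (dg s)) -> continuous dg ->
  (forall s, A <= `|s| -> g s = 0) -> (\int[mu]_s (dg s)%:E = 0)%E.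
Proof.
move=> A0 dgP cdg g0.
have cg : continuous g.
  by move=> s; apply/differentiable_continuous/derivable1_diffP; case: (dgP s).
have dg0 s : A < `|s| -> dg s = 0.
  move=> As; have := dgP s => -[_ <-].
  rewrite (@near_eq_derive _ _ _ _ (cst 0)) ?derive_cst//.
  by near=> y; apply: g0; apply: ltW; near: y; exact: (@near_norm_gt R^o s A As).
have A2 : - A < A by rewrite gtrN.
have -> : (\int[mu]_s (dg s)%:E = \int[mu]_(s in `[(- A)%R, A]) (dg s)%:E)%E.
  rewrite [RHS]integral_mkcond; apply: eq_integral => s _.
  rewrite patchE; case: ifPn => //; rewrite notin_setE /= in_itv /= => /negP h.
  by rewrite dg0 ?ltNge ?ler_norml//; apply/negP => /h.
rewrite (@continuous_FTC2 _ dg g)//.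
- by rewrite !g0 ?subee//= ?normrN gtr0_norm.
- exact: continuous_subspaceT.
- split; first by move=> x _; case: (dgP x).
  + by apply: cvg_at_right_filter; exact: cg.
  + by apply: cvg_at_left_filter; exact: cg.
- by move=> x _; rewrite derive1E; case: (dgP x).
Unshelve. all: by end_near. Qed.

Lemma compact_cube (A : R) : compact [set q : V | `|q| <= A].
Proof.
apply: bounded_closed_compact.
  by exists A; split; [exact: num_real|move=> M AM q /= /le_trans]; apply; exact: ltW.
rewrite (_ : [set _ | _] = (fun q : V => `|q|) @^-1` [set y | y <= A])//.
by apply: closed_comp; [move=> ? _; exact: norm_continuous|exact: closed_le].
Qed.

Lemma bounded_on_cube (g : V -> R) (A : R) : continuous g ->
  exists2 C, 0 <= C & forall q, `|q| <= A -> `|g q| <= C.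
Proof.
move=> cg; have [A0|A0] := ltP A 0.
  by exists 0 => // q h; have := le_lt_trans h A0; rewrite normr_lt0.
have [c _ hc] : exists2 c, c \in [set q : V | `|q| <= A] &
   forall t, t \in [set q : V | `|q| <= A] -> `|g t| <= `|g c|.
  apply: (@compact_EVT_max _ R (fun q => `|g q|)); [by exists 0; rewrite /= normr0|exact: compact_cube|].
  apply: continuous_subspaceT => x.
  by apply: continuous_comp; [exact: cg|exact: norm_continuous].
by exists `|g c| => // q hq; apply: hc; rewrite inE.
Qed.

Lemma line_vec3_0 (a b c h : R) : vec3 ((h + a, b), c) = h *: basis3 i0 + vec3 ((a, b), c).
Proof. by apply/rowP; apply: ord3P; rewrite !mxE/=; ring. Qed.
Lemma line_vec3_1 (a b c h : R) : vec3 ((a, h + b), c) = h *: basis3 i1 + vec3 ((a, b), c).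
Proof. by apply/rowP; apply: ord3P; rewrite !mxE/=; ring. Qed.
Lemma line_vec3_2 (a b c h : R) : vec3 ((a, b), h + c) = h *: basis3 i2 + vec3 ((a, b), c).
Proof. by apply/rowP; apply: ord3P; rewrite !mxE/=; ring. Qed.

Lemma integ3_compact (g : V -> R) (A : R) : 0 < A -> continuous g ->
  (forall q, A <= `|q| -> g q = 0) -> integ3 g.
Proof.
move=> A0 cg g0; have [C C0 hC] := bounded_on_cube A cg.
have [ii _] := int3_cube (0 : V) A0.
apply: (integ3_le (meas3_continuous cg) (integ3Z C ii)) => q.
rewrite indicE; case: (boolP (q \in _)); rewrite ?notin_setE ?inE /= subr0.
  by move=> h; rewrite mulr1 hC// ltW.
by move=> /negP; rewrite -leNgt => /g0 ->; rewrite normr0 mulr0.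
Qed.

(** A copy of the planar measure that can carry the sigma-finiteness instance
required by the Fubini theorems. *)
Definition leb2 : set (measurableTypeR R * measurableTypeR R)%type -> \bar R := mu2.

HB.instance Definition _ := Measure.copy leb2 mu2.

Lemma leb2_sigma_finite : sigma_finite setT leb2.
Proof.
pose I n : set (measurableTypeR R) := `]0 - n.+1%:R, 0 + n.+1%:R[%classic.
exists (fun n => I n `*` I n).
  apply/seteqP; split => // -[a b] _ /=.
  exists (Num.truncn (`|a| + `|b|)) => //; rewrite /I /= !in_itv /= !sub0r !add0r -!ltr_norml.
  have h : `|a| + `|b| < (Num.truncn (`|a| + `|b|)).+1%:R by rewrite truncnS_gt.
  have ha : `|a : R| <= `|a : R| + `|b : R| by rewrite lerDl.
  have hb : `|b : R| <= `|a : R| + `|b : R| by rewrite lerDr.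
  by split; [exact: le_lt_trans ha h|exact: le_lt_trans hb h].
move=> n; split; first by rewrite /I; apply: measurableX; exact: measurable_itv.
by rewrite /leb2 /I leb2E// !leb_itv// -EFinM ltry.
Qed.

HB.instance Definition _ := Measure_isSigmaFinite.Build _ _ _ leb2 leb2_sigma_finite.

Lemma int3_iter2 (g : V -> R) : integ3 g ->
  (int3 g)%:E = (\int[mu]_c \int[leb2]_ab (g (vec3 (ab, c)))%:E)%E.
Proof.
move=> ig; rewrite EFin_int3//.
by rewrite -(integral21_prod_meas1 (m1:=leb2) (m2:=mu) ig).
Qed.

Lemma int3_iter1 (g : V -> R) : integ3 g ->
  (int3 g)%:E = (\int[leb2]_ab \int[mu]_c (g (vec3 (ab, c)))%:E)%E.
Proof.
move=> ig; rewrite EFin_int3//.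
by rewrite -(integral12_prod_meas1 (m1:=leb2) (m2:=mu) ig).
Qed.

Lemma continuous_vec3_line (a0 : V) (e : V) : continuous (fun s : R => s *: e + a0).
Proof.
by move=> s; apply: cvgD; [apply: cvgZr_tmp; exact: cvg_id|exact: cvg_cst].
Qed.

Lemma integrable_slice (g : V -> R) (A c : R) : 0 < A -> continuous g ->
  (forall q, A <= `|q| -> g q = 0) ->
  leb2.-integrable setT (fun ab => (g (vec3 (ab, c)))%:E).
Proof.
move=> A0 cg g0; have [C C0 hC] := bounded_on_cube A cg.
pose I : set (measurableTypeR R) := `]0 - A, 0 + A[%classic.
have mI : measurable (I `*` I) by rewrite /I; apply: measurableX; exact: measurable_itv.
have iI : leb2.-integrable setT (fun ab => C%:E * (\1_(I `*` I) ab)%:E)%E.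
  apply: integrableZl => //; apply/integrableP; split.
    by apply/measurable_EFinP; exact: measurable_indic.
  under eq_integral do rewrite gee0_abs ?lee_fin//.
  rewrite integral_indic// setIT.
  have lI : leb2 (I `*` I) = (2 * A * (2 * A))%:E.
    by rewrite /leb2 /I leb2E// !leb_itv// -EFinM.
  by apply: le_lt_trans (ltry (2 * A * (2 * A))); rewrite -lI.
apply: (le_integrable _ _ _ iI) => //.
  apply/measurable_EFinP.
  exact: (measurable_fun_pair1 (f := fun z => g (vec3 z)) c (meas3_continuous cg)).
move=> [a b] _; rewrite -EFinM !abse_EFin lee_fin.
rewrite [leRHS]ger0_norm; last by rewrite mulr_ge0.
have [h|h] := ltP `|vec3 (a, b, c)| A; last by rewrite g0// normr0 mulr_ge0.
rewrite indicE mem_set ?mulr1 ?hC ?ltW//.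
move: h => /(vnorm_ltP _ A0) h; rewrite /I /= !in_itv /= !sub0r !add0r -!ltr_norml.
by split; [move: (h i0)|move: (h i1)]; rewrite mxE.
Qed.

Lemma int_slice_derive (F : V -> R) (A : R) (e a0 : V) : 0 < A ->
  (forall q, derivable F q e) -> continuous ('D_e F) ->
  (forall s, A <= `|s| -> F (s *: e + a0) = 0) ->
  (\int[mu]_s ('D_e F (s *: e + a0))%:E = 0)%E.
Proof.
move=> A0 dF cF F0.
apply: (@integral_derive_compact (fun s => F (s *: e + a0)) _ A) => //.
- by move=> s; apply: (is_derive_line F e a0 s _).1; exact: derivableP.
- by move=> s; apply: (@continuous_comp _ _ _ (fun s : R => s *: e + a0) ('D_e F));
    [exact: continuous_vec3_line|exact: cF].
Qed.

(** By Fubini one may integrate first along the direction of differentiation,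
where the fundamental theorem of calculus gives 0. *)
Lemma int3_derive_compact (F : V -> R) (A : R) (j : 'I_3) : 0 < A ->
  (forall q, derivable F q (basis3 j)) -> continuous ('D_(basis3 j) F) ->
  (forall q, A <= `|q| -> F q = 0) ->
  integ3 ('D_(basis3 j) F) /\ int3 ('D_(basis3 j) F) = 0.
Proof.
move=> A0 dF cF F0.
have A1 : 0 < A + 1 by exact: addr_gt0.
have dF0 q : A + 1 <= `|q| -> 'D_(basis3 j) F q = 0.
  move=> hq; have Aq : A < `|q| by apply: lt_le_trans hq; rewrite ltrDl.
  rewrite -(derive_cst (0:R) q (basis3 j)).
  apply: near_eq_derive; near=> y; apply: F0; apply: ltW; near: y.
  exact: (@near_norm_gt V q A Aq).
have iF : integ3 ('D_(basis3 j) F) by exact: (integ3_compact A1).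
split => //; apply/EFin_inj.
have big (q : V) i s : A <= `|s| -> q 0 i = s -> F q = 0.
  by move=> h E; apply: F0; apply: le_trans h _; rewrite -E le_vnorm.
have sl c : leb2.-integrable setT (fun ab => ('D_(basis3 j) F (vec3 (ab, c)))%:E).
  exact: (integrable_slice c A1 cF dF0).
elim/ord3P: j dF cF iF dF0 sl => dF cF iF _ sl.
- rewrite int3_iter2//; apply: integral0_eq => c _.
  have E0 : forall b : R, (\int[mu]_a ('D_(basis3 i0) F (vec3 (a, b, c)))%:E = 0)%E.
    move=> b; under eq_integral do rewrite -[X in vec3 (X, _, _)]addr0 line_vec3_0.
    apply: (int_slice_derive A0) => // s hs.
    by apply: (big _ i0 s) => //; rewrite !mxE/=; ring.
  rewrite -(integral21_prod_meas1 (m1:=mu) (m2:=mu)); last exact: sl.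
  by apply: integral0_eq => b _; rewrite /fubini_G E0.
- rewrite int3_iter2//; apply: integral0_eq => c _.
  have E0 : forall a : R, (\int[mu]_b ('D_(basis3 i1) F (vec3 (a, b, c)))%:E = 0)%E.
    move=> a; under eq_integral do rewrite -[X in vec3 (_, X, _)]addr0 line_vec3_1.
    apply: (int_slice_derive A0) => // s hs.
    by apply: (big _ i1 s) => //; rewrite !mxE/=; ring.
  rewrite -(integral12_prod_meas1 (m1:=mu) (m2:=mu)); last exact: sl.
  by apply: integral0_eq => b _; rewrite /fubini_F E0.
- rewrite int3_iter1//; apply: integral0_eq => -[a b] _.
  under eq_integral do rewrite -[X in vec3 (_, X)]addr0 line_vec3_2.
  apply: (int_slice_derive A0) => // s hs.
  by apply: (big _ i2 s) => //; rewrite !mxE/=; ring.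
Unshelve. all: by end_near. Qed.
End Divergence.

(** * Integrability of the Newton potential *)

Section SingularIntegral.
Variable R : realType.
Notation V := 'rV[R]_3.
Local Notation cube p r := [set q : V | `|q - p| < r].

Lemma continuous_dist (p : V) : continuous (fun q : V => `|q - p|).
Proof.
move=> x; apply: (@continuous_comp _ _ _ (fun q : V => q - p) (fun q => `|q|)).
  by apply: (@cvgB R V V (nbhs x) _ id (cst p)); [exact: cvg_id|exact: cvg_cst].
exact: norm_continuous.
Qed.

Lemma open_cube (p : V) r : open (cube p r).
Proof.
rewrite (_ : [set q | _] = (fun q : V => `|q - p|) @^-1` [set y | y < r])//.
apply: open_comp; last exact: open_lt.
by move=> x _; exact: continuous_dist.
Qed.

Lemma meas3M (g h : V -> R) : meas3 g -> meas3 h -> meas3 (fun q => g q * h q).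
Proof. by move=> mg mh; exact: measurable_funM. Qed.

Lemma meas3_inv (g : V -> R) : meas3 g -> (forall q, 0 <= g q) -> meas3 (fun q => (g q)^-1).
Proof.
move=> mg g0; rewrite (_ : (fun q => _) = (fun q => g q `^ (-1))); last first.
  by apply/funext => q; rewrite powR_inv1.
exact: (measurableT_comp (measurable_powR (-1)) mg).
Qed.

Lemma meas3_dist (p : V) : meas3 (fun q => `|q - p|).
Proof.
exact: (meas3_continuous (@continuous_dist p)).
Qed.

(** The Newton potential truncated at distance r. It carries the whole singularity
of the collision kernel. *)
Definition newton (p : V) (r : R) (q : V) : R := \1_(cube p r) q * `|q - p|^-1.

Lemma newtonE p r q : newton p r q = if `|q - p| < r then `|q - p|^-1 else 0.
Proof.
rewrite /newton indicE; case: ifPn => h; first by rewrite mem_set// mul1r.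
by rewrite memNset ?mul0r//= => /(elimN idP h).
Qed.

Lemma newton_ge0 p r q : 0 <= newton p r q.
Proof. by rewrite newtonE; case: ifP. Qed.

(** Locates x between two consecutive scales r / 2^n. *)
Lemma dyadic_scale (x r : R) : 0 < x -> x < r ->
  exists n, x < r / 2 ^+ n /\ x^-1 <= 2 ^+ n.+1 / r.
Proof.
move=> x0 xr; have r0 := lt_trans x0 xr.
have hex : exists n, r / 2 ^+ n.+1 <= x.
  exists (Num.truncn (r / x)); rewrite ler_pdivrMr ?exprn_gt0// mulrC -ler_pdivrMr//.
  apply: ltW; apply: lt_le_trans (truncnS_gt _) _.
  by rewrite -natrX ler_nat; apply: ltnW; exact: ltn_expl.
have [n hn mn] := ex_minnP hex; exists n; split.
  case: n hn mn => [|n] hn mn; first by rewrite expr0 divr1.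
  by rewrite ltNge; apply/negP => /mn; rewrite ltnn.
by rewrite -[leRHS]invrK invf_div lef_pV2// posrE divr_gt0 ?exprn_gt0.
Qed.

(** The cube of radius r / 2^n has volume O(r^3 / 8^n) and the potential is
O(2^n / r) on its boundary, so that the dyadic contributions are summable. *)
Lemma newton_int p r : 0 < r -> integ3 (newton p r) /\ int3 (newton p r) <= 32 * r ^+ 2.
Proof.
move=> r0; have mn : meas3 (newton p r).
  by apply: meas3M; [apply: meas3_indic; exact: open_cube|apply: meas3_inv => //; exact: meas3_dist].
apply: integ3_ge0P => //; first exact: newton_ge0.
pose c n : R := 2 ^+ n.+1 / r.
pose F n (q : V) : R := c n * \1_(cube p (r / 2 ^+ n)) q.
have rn n : 0 < r / 2 ^+ n :> R by rewrite divr_gt0// exprn_gt0.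
have c0 n : 0 <= c n by rewrite /c divr_ge0 ?exprn_ge0// ltW.
have iF n : integ3 (F n) by apply: integ3Z; exact: (int3_cube p (rn n)).1.
have F0 n q : 0 <= F n q by rewrite mulr_ge0// indicE.
have le_F q : ((newton p r q)%:E <= \sum_(n <oo) (F n q)%:E)%E.
  rewrite newtonE; case: ifPn => [h|_]; last first.
    by apply: nneseries_ge0 => n _ _; rewrite lee_fin.
  have [->|qp] := eqVneq (q - p) 0.
    by rewrite normr0 invr0; apply: nneseries_ge0 => n _ _; rewrite lee_fin.
  have [||n [hn1 hn2]] := @dyadic_scale `|q - p| r => //.
    by rewrite normr_gt0.
  apply: le_trans (nneseries_lim_ge n.+1 _); last by move=> k _ _; rewrite lee_fin.
  rewrite big_nat_recr//= -[leLHS]add0e leeD//.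
    by apply: sume_ge0 => k _; rewrite lee_fin.
  by rewrite lee_fin /F indicE mem_set ?mulr1.
apply: (@le_trans _ _ (\int[leb3]_z \sum_(n <oo) (F n (vec3 z))%:E)%E).
  apply: ge0_le_integral => //.
  - by move=> z _; rewrite lee_fin newton_ge0.
  - exact/measurable_EFinP.
  - apply: ge0_emeasurable_sum => [n z _ _|n _]; first by rewrite lee_fin.
    by case/integrableP: (iF n).
rewrite integral_nneseries//; last 2 first.
  - by move=> n; case/integrableP: (iF n).
  - by move=> n z _; rewrite lee_fin.
apply: le_trans (epsilon_trick0 xpredT (_ : 0 <= 32 * r ^+ 2)); last first.
  by rewrite mulr_ge0// exprn_ge0// ltW.
apply: lee_nneseries => [n _ _|n _].
  by apply: integral_ge0 => z _; rewrite lee_fin.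
rewrite -EFin_int3// lee_fin /F int3Z; last exact: (int3_cube p (rn n)).1.
rewrite (int3_cube p (rn n)).2 /c.
have e2 : 0 < 2 ^+ n :> R by rewrite exprn_gt0.
have e1 : 1 <= 2 ^+ n :> R by rewrite exprn_ege1// ler1n.
rewrite natrX exprSr.
have -> : 2 ^+ n * 2 / r * (2 * (r / 2 ^+ n)) ^+ 3 = 16 * r ^+ 2 / (2 ^+ n * 2 ^+ n).
  by field; rewrite !gt_eqF.
have -> : 32 * r ^+ 2 / (2 ^+ n * 2) = 16 * r ^+ 2 / 2 ^+ n.
  by field; rewrite !gt_eqF.
rewrite ler_pM2l ?lef_pV2 ?posrE ?mulr_gt0 ?exprn_gt0//.
by rewrite ler_pMr.
Qed.
End SingularIntegral.

Section ShearedBoxes.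
Variable R : realType.
Notation V := 'rV[R]_3.
Local Notation T1 := (measurableTypeR R).
Local Notation mu := (@lebesgue_measure R).

Definition ival (c r : R) (x : R) : R := \1_(`]c - r, c + r[%classic : set R) x.

Lemma ivalE c r x : ival c r x = (`|x - c| < r)%R%:R.
Proof.
rewrite /ival indicE; congr (nat_of_bool _)%:R.
by apply/idP/idP; rewrite inE /= in_itv/= ltr_distl.
Qed.

Lemma ival_ge0 c r x : (0 <= ival c r x)%R.
Proof. by rewrite ivalE. Qed.

Lemma ival_meas c r : measurable_fun [set: T1] (ival c r).
Proof. exact: measurable_indic. Qed.

Local Open Scope ereal_scope.
Lemma int_ival c r : (0 < r)%R -> \int[mu]_x (ival c r x)%:E = (2 * r)%:E.
Proof.
by move=> r0; rewrite integral_indic//= setIT; rewrite leb_itv.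
Qed.

Lemma int_ivalZ c r k : (0 < r)%R -> (0 <= k)%R ->
  \int[mu]_x (k * ival c r x)%:E = (k * (2 * r))%:E.
Proof.
move=> r0 k0; under eq_integral do rewrite EFinM.
rewrite ge0_integralZl_EFin//.
- by rewrite int_ival.
- by move=> x _; rewrite lee_fin ival_ge0.
- by apply/measurable_EFinP; exact: ival_meas.
Qed.

Section bound.
Variables (g : V -> R) (c0 c2 a b : R) (c : R -> R -> R).
Hypotheses (a0 : (0 < a)%R) (b0 : (0 < b)%R) (mg : meas3 g) (g0 : forall q, (0 <= g q)%R).

Let mslice z : measurable_fun [set: T1 * T1] (fun xy => (g (vec3 (xy, z)))%:E).
Proof.
apply/measurable_EFinP.
exact: (measurable_fun_pair1 (f := fun z => g (vec3 z)) z mg).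
Qed.

Let outer (k : R -> R) : (forall z, k z = ival c2 a z * (4 * a * b))%R ->
  (forall z, \int[@leb2 R]_xy (g (vec3 (xy, z)))%:E <= (k z)%:E) ->
  integ3 g /\ (int3 g <= 8 * a ^+ 2 * b)%R.
Proof.
move=> kE kP; apply: integ3_ge0P => //.
have mG : measurable_fun setT (fun z => (g (vec3 z))%:E) by exact/measurable_EFinP.
have G0 z : 0 <= (g (vec3 z))%:E by rewrite lee_fin.
rewrite [leLHS](fubini_tonelli2 (m1 := @leb2 R) (m2 := mu) _ mG G0).
have -> : (8 * a ^+ 2 * b)%:E = \int[mu]_z (k z)%:E.
  under eq_integral do rewrite kE mulrC.
  by rewrite int_ivalZ// ?mulr_ge0 ?ltW//; congr EFin; ring.
apply: ge0_le_integral => //.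
- by move=> z _; apply: integral_ge0.
- exact: (measurable_fun_fubini_tonelli_G (m1 := @leb2 R) _ mG).
- apply/measurable_EFinP; rewrite (_ : k = (fun z => ival c2 a z * (4 * a * b))%R); last exact/funext.
  by apply: measurable_funM => //; exact: ival_meas.
- by move=> z _; exact: kP.
Qed.

(** A shear preserves volume: the middle coordinate is integrated first, over an
interval whose centre may depend on the other two. *)
Lemma sheared_box_mid :
  (forall x y z : R, (g (vec3 (x, y, z)) <= ival c0 a x * ival c2 a z * ival (c x z) b y)%R) ->
  integ3 g /\ (int3 g <= 8 * a ^+ 2 * b)%R.
Proof.
move=> gle; apply: (outer (k := fun z => ival c2 a z * (4 * a * b))%R) => // z.
have G0 xy : 0 <= (g (vec3 (xy, z)))%:E by rewrite lee_fin.
rewrite [leLHS](fubini_tonelli1 (m1 := mu) (m2 := mu) _ (mslice z) G0).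
apply: (@le_trans _ _ (\int[mu]_x ((ival c2 a z * (2 * b)) * ival c0 a x)%:E)); last first.
  rewrite int_ivalZ//; last by rewrite !mulr_ge0 ?ival_ge0// ltW.
  by rewrite lee_fin le_eqVlt; apply/orP; left; apply/eqP; ring.
apply: ge0_le_integral => //.
- by move=> x _; apply: integral_ge0.
- exact: (measurable_fun_fubini_tonelli_F (m2 := mu) _ (mslice z)).
- by apply/measurable_EFinP; apply: measurable_funM => //; exact: ival_meas.
move=> x _; rewrite /fubini_F.
have -> : (ival c2 a z * (2 * b) * ival c0 a x)%:E =
    \int[mu]_y (ival c0 a x * ival c2 a z * ival (c x z) b y)%:E.
  by rewrite int_ivalZ ?mulr_ge0 ?ival_ge0//; congr EFin; ring.
apply: ge0_le_integral => //.
- apply/measurable_EFinP.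
  by have /measurable_EFinP := mslice z; move/measurable_fun_pair2; apply.
- by apply/measurable_EFinP; apply: measurable_funM => //; exact: ival_meas.
- by move=> y _; rewrite lee_fin.
Qed.

(** The same with the first coordinate sheared. *)
Lemma sheared_box_left :
  (forall x y z : R, (g (vec3 (x, y, z)) <= ival c0 a y * ival c2 a z * ival (c y z) b x)%R) ->
  integ3 g /\ (int3 g <= 8 * a ^+ 2 * b)%R.
Proof.
move=> gle; apply: (outer (k := fun z => ival c2 a z * (4 * a * b))%R) => // z.
have G0 xy : 0 <= (g (vec3 (xy, z)))%:E by rewrite lee_fin.
rewrite [leLHS](fubini_tonelli2 (m1 := mu) (m2 := mu) _ (mslice z) G0).
apply: (@le_trans _ _ (\int[mu]_x ((ival c2 a z * (2 * b)) * ival c0 a x)%:E)); last first.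
  rewrite int_ivalZ//; last by rewrite !mulr_ge0 ?ival_ge0// ltW.
  by rewrite lee_fin le_eqVlt; apply/orP; left; apply/eqP; ring.
apply: ge0_le_integral => //.
- by move=> x _; apply: integral_ge0.
- exact: (measurable_fun_fubini_tonelli_G (m1 := mu) _ (mslice z)).
- by apply/measurable_EFinP; apply: measurable_funM => //; exact: ival_meas.
move=> y _; rewrite /fubini_G.
have -> : (ival c2 a z * (2 * b) * ival c0 a y)%:E =
    \int[mu]_x (ival c0 a y * ival c2 a z * ival (c y z) b x)%:E.
  by rewrite int_ivalZ ?mulr_ge0 ?ival_ge0//; congr EFin; ring.
apply: ge0_le_integral => //.
- apply/measurable_EFinP.
  by have /measurable_EFinP := mslice z; move/measurable_fun_pair1; apply.
- by apply/measurable_EFinP; apply: measurable_funM => //; exact: ival_meas.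
- by move=> x _; rewrite lee_fin.
Qed.
End bound.
End ShearedBoxes.

(** * Algebra of the collision kernel *)

Section Kernel.
Variable R : realType.
Notation V := 'rV[R]_3.
Implicit Types (p q : V) (i j k : 'I_3).

(** This is tau - 1, the relative Lorentz factor of the two momenta; rho = 1
exactly on the diagonal. *)
Definition rho p q : R := jbracket p * jbracket q - dotv p q.

Definition cross p q : V := vec3 ((p 0 i1 * q 0 i2 - p 0 i2 * q 0 i1,
  p 0 i2 * q 0 i0 - p 0 i0 * q 0 i2), p 0 i0 * q 0 i1 - p 0 i1 * q 0 i0).

Definition nsq p : R := dotv p p.

Lemma dotvE p q : dotv p q = p 0 i0 * q 0 i0 + p 0 i1 * q 0 i1 + p 0 i2 * q 0 i2.
Proof. by rewrite /dotv sum3. Qed.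

Lemma nsqE p : nsq p = p 0 i0 ^+ 2 + p 0 i1 ^+ 2 + p 0 i2 ^+ 2.
Proof. by rewrite /nsq dotvE !expr2. Qed.

Lemma nsq_ge0 p : 0 <= nsq p.
Proof. by rewrite nsqE !addr_ge0// sqr_ge0. Qed.

Lemma jb_sqr p : jbracket p ^+ 2 = 1 + (p 0 i0 ^+ 2 + p 0 i1 ^+ 2 + p 0 i2 ^+ 2).
Proof. by rewrite sqr_sqrtr -?nsqE// addr_ge0// nsq_ge0. Qed.

Lemma jb_ge1 p : 1 <= jbracket p.
Proof.
by rewrite -[leLHS]sqrtr1 ler_sqrt; rewrite ?lerDl ?addr_ge0 ?nsq_ge0.
Qed.

Lemma jb_gt0 p : 0 < jbracket p.
Proof. exact: lt_le_trans ltr01 (jb_ge1 p). Qed.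

Lemma jb_neq0 p : jbracket p != 0.
Proof. by rewrite gt_eqF// jb_gt0. Qed.

Lemma rhoC p q : rho p q = rho q p.
Proof. by rewrite /rho !dotvE; ring. Qed.

Lemma tauE p q : tauRL p q = rho p q + 1.
Proof. by []. Qed.

(** The entries of S in terms of rho: tau (tau - 2) = rho^2 - 1 and tau - 2 = rho - 1. *)
Definition Sm p q i j : R :=
  (rho p q ^+ 2 - 1) * (i == j)%:R - (p 0 i - q 0 i) * (p 0 j - q 0 j)
  + (rho p q - 1) * (p 0 i * q 0 j + p 0 j * q 0 i).

Lemma SRLE p q i j : SRL p q i j = Sm p q i j.
Proof. by rewrite mxE tauE /Sm; ring. Qed.

Lemma SmC p q i j : Sm p q i j = Sm p q j i.
Proof. by rewrite /Sm (eq_sym i); ring. Qed.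

Lemma Sm_swap p q i j : Sm p q i j = Sm q p i j.
Proof. by rewrite /Sm (rhoC q); ring. Qed.

Local Ltac coords p q :=
  have := jb_sqr p; have := jb_sqr q; rewrite /rho ?dotvE ?mxE /=;
  move: (jbracket p) (jbracket q) (p 0 i0) (p 0 i1) (p 0 i2) (q 0 i0) (q 0 i1) (q 0 i2) => P Q a0 a1 a2 b0 b1 b2 hQ hP.

(** The gradient of rho in p is (Q p - P q) / P, and S is degenerate in this
direction. It is the reason why no derivative of the radial profile appears in
the divergence of the kernel. *)
Lemma S_grad_rho p q j :
  \sum_(i < 3) (jbracket q * p 0 i - jbracket p * q 0 i) * Sm p q i j = 0.
Proof.
by rewrite sum3; elim/ord3P: j; rewrite /Sm /=; coords p q; ring: hP hQ.
Qed.

Lemma S_pp p q :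
  \sum_(i < 3) \sum_(j < 3) Sm p q i j * (p 0 i * p 0 j) = jbracket p ^+ 2 * nsq (cross p q).
Proof. by rewrite nsqE !sum3 /Sm /=; coords p q; ring: hP hQ. Qed.

Lemma S_trace p q : \sum_(i < 3) Sm p q i i = 2 * (rho p q ^+ 2 - 1) + nsq (cross p q).
Proof. by rewrite nsqE !sum3 /Sm /= ; coords p q; ring: hP hQ. Qed.

Lemma nsq_cross p q : nsq (cross p q) =
  2 * rho p q * jbracket p * jbracket q - jbracket p ^+ 2 - jbracket q ^+ 2 - rho p q ^+ 2 + 1.
Proof. by rewrite nsqE; coords p q; ring: hP hQ. Qed.

(** Difference of squares: (P Q)^2 - (1 + p.q)^2 is |q - p|^2 + |p x q|^2. *)
Lemma rho1E p q : (rho p q - 1) * (jbracket p * jbracket q + dotv p q + 1) =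
  nsq (q - p) + nsq (cross p q).
Proof. by rewrite !nsqE; coords p q; ring: hP hQ. Qed.

(** S is the sum of the squares of these three vectors: the cross products of
Q p - P q with the basis, corrected by multiples of p x q. *)
Definition eta p q k : V :=
  cross (jbracket q *: p - jbracket p *: q) (basis3 k) - (p 0 k / (jbracket p + 1)) *: cross p q.

(** Positivity of S in a form that applies the second derivative test direction
by direction. *)
Lemma S_squares p q i j : Sm p q i j = \sum_(k < 3) eta p q k 0 i * eta p q k 0 j.
Proof.
have h : jbracket p + 1 != 0 by rewrite gt_eqF// addr_gt0// jb_gt0.
have e : forall x y z : R, x *: (z *: (1 : R)) = x * z by move=> *; rewrite -[_ *: _]/(_ * (_ * 1)) mulr1.
rewrite sum3 /eta; elim/ord3P: i; elim/ord3P: j; rewrite /Sm /= !mxE /= ?mxE /=;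
 move: h; coords p q => h; field: hP hQ => //.
Qed.
End Kernel.

(** * Directional derivatives and the regularised profile *)

Section DirectionalCalculus.
Variables (R : realType) (W : normedModType R).
Implicit Types (f g : W -> R) (x v : W).

(** Rules for derivatives at a point of pointwise defined functions. *)
Lemma dvC x v (c : R) : is_derive x v (fun=> c) 0.
Proof. exact: is_derive_cst. Qed.

Lemma dvD x v f g df dg : is_derive x v f df -> is_derive x v g dg ->
  is_derive x v (fun y => f y + g y) (df + dg).
Proof. by move=> h1 h2; exact: (@is_deriveD _ _ _ f g). Qed.

Lemma dvN x v f df : is_derive x v f df -> is_derive x v (fun y => - f y) (- df).
Proof. by move=> h1; exact: (@is_deriveN _ _ _ f). Qed.

Lemma dvM x v f g df dg : is_derive x v f df -> is_derive x v g dg ->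
  is_derive x v (fun y => f y * g y) (f x * dg + g x * df).
Proof. by move=> h1 h2; exact: (@is_deriveM _ _ f g). Qed.

Lemma dvX x v f df n : is_derive x v f df ->
  is_derive x v (fun y => f y ^+ n) (n%:R * f x ^+ n.-1 * df).
Proof.
move=> h; have := @is_deriveX _ _ f n x v df h.
by rewrite exprfctE.
Qed.

Lemma dvV x v f df : f x != 0 -> is_derive x v f df ->
  is_derive x v (fun y => (f y)^-1) (- (f x) ^- 2 * df).
Proof.
move=> f0 [h1 <-]; apply: DeriveDef; first exact: derivableV.
by rewrite deriveV.
Qed.

Lemma dv_comp x v f (h : R -> R) df dh : is_derive x v f df ->
  is_derive (f x) (1 : R) h dh -> is_derive x v (fun y => h (f y)) (dh * df).
Proof.
move=> hf hh; have E : x = 0 *: v + x by rewrite scale0r add0r.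
rewrite E; apply: (is_derive_line (fun y => h (f y)) v x 0 _).2.
apply: (@is_derive1_comp _ h (fun s => f (s *: v + x))); first by rewrite -E.
by apply: (is_derive_line f v x 0 _).1; rewrite -E.
Qed.
End DirectionalCalculus.

Ltac derive_step :=
  match goal with
  | |- is_derive _ _ (fun x => ?c) _ => exact: dvC
  | |- is_derive _ _ (fun x => - @?f x) _ => apply: (dvN (f := f))
  | |- is_derive _ _ (fun x => @?f x + @?g x) _ => apply: (dvD (f := f) (g := g))
  | |- is_derive _ _ (fun x => @?f x * @?g x) _ => apply: (dvM (f := f) (g := g))
  | |- is_derive _ _ (fun x => @?f x ^+ ?n) _ => apply: (dvX (f := f) n)
  | |- is_derive _ _ (fun x => (@?f x)^-1) _ => apply: (dvV (f := f))
  end.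

Section Glue.
Variable R : realType.
Implicit Types (f g : R -> R).

(** Used for profiles that are C^1 but not smooth at c. *)
Definition glue (c : R) f g (x : R) : R := if x <= c then f x else g x.

Lemma glue_derive c f g df dg : f c = g c -> df c = dg c ->
  (forall x, x <= c -> is_derive x (1:R) f (df x)) ->
  (forall x, c <= x -> is_derive x (1:R) g (dg x)) ->
  forall x, is_derive x (1:R) (glue c f g) (glue c df dg x).
Proof.
move=> fg dfg hf hg x; rewrite /glue; case: (ltgtP x c) => [xc|cx|xc].
- apply: (near_eq_is_derive _ (hf _ (ltW xc))); near=> y.
  by rewrite ifT//; apply: ltW; near: y; exact: lt_nbhsl.
- apply: (near_eq_is_derive _ (hg _ (ltW cx))); near=> y.
  by rewrite ifF//; apply/negbTE; rewrite -ltNge; near: y; exact: lt_nbhsr.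
subst x.
have [f1 f2] := hf c (lexx c); have [g1 g2] := hg c (lexx c).
have cf : h^-1 *: ((f \o shift c) (h *: (1:R)) - f c) @[h --> 0^'] --> df c.
  by rewrite -f2; exact: f1.
have cg : h^-1 *: ((g \o shift c) (h *: (1:R)) - g c) @[h --> 0^'] --> df c.
  by rewrite dfg -g2; exact: g1.
have cfg : h^-1 *: (((fun x => if x <= c then f x else g x) \o shift c) (h *: (1:R)) -
     (if c <= c then f c else g c)) @[h --> 0^'] --> df c.
  rewrite lexx => A nA; have hA := cf A nA; have hB := cg A nA.
  suff : \forall h \near 0^', A (h^-1 *: ((if h *: (1:R) + c <= c then f (h *: (1:R) + c)
      else g (h *: (1:R) + c)) - f c)) by [].
  near=> h; case: ifPn => _; first by near: h; exact: hA.
  by rewrite fg; near: h; exact: hB.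
by apply: DeriveDef; [apply/cvg_ex; exists (df c)|exact: cvg_lim cfg].
Unshelve. all: by end_near. Qed.

Lemma glue_continuous c f g : f c = g c ->
  (forall x, x <= c -> {for x, continuous f}) ->
  (forall x, c <= x -> {for x, continuous g}) -> continuous (glue c f g).
Proof.
move=> fg hf hg x; rewrite /glue; case: (ltgtP x c) => [xc|cx|xc].
- apply: cvg_trans (_ : f y @[y --> x] --> _).
    apply: near_eq_cvg; near=> y.
    by rewrite ifT//; apply: ltW; near: y; exact: lt_nbhsl.
  by rewrite (ltW xc); exact: (hf _ (ltW xc)).
- apply: cvg_trans (_ : g y @[y --> x] --> _).
    apply: near_eq_cvg; near=> y.
    by rewrite ifF//; apply/negbTE; rewrite -ltNge; near: y; exact: lt_nbhsr.
  by rewrite (lt_geF cx); exact: (hg _ (ltW cx)).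
subst x; rewrite /continuous_at lexx => A nA.
have hA := hf c (lexx c) A nA; have hB : nbhs c (g @^-1` A).
  by apply: (hg c (lexx c)); rewrite -fg.
suff : \forall y \near c, A (if y <= c then f y else g y) by [].
near=> y; case: ifPn => _; first by near: y; exact: hA.
by near: y; exact: hB.
Unshelve. all: by end_near. Qed.
End Glue.

Section Regularisation.
Variable R : realType.

(** The function u^(-3/2), continued below u = s^2 by its tangent line. *)
Definition psi (s : R) : R -> R :=
  glue (s ^+ 2) (fun u => s ^- 3 - 3 / 2 * s ^- 5 * (u - s ^+ 2)) (fun u => (Num.sqrt u) ^- 3).
Definition dpsi (s : R) : R -> R :=
  glue (s ^+ 2) (fun=> - (3 / 2 * s ^- 5)) (fun u => - (3 / 2 * (Num.sqrt u) ^- 5)).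

Variable s : R.
Hypothesis s0 : 0 < s.

Let s20 : 0 < s ^+ 2. Proof. exact: exprn_gt0. Qed.
Let sqs : Num.sqrt (s ^+ 2) = s. Proof. by rewrite sqrtr_sqr gtr0_norm. Qed.

Lemma psi_derive u : is_derive u (1:R) (psi s) (dpsi s u).
Proof.
apply: glue_derive.
- by rewrite subrr mulr0 subr0 sqs.
- by rewrite sqs.
- move=> x _; eapply is_derive_eq; first by repeat (derive_step || exact: is_derive_id).
  by rewrite /GRing.scale /=; ring.
- move=> x sx; have x0 : 0 < x by exact: lt_le_trans s20 sx.
  have sx0 : Num.sqrt x != 0 by rewrite gt_eqF// sqrtr_gt0.
  eapply is_derive_eq.
    derive_step; first by rewrite /= expf_neq0.
    by derive_step; exact: is_derive1_sqrt.
  by rewrite /GRing.scale /=; field.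
Qed.

Lemma dpsi_continuous : continuous (dpsi s).
Proof.
apply: glue_continuous; first by rewrite sqs.
  by move=> x _; exact: cvg_cst.
move=> x sx; apply: cvgN; apply: cvgM; first exact: cvg_cst.
apply: cvgV; first by rewrite expf_neq0// gt_eqF// sqrtr_gt0 (lt_le_trans s20).
apply: (@continuous_comp _ _ _ (@Num.sqrt R) (fun y => y ^+ 5)).
  exact: sqrt_continuous.
exact: exprn_continuous.
Qed.
End Regularisation.

(** * Derivatives of radial kernels *)

Section KernelCalculus.
Variable R : realType.
Notation V := 'rV[R]_3.
Implicit Types (p q : V) (i j k : 'I_3) (L dL : R -> R).

(** The general kernel L(rho) S / (P Q) with a radial profile L. The collision
kernel, its regularisation and its truncations are all of this form. *)
Definition Ker L p q i j : R := L (rho p q) * Sm p q i j / (jbracket p * jbracket q).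

(** The divergence in q of the kernel, see [sum_dKer]. *)
Definition divK L p q i : R :=
  2 * L (rho p q) * (rho p q * p 0 i - q 0 i) / (jbracket p * jbracket q).

(** The partial derivative of rho with respect to p_i. *)
Definition srho p q i : R := jbracket q * p 0 i / jbracket p - q 0 i.

Definition dSm p q i j : R :=
  2 * rho p q * srho p q i * (i == j)%:R
  - ((p 0 j - q 0 j) + (p 0 i - q 0 i) * (i == j)%:R)
  + (srho p q i * (p 0 i * q 0 j + p 0 j * q 0 i)
     + (rho p q - 1) * (q 0 j + q 0 i * (i == j)%:R)).

Definition dKer L dL p q i j : R :=
  dL (rho p q) * srho p q i * Sm p q i j / (jbracket p * jbracket q)
  + L (rho p q) * dSm p q i j / (jbracket p * jbracket q)
  - L (rho p q) * Sm p q i j * p 0 i / (jbracket p ^+ 3 * jbracket q).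

Definition ddivK L dL p q i : R :=
  2 * dL (rho p q) * srho p q i * (rho p q * p 0 i - q 0 i) / (jbracket p * jbracket q)
  + 2 * L (rho p q) * (srho p q i * p 0 i + rho p q) / (jbracket p * jbracket q)
  - 2 * L (rho p q) * (rho p q * p 0 i - q 0 i) * p 0 i / (jbracket p ^+ 3 * jbracket q).

Lemma Ker_swap L p q i j : Ker L p q i j = Ker L q p j i.
Proof. by rewrite /Ker (rhoC q) (Sm_swap p) SmC (mulrC (jbracket q)). Qed.

Lemma coord_derive p i k : is_derive p (basis3 i) (fun p : V => p 0 k) (k == i)%:R.
Proof.
have H : h^-1 *: (((fun p : V => p 0 k) \o shift p) (h *: basis3 i) - p 0 k)
    @[h --> (0:R)^'] --> ((k == i)%:R : R).
  apply: cvg_trans (_ : (fun=> (k == i)%:R : R) @ 0^' --> _); last exact: cvg_cst.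
  apply: near_eq_cvg; near=> h; rewrite /= !mxE /= addrK ?eqxx /=.
  by rewrite -[RHS]/(h^-1 * (h * _)) mulKf//; near: h; exact: nbhs_dnbhs_neq.
by apply: DeriveDef; [apply/cvg_ex; exists (k == i)%:R|exact: cvg_lim H].
Unshelve. all: by end_near. Qed.

Lemma dotvr_derive p i q : is_derive p (basis3 i) (fun p : V => dotv p q) (q 0 i).
Proof.
rewrite (_ : (fun p => _) = (fun p => p 0 i0 * q 0 i0 + p 0 i1 * q 0 i1 + p 0 i2 * q 0 i2)).
  eapply is_derive_eq; first by repeat (derive_step || exact: coord_derive).
  by elim/ord3P: i; rewrite /GRing.scale /=; ring.
by apply/funext => x; rewrite dotvE.
Qed.

Lemma nsq_derive p i : is_derive p (basis3 i) (@nsq R) (2 * p 0 i).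
Proof.
rewrite (_ : @nsq R = (fun p => p 0 i0 ^+ 2 + p 0 i1 ^+ 2 + p 0 i2 ^+ 2)).
  eapply is_derive_eq; first by repeat (derive_step || exact: coord_derive).
  by elim/ord3P: i; rewrite /GRing.scale /=; ring.
by apply/funext => x; rewrite nsqE.
Qed.

Lemma jb_derive p i : is_derive p (basis3 i) (@jbracket R) (p 0 i / jbracket p).
Proof.
have n0 := jb_gt0 p.
eapply is_derive_eq.
  apply: (dv_comp (f := fun p => 1 + nsq p) (h := Num.sqrt)).
    by apply: dvD; (exact: dvC || exact: nsq_derive).
  by apply: is_derive1_sqrt; rewrite -sqrtr_gt0.
rewrite /GRing.scale /= -/(jbracket p); field; exact: jb_neq0.
Qed.

Lemma rho_derive p i q : is_derive p (basis3 i) (fun p => rho p q) (srho p q i).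
Proof.
rewrite /rho; eapply is_derive_eq.
  apply: dvD; first by apply: dvM; (exact: jb_derive || exact: dvC).
  by apply: dvN; exact: dotvr_derive.
by rewrite /srho /GRing.scale /=; ring.
Qed.

Lemma Sm_derive p i j q : is_derive p (basis3 i) (fun p => Sm p q i j) (dSm p q i j).
Proof.
rewrite /Sm; eapply is_derive_eq.
  by repeat (derive_step || exact: coord_derive || exact: rho_derive).
by rewrite eqxx (eq_sym j) /dSm /GRing.scale /=; ring.
Qed.

Lemma Ker_derive L dL p i j q : is_derive (rho p q) (1:R) L (dL (rho p q)) ->
  is_derive p (basis3 i) (fun p => Ker L p q i j) (dKer L dL p q i j).
Proof.
move=> hL; rewrite /Ker; eapply is_derive_eq.
  apply: dvM.
    by apply: dvM; (exact: (dv_comp (rho_derive p i q) hL) || exact: Sm_derive).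
  apply: dvV; first by rewrite mulf_neq0// jb_neq0.
  by apply: dvM; (exact: jb_derive || exact: dvC).
by rewrite /dKer /GRing.scale /=; field; rewrite !jb_neq0.
Qed.

Lemma divK_derive L dL p i q : is_derive (rho p q) (1:R) L (dL (rho p q)) ->
  is_derive p (basis3 i) (fun p => divK L p q i) (ddivK L dL p q i).
Proof.
move=> hL; rewrite /divK; eapply is_derive_eq.
  apply: dvM.
    apply: dvM; first by apply: dvM; (exact: dvC || exact: (dv_comp (rho_derive p i q) hL)).
    by repeat (derive_step || exact: coord_derive || exact: rho_derive).
  apply: dvV; first by rewrite mulf_neq0// jb_neq0.
  by apply: dvM; (exact: jb_derive || exact: dvC).
by rewrite eqxx /ddivK /GRing.scale /=; field; rewrite !jb_neq0.
Qed.

(** Because of [S_grad_rho] no derivative of the radial profile survives in the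
divergence, so the formula holds with one expression for every profile. *)
Lemma sum_dKer L dL p q j : \sum_(i < 3) dKer L dL p q i j = divK L q p j.
Proof.
have h : \sum_(i < 3) srho p q i * Sm p q i j = 0.
  apply: (mulfI (jb_neq0 p)); rewrite mulr0 big_distrr /= -[RHS](S_grad_rho p q j).
  by apply: eq_bigr => i _; rewrite /srho; field; exact: jb_neq0.
have -> : \sum_(i < 3) dKer L dL p q i j =
   dL (rho p q) / (jbracket p * jbracket q) * (\sum_(i < 3) srho p q i * Sm p q i j)
   + L (rho p q) / (jbracket p ^+ 3 * jbracket q) *
     (\sum_(i < 3) (jbracket p ^+ 2 * dSm p q i j - Sm p q i j * p 0 i)).
  rewrite !big_distrr /= -big_split /=; apply: eq_bigr => i _.
  by rewrite /dKer; field; rewrite !jb_neq0.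
rewrite h mulr0 add0r /divK (rhoC q) (mulrC (jbracket q)).
have -> : \sum_(i < 3) (jbracket p ^+ 2 * dSm p q i j - Sm p q i j * p 0 i) =
   2 * jbracket p ^+ 2 * (rho p q * q 0 j - p 0 j).
  have := jb_neq0 p; rewrite sum3 /dSm /Sm /srho; elim/ord3P: j {h};
  rewrite /=; have := jb_sqr p; have := jb_sqr q; rewrite /rho ?dotvE;
  move: (jbracket p) (jbracket q) (p 0 i0) (p 0 i1) (p 0 i2) (q 0 i0) (q 0 i1) (q 0 i2)
    => P Q a0 a1 a2 b0 b1 b2 hQ hP P0; field: hP hQ => //.
by field; rewrite !jb_neq0.
Qed.

(** The double divergence of the kernel. For L = rho^2 u^(-3/2) the last factor is
2 rho u^(-1/2), so that the singularity of order u^(-3/2) cancels away from the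
diagonal. *)
Lemma sum_ddivK L dL p q : \sum_(i < 3) ddivK L dL p q i =
  2 / (jbracket p * jbracket q) *
   ((rho p q ^+ 2 - 1) * dL (rho p q) + 3 * rho p q * L (rho p q)).
Proof.
have h : \sum_(i < 3) srho p q i * (rho p q * p 0 i - q 0 i) = rho p q ^+ 2 - 1.
  have := jb_neq0 p; rewrite sum3 /srho; have := jb_sqr p; have := jb_sqr q; rewrite /rho ?dotvE;
  move: (jbracket p) (jbracket q) (p 0 i0) (p 0 i1) (p 0 i2) (q 0 i0) (q 0 i1) (q 0 i2)
    => P Q a0 a1 a2 b0 b1 b2 hQ hP P0; field: hP hQ => //.
have h2 : \sum_(i < 3) (jbracket p ^+ 2 * (srho p q i * p 0 i + rho p q)
     - (rho p q * p 0 i - q 0 i) * p 0 i) = 3 * rho p q * jbracket p ^+ 2.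
  have := jb_neq0 p; rewrite sum3 /srho; have := jb_sqr p; have := jb_sqr q; rewrite /rho ?dotvE;
  move: (jbracket p) (jbracket q) (p 0 i0) (p 0 i1) (p 0 i2) (q 0 i0) (q 0 i1) (q 0 i2)
    => P Q a0 a1 a2 b0 b1 b2 hQ hP P0; field: hP hQ => //.
have -> : \sum_(i < 3) ddivK L dL p q i =
   2 * dL (rho p q) / (jbracket p * jbracket q) *
     (\sum_(i < 3) srho p q i * (rho p q * p 0 i - q 0 i))
   + 2 * L (rho p q) / (jbracket p ^+ 3 * jbracket q) *
     (\sum_(i < 3) (jbracket p ^+ 2 * (srho p q i * p 0 i + rho p q)
     - (rho p q * p 0 i - q 0 i) * p 0 i)).
  rewrite !big_distrr /= -big_split /=; apply: eq_bigr => i _.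
  by rewrite /ddivK; field; rewrite !jb_neq0.
by rewrite h h2; field; rewrite !jb_neq0.
Qed.
End KernelCalculus.

(** * Pointwise bounds on the kernel *)

Section Inequalities.
Variable R : realType.
Notation V := 'rV[R]_3.
Implicit Types (p q : V) (i j k : 'I_3).
Local Notation jb := jbracket.

Lemma jb_ge0 p : 0 <= jb p.
Proof. exact: ltW (jb_gt0 p). Qed.

Lemma le_coord_jb p i : `|p 0 i| <= jb p.
Proof.
rewrite -(@ler_pXn2r _ 2)// ?nnegrE ?normr_ge0 ?ltW ?jb_gt0//.
rewrite real_normK ?num_real// jb_sqr.
have := sqr_ge0 (p 0 i0); have := sqr_ge0 (p 0 i1); have := sqr_ge0 (p 0 i2).
by elim/ord3P: i; lra.
Qed.

(** Lagrange's identity. *)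
Lemma dot_cauchy p q : (dotv p q) ^+ 2 <= nsq p * nsq q.
Proof.
rewrite -subr_ge0.
have -> : nsq p * nsq q - dotv p q ^+ 2 = nsq (cross p q).
  by rewrite !nsqE dotvE !mxE /=; ring.
exact: nsq_ge0.
Qed.

Lemma nsq_jb p : nsq p = jb p ^+ 2 - 1.
Proof. by rewrite jb_sqr nsqE; ring. Qed.

Lemma dot_le_jb p q : `|dotv p q| <= jb p * jb q - 1.
Proof.
have P1 := jb_ge1 p; have Q1 := jb_ge1 q.
have h := dot_cauchy p q; rewrite !nsq_jb in h.
have D0 : 0 <= jb p * jb q - 1 by rewrite subr_ge0 mulr_ege1.
rewrite -(@ler_pXn2r _ 2)// ?nnegrE ?normr_ge0// real_normK ?num_real//.
apply: le_trans h _; rewrite -subr_ge0.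
have -> : (jb p * jb q - 1) ^+ 2 - (jb p ^+ 2 - 1) * (jb q ^+ 2 - 1) =
  (jb p - jb q) ^+ 2 by ring.
exact: sqr_ge0.
Qed.

Lemma rho_ge1 p q : 1 <= rho p q.
Proof.
have := dot_le_jb p q; rewrite /rho => h; have := ler_norm (dotv p q); lra.
Qed.

Lemma rho_le p q : rho p q <= 2 * jb p * jb q.
Proof.
have := dot_le_jb p q; rewrite /rho => h; have := ler_norm (- dotv p q).
rewrite normrN; lra.
Qed.

Lemma nsq_le_rho p q : nsq (q - p) + nsq (cross p q) <= (rho p q - 1) * (2 * jb p * jb q).
Proof.
rewrite -rho1E; apply: ler_wpM2l; first by have := rho_ge1 p q; lra.
have := dot_le_jb p q => h; have := ler_norm (dotv p q); lra.
Qed.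

(** Nonnegativity of |p x q|^2, read as a quadratic inequality in Q. It makes a
cutoff in rho a cutoff in q. *)
Lemma jb_le_rho p q : jb q <= 2 * jb p * rho p q.
Proof.
have h := nsq_ge0 (cross p q); rewrite nsq_cross in h.
have r1 := rho_ge1 p q; have Q0 := jb_gt0 q.
rewrite -(ler_pM2r Q0); have := sqr_ge0 (jb p).
have : 1 <= rho p q ^+ 2 by rewrite exprn_ege1.
nra.
Qed.

Lemma vnorm_le_sqrt p : `|p| <= Num.sqrt (nsq p).
Proof.
apply/vnorm_leP; first exact: sqrtr_ge0.
move=> i; rewrite -sqrtr_sqr ler_sqrt ?nsq_ge0// nsqE.
have := sqr_ge0 (p 0 i0); have := sqr_ge0 (p 0 i1); have := sqr_ge0 (p 0 i2).
by elim/ord3P: i; lra.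
Qed.

Lemma vnorm_le_jb p : `|p| <= jb p.
Proof.
apply: le_trans (vnorm_le_sqrt p) _.
by rewrite /jb ler_sqrt ?addr_ge0 ?nsq_ge0// lerDr.
Qed.

Lemma vnorm_sqr_le p : `|p| ^+ 2 <= nsq p.
Proof.
rewrite -[leRHS]sqr_sqrtr ?nsq_ge0// ler_pXn2r// ?nnegrE ?sqrtr_ge0//.
exact: vnorm_le_sqrt.
Qed.

Lemma nsq_le_vnorm p : nsq p <= 3 * `|p| ^+ 2.
Proof.
have h i : p 0 i ^+ 2 <= `|p| ^+ 2.
  by rewrite -real_normK ?num_real// ler_pXn2r// ?nnegrE// le_vnorm.
by rewrite nsqE; have := h i0; have := h i1; have := h i2; lra.
Qed.

Lemma jb_lip p q : jb p <= jb q + 2 * `|q - p|.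
Proof.
have t0 := normr_ge0 (q - p); have Q1 := jb_ge1 q; have P1 := jb_ge1 p.
rewrite -(@ler_pXn2r _ 2)// ?nnegrE ?addr_ge0 ?mulr_ge0 ?jb_ge0//.
have E : jb p ^+ 2 = jb q ^+ 2 + nsq (q - p) - 2 * dotv q (q - p).
  by rewrite !jb_sqr nsqE dotvE !mxE; ring.
have h1 := nsq_le_vnorm (q - p); have h2 := dot_cauchy q (q - p); rewrite nsq_jb in h2.
have h3 : - dotv q (q - p) <= 2 * jb q * `|q - p|.
  apply: le_trans (ler_norm _) _; rewrite normrN.
  rewrite -(@ler_pXn2r _ 2)// ?nnegrE ?normr_ge0 ?mulr_ge0 ?jb_ge0//.
  rewrite real_normK ?num_real//; apply: le_trans h2 _; rewrite !exprMn.
  apply: (@le_trans _ _ ((jb q ^+ 2 - 1) * (3 * `|q - p| ^+ 2))).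
    by apply: ler_wpM2l => //; rewrite subr_ge0 exprn_ege1.
  have := sqr_ge0 (jb q); have := sqr_ge0 `|q - p|; nra.
rewrite E sqrrD; nra.
Qed.

(** The size of the collision kernel with the natural weights taken out: it
bounds Lambda (rho - 1) and rho u^(-1/2). *)
Definition kernel_size p q : R := 1 + Num.sqrt (jb p * jb q) * `|q - p|^-1.

Lemma sqrtu_bound p q : 1 < rho p q ->
  0 < `|q - p| /\ (Num.sqrt (rho p q ^+ 2 - 1))^-1 <= Num.sqrt (jb p * jb q) * `|q - p|^-1.
Proof.
move=> r1.
have z0 : 0 < `|q - p|.
  rewrite normr_gt0 subr_eq0; apply/negP => /eqP E; move: r1.
  by rewrite E /rho -/(nsq p) nsq_jb expr2; lra.
split=> //.
have u0 : 0 < rho p q ^+ 2 - 1 by nra.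
have w0 : 0 < Num.sqrt (rho p q ^+ 2 - 1) by rewrite sqrtr_gt0.
rewrite ler_pdivlMr// mulrC ler_pdivrMr// -sqrtrM; last first.
  by rewrite mulr_ge0// ltW// jb_gt0.
apply: le_trans (vnorm_le_sqrt _) _; rewrite ler_sqrt; last first.
  by rewrite mulr_ge0 ?mulr_ge0// ltW// jb_gt0.
have := nsq_le_rho p q; have := nsq_ge0 (cross p q).
have PQ0 : 0 < jb p * jb q by rewrite mulr_gt0 ?jb_gt0.
have -> : jb p * jb q * (rho p q ^+ 2 - 1) = (rho p q - 1) * ((rho p q + 1) * (jb p * jb q)) by ring.
have : (rho p q - 1) * (2 * jb p * jb q) <= (rho p q - 1) * ((rho p q + 1) * (jb p * jb q)).
  by apply: ler_wpM2l; [lra|rewrite -mulrA ler_pM2r//; lra].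
lra.
Qed.

(** For |q - p| >= 1 each quantity is bounded by a multiple of the energy weight Q;
for |q - p| < 1 the brackets of p and q are comparable and only the Newton
potential remains. The three weights correspond to the second order, first
order and zeroth order terms. *)
Lemma kernel_size_far_near p q : kernel_size p q <= 3 * jb q + 2 * jb p * newton p 1 q /\
  kernel_size p q * ((jb p)^-1 + (jb q)^-1) <= 6 * jb q + 8 * newton p 1 q /\
  kernel_size p q / (jb p * jb q) <= 3 * jb q + 2 * newton p 1 q.
Proof.
have P1 := jb_ge1 p; have Q1 := jb_ge1 q; have P0 := jb_gt0 p; have Q0 := jb_gt0 q.
have h1 := jb_lip p q; have h2 := jb_lip q p; rewrite distrC in h2.
have iP : (jb p)^-1 <= 1 by rewrite invf_le1.
have iQ : (jb q)^-1 <= 1 by rewrite invf_le1.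
have iP0 : 0 < (jb p)^-1 by rewrite invr_gt0.
have iQ0 : 0 < (jb q)^-1 by rewrite invr_gt0.
have PQ1 : (jb p * jb q)^-1 <= 1 by rewrite invf_le1 ?mulr_gt0// mulr_ege1.
have PQ0 : 0 < (jb p * jb q)^-1 by rewrite invr_gt0 mulr_gt0.
rewrite newtonE; case: ifPn => [near|]; last first.
  rewrite -leNgt => far; rewrite !mulr0 !addr0.
  have K3 : kernel_size p q <= 3 * jb q.
    have z0 : 0 < `|q - p| by exact: lt_le_trans ltr01 far.
    rewrite /kernel_size; suff : Num.sqrt (jb p * jb q) * `|q - p|^-1 <= 2 * jb q by lra.
    rewrite ler_pdivrMr// -[leRHS]gtr0_norm ?mulr_gt0// -sqrtr_sqr ler_sqrt ?sqr_ge0//.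
    rewrite [leRHS](_ : _ = (4 * jb q * `|q - p| ^+ 2) * jb q); last by ring.
    rewrite ler_pM2r//; apply: le_trans h1 _.
    have : `|q - p| <= `|q - p| ^+ 2 by rewrite expr2 ler_peMl.
    nra.
  have K0 : 0 <= kernel_size p q by rewrite /kernel_size addr_ge0// mulr_ge0// sqrtr_ge0.
  split=> //; split.
    rewrite (_ : 6 * jb q = 3 * jb q * 2); last by ring.
    by apply: ler_pM => //; lra.
  by rewrite -[leRHS]mulr1; apply: ler_pM => //; lra.
have i0 := invr_ge0 `|q - p|; rewrite normr_ge0 in i0.
set t := `|q - p|^-1 in i0 *.
have P3 : jb p <= 3 * jb q by lra.
have Q3 : jb q <= 3 * jb p by lra.
have sP : Num.sqrt (jb p * jb q) <= 2 * jb p.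
  by rewrite -[leRHS]gtr0_norm ?mulr_gt0// -sqrtr_sqr ler_sqrt ?sqr_ge0//; nra.
have sQ : Num.sqrt (jb p * jb q) <= 2 * jb q.
  by rewrite -[leRHS]gtr0_norm ?mulr_gt0// -sqrtr_sqr ler_sqrt ?sqr_ge0//; nra.
have s0 := sqrtr_ge0 (jb p * jb q).
have sP' : Num.sqrt (jb p * jb q) / jb p <= 2 by rewrite ler_pdivrMr.
have sQ' : Num.sqrt (jb p * jb q) / jb q <= 2 by rewrite ler_pdivrMr.
rewrite /kernel_size -/t; split; [|split].
- have := ler_wpM2r i0 sP; lra.
- rewrite (_ : (1 + _) * _ = (jb p)^-1 + (jb q)^-1 + (Num.sqrt (jb p * jb q) / jb p
    + Num.sqrt (jb p * jb q) / jb q) * t); last by ring.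
  have : (Num.sqrt (jb p * jb q) / jb p + Num.sqrt (jb p * jb q) / jb q) * t <= 4 * t.
    by apply: ler_wpM2r => //; lra.
  lra.
- rewrite mulrDl mul1r.
  have : Num.sqrt (jb p * jb q) * t / (jb p * jb q) <= 2 * t.
    rewrite mulrAC; apply: ler_wpM2r => //; rewrite ler_pdivrMr ?mulr_gt0//; nra.
  lra.
Qed.

Section Profile.
Variable s : R.
Hypothesis s0 : 0 < s.

Let s20 : 0 < s ^+ 2. Proof. exact: exprn_gt0. Qed.

(** Lambda with u^(-3/2) replaced by [psi]. *)
Definition Lreg (r : R) : R := r ^+ 2 * psi s (r ^+ 2 - 1).
Definition dLreg (r : R) : R := 2 * r * psi s (r ^+ 2 - 1) + 2 * r ^+ 3 * dpsi s (r ^+ 2 - 1).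

Lemma Lreg_derive r : is_derive r (1:R) Lreg (dLreg r).
Proof.
have h1 : is_derive r (1:R) (fun r : R => r ^+ 2) (2 * r).
  by eapply is_derive_eq; [exact: (dvX 2 (is_derive_id r 1))|rewrite /= expr1 mulr1].
have h2 : is_derive r (1:R) (fun r : R => r ^+ 2 - 1) (2 * r).
  by eapply is_derive_eq; [exact: (dvD h1 (dvC r 1 (-1)))|rewrite addr0].
rewrite /Lreg; eapply is_derive_eq.
  exact: (dvM h1 (dv_comp h2 (psi_derive s0 _))).
by rewrite /dLreg; ring.
Qed.

Lemma psi_small u : u <= s ^+ 2 -> psi s u = s ^- 3 - 3 / 2 * s ^- 5 * (u - s ^+ 2).
Proof. by rewrite /psi /glue => ->. Qed.
Lemma psi_large u : s ^+ 2 < u -> psi s u = (Num.sqrt u) ^- 3.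
Proof. by rewrite /psi /glue leNgt => ->. Qed.
Lemma dpsi_small u : u <= s ^+ 2 -> dpsi s u = - (3 / 2 * s ^- 5).
Proof. by rewrite /dpsi /glue => ->. Qed.
Lemma dpsi_large u : s ^+ 2 < u -> dpsi s u = - (3 / 2 * (Num.sqrt u) ^- 5).
Proof. by rewrite /dpsi /glue leNgt => ->. Qed.

Lemma dpsi_le0 u : dpsi s u <= 0.
Proof.
rewrite /dpsi /glue; case: ifP => _; rewrite oppr_le0 mulr_ge0 ?divr_ge0// invr_ge0 exprn_ge0//.
exact: ltW.
Qed.

Lemma psi_ge0 u : 0 <= psi s u.
Proof.
have [us|us] := leP u (s ^+ 2); last by rewrite psi_large// invr_ge0 exprn_ge0// sqrtr_ge0.
have s3 : 0 <= s ^- 3 by rewrite invr_ge0 exprn_ge0// ltW.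
have s5 : 0 <= s ^- 5 by rewrite invr_ge0 exprn_ge0// ltW.
rewrite psi_small//.
have : 0 <= s ^- 5 * (s ^+ 2 - u) by rewrite mulr_ge0// subr_ge0.
lra.
Qed.

Lemma psi_le_small u : 0 <= u -> u <= s ^+ 2 -> psi s u <= 5 / 2 * s ^- 3.
Proof.
move=> u0 us; rewrite psi_small// (_ : _ - _ = 5 / 2 * s ^- 3 - 3 / 2 * s ^- 5 * u).
  by rewrite gerBl mulr_ge0// mulr_ge0 ?divr_ge0 ?invr_ge0 ?exprn_ge0// ltW.
by field; rewrite gt_eqF.
Qed.

(** The tangent line of a convex function lies below its graph; with w the square
root of u the difference factors through (s - w)^2. *)
Lemma psi_le u : 0 < u -> psi s u <= (Num.sqrt u) ^- 3.
Proof.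
move=> u0; have [us|us] := leP u (s ^+ 2); last by rewrite psi_large.
rewrite psi_small//.
have w0 : 0 < Num.sqrt u by rewrite sqrtr_gt0.
rewrite -[X in X - s ^+ 2](@sqr_sqrtr _ u) ?(ltW u0)//.
move: (Num.sqrt u) w0 => w w0.
(* The difference of the function and its tangent has a double zero at w = s. *)
have E : w ^- 3 - (s ^- 3 - 3 / 2 * s ^- 5 * (w ^+ 2 - s ^+ 2)) =
    (s - w) ^+ 2 * (s ^+ 3 + 2 * s ^+ 2 * w + 3 * s * w ^+ 2 + 3 / 2 * w ^+ 3)
    / (s ^+ 5 * w ^+ 3) by field; rewrite !gt_eqF.
have [s_ w_] := (ltW s0, ltW w0).
rewrite -subr_ge0 E; apply: divr_ge0; last by rewrite mulr_ge0// exprn_ge0.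
apply: mulr_ge0; first exact: sqr_ge0.
have e (x : R) n : 0 <= x -> 0 <= x ^+ n by exact: exprn_ge0.
by rewrite !addr_ge0//; repeat (apply: mulr_ge0 || exact: e || exact: divr_ge0).
Qed.

Lemma Lreg_ge0 r : 0 <= Lreg r.
Proof. by rewrite mulr_ge0 ?sqr_ge0 ?psi_ge0. Qed.

Lemma rho_ratio_bound p q : 1 < rho p q ->
  rho p q / Num.sqrt (rho p q ^+ 2 - 1) <= kernel_size p q.
Proof.
move=> r1; have [_ h] := sqrtu_bound r1.
have u0 : 0 < rho p q ^+ 2 - 1 by nra.
have w0 : 0 < Num.sqrt (rho p q ^+ 2 - 1) by rewrite sqrtr_gt0.
have w2 : Num.sqrt (rho p q ^+ 2 - 1) ^+ 2 = rho p q ^+ 2 - 1 by rewrite sqr_sqrtr// ltW.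
apply: (@le_trans _ _ (1 + (Num.sqrt (rho p q ^+ 2 - 1))^-1)); last by rewrite /kernel_size lerD2l.
rewrite ler_pdivrMr// mulrDl mul1r mulVf ?gt_eqF//.
by move: w0 w2; move: (Num.sqrt _) => w w0 w2; nra.
Qed.

Lemma kernel_size_ge1 p q : 1 <= kernel_size p q.
Proof. by rewrite /kernel_size lerDl mulr_ge0// sqrtr_ge0. Qed.

(** The factor rho - 1 cancels one power of the singularity: r^2 (r - 1) u^(-3/2) is
at most r u^(-1/2). *)
Lemma Lreg_bound p q : Lreg (rho p q) * (rho p q - 1) <= kernel_size p q.
Proof.
have := rho_ge1 p q; rewrite le_eqVlt => /predU1P[<-|r1].
  by rewrite subrr mulr0; exact: le_trans (kernel_size_ge1 p q).
apply: le_trans (rho_ratio_bound r1).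
have u0 : 0 < rho p q ^+ 2 - 1 by nra.
have w0 : 0 < Num.sqrt (rho p q ^+ 2 - 1) by rewrite sqrtr_gt0.
have w2 : Num.sqrt (rho p q ^+ 2 - 1) ^+ 2 = rho p q ^+ 2 - 1 by rewrite sqr_sqrtr// ltW.
apply: (@le_trans _ _ (rho p q ^+ 2 * (Num.sqrt (rho p q ^+ 2 - 1)) ^- 3 * (rho p q - 1))).
  by rewrite ler_pM2r ?subr_gt0// ler_pM2l ?psi_le// exprn_gt0// (lt_trans ltr01).
move: w0 w2 r1 {u0}; move: (Num.sqrt _) => w; move: (rho p q) => r w0 w2 r1.
have e : r / w - r ^+ 2 * w ^- 3 * (r - 1) = r * (w ^+ 2 - r * (r - 1)) / w ^+ 3.
  by field; rewrite gt_eqF.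
rewrite -subr_ge0 e w2 divr_ge0 ?exprn_ge0 ?(ltW w0)// mulr_ge0//; nra.
Qed.

(** Beyond u = s^2 the cancellation in [sum_ddivK] is exact. Below that threshold
the regularised profile has an approximate Dirac mass of height s^-3, kept as an
indicator function. The derivative of the profile may be dropped there, being
nonpositive. *)
Lemma div_bound p q : s <= 2^-1 ->
  (rho p q ^+ 2 - 1) * dLreg (rho p q) + 3 * rho p q * Lreg (rho p q) <=
  2 * kernel_size p q + 30 * s ^- 3 * \1_[set q | rho p q ^+ 2 - 1 < 2 * s ^+ 2] q.
Proof.
move=> s2; have r1 := rho_ge1 p q; have K1 := kernel_size_ge1 p q.
have s3 : 0 < s ^- 3 by rewrite invr_gt0 exprn_gt0.
have u0 : 0 <= rho p q ^+ 2 - 1 by nra.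
rewrite /Lreg /dLreg.
have [us|us] := leP (rho p q ^+ 2 - 1) (s ^+ 2).
  rewrite indicE mem_set /=; last by rewrite /=; have := s20; lra.
  have p0 := psi_ge0 (rho p q ^+ 2 - 1); have d0 := dpsi_le0 (rho p q ^+ 2 - 1).
  have p1 := psi_le_small u0 us.
  have s4 : s ^+ 2 <= 4^-1.
    have : s ^+ 2 <= 2^-1 * 2^-1 by rewrite expr2; apply: ler_pM => //; exact: ltW.
    lra.
  have r2 : rho p q ^+ 2 <= 5 / 4 by lra.
  have r3 : rho p q <= 5 / 4 by nra.
  move: p0 d0 p1; move: (psi _ _) (dpsi _ _) => a b a0 b0 a1.
  move: u0 us r1 r2 r3; move: (rho p q) => r u0 us r1 r2 r3.
  have h1 : (r ^+ 2 - 1) * (2 * r ^+ 3 * b) <= 0.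
    rewrite mulr_ge0_le0// mulr_ge0_le0// mulr_ge0// exprn_ge0//; lra.
  have h2 : (r ^+ 2 - 1) * (2 * r * a) <= 2 * a.
    rewrite mulrA ler_wpM2r//.
    have : (r ^+ 2 - 1) * (2 * r) <= 4^-1 * (2 * (5 / 4)) by apply: ler_pM => //; lra.
    lra.
  have h3 : 3 * r * (r ^+ 2 * a) <= 6 * a.
    rewrite mulrA ler_wpM2r//.
    have : 3 * r * r ^+ 2 <= 3 * (5 / 4) * (5 / 4) by apply: ler_pM => //; rewrite ?exprn_ge0//; lra.
    lra.
  rewrite mulr1 mulrDr; move: s3 a1 h1 h2 h3 K1; move: (s ^- 3) (kernel_size p q) => y K; lra.
have u1 : 0 < rho p q ^+ 2 - 1 by exact: lt_trans us.
have r11 : 1 < rho p q by nra.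
have h := rho_ratio_bound r11.
rewrite psi_large// dpsi_large//.
apply: (@le_trans _ _ (2 * kernel_size p q)); last by rewrite lerDl mulr_ge0// ?indicE// mulr_ge0// ltW.
have w0 : 0 < Num.sqrt (rho p q ^+ 2 - 1) by rewrite sqrtr_gt0.
have w2 : rho p q ^+ 2 = Num.sqrt (rho p q ^+ 2 - 1) ^+ 2 + 1 by rewrite sqr_sqrtr ?subrK// ltW.
have -> : (rho p q ^+ 2 - 1) * (2 * rho p q / Num.sqrt (rho p q ^+ 2 - 1) ^+ 3
    + 2 * rho p q ^+ 3 * - (3 / 2 / Num.sqrt (rho p q ^+ 2 - 1) ^+ 5))
   + 3 * rho p q * (rho p q ^+ 2 / Num.sqrt (rho p q ^+ 2 - 1) ^+ 3)
  = 2 * (rho p q / Num.sqrt (rho p q ^+ 2 - 1)).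
  by move: w0 w2; move: (Num.sqrt _) => w w0 w2; field: w2; rewrite gt_eqF.
by rewrite ler_pM2l.
Qed.

(** Bounds that may depend on s; they only serve to justify differentiation under
the integral sign. *)
Lemma Lreg_growth : exists2 C, 0 < C & forall r, 1 <= r ->
  `|Lreg r| <= C /\ r * `|dLreg r| <= C.
Proof.
have s3 : 0 < s ^- 3 by rewrite invr_gt0 exprn_gt0.
have s5 : 0 < s ^- 5 by rewrite invr_gt0 exprn_gt0.
have s1 : 0 < s^-1 by rewrite invr_gt0.
have s2 : 0 < s ^- 2 by rewrite invr_gt0 exprn_gt0.
pose A1 := (1 + s ^+ 2) * (5 / 2 * s ^- 3).
pose A2 := (1 + s ^+ 2) ^+ 2 * (3 * s ^- 5).
pose c := 1 + s ^- 2.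
have c0 : 0 < c by rewrite addr_gt0.
have A10 : 0 < A1 by rewrite mulr_gt0 ?addr_gt0// mulr_gt0// divr_gt0.
have A20 : 0 < A2 by rewrite mulr_gt0 ?exprn_gt0 ?addr_gt0// mulr_gt0.
have cs0 : 0 < c * s^-1 by rewrite mulr_gt0.
have cs2 : 0 < c ^+ 2 * s^-1 by rewrite mulr_gt0// exprn_gt0.
exists (2 * A1 + A2 + 2 * (c * s^-1) + 3 * (c ^+ 2 * s^-1)); first lra.
move=> r r1.
have u0 : 0 <= r ^+ 2 - 1 by rewrite subr_ge0 exprn_ege1.
have p0 := psi_ge0 (r ^+ 2 - 1); have d0 := dpsi_le0 (r ^+ 2 - 1).
have r0 : 0 <= r by lra.
rewrite /dLreg ger0_norm ?Lreg_ge0// /Lreg.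
have tri : r * `|2 * r * psi s (r ^+ 2 - 1) + 2 * r ^+ 3 * dpsi s (r ^+ 2 - 1)| <=
   2 * (r ^+ 2 * psi s (r ^+ 2 - 1)) + 2 * (r ^+ 4 * (- dpsi s (r ^+ 2 - 1))).
  rewrite -[X in X * _](ger0_norm r0) -normrM.
  rewrite (_ : r * _ = 2 * (r ^+ 2 * psi s (r ^+ 2 - 1)) - 2 * (r ^+ 4 * (- dpsi s (r ^+ 2 - 1)))); last by ring.
  apply: le_trans (ler_normB _ _) _.
  rewrite !ger0_norm// ?mulr_ge0 ?exprn_ge0 ?oppr_ge0//.
suff h : (r ^+ 2 * psi s (r ^+ 2 - 1) <= A1 /\ r ^+ 4 * (- dpsi s (r ^+ 2 - 1)) <= 2^-1 * A2) \/
   (r ^+ 2 * psi s (r ^+ 2 - 1) <= c * s^-1 /\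
    r ^+ 4 * (- dpsi s (r ^+ 2 - 1)) <= 3 / 2 * (c ^+ 2 * s^-1)).
  by move: h => [[? ?]|[? ?]]; split; lra.
have [us|us] := leP (r ^+ 2 - 1) (s ^+ 2); [left|right].
  have r2 : r ^+ 2 <= 1 + s ^+ 2 by lra.
  split; first by apply: ler_pM => //; [exact: exprn_ge0|exact: psi_le_small].
  rewrite dpsi_small// opprK (_ : 2^-1 * A2 = (1 + s ^+ 2) ^+ 2 * (3 / 2 * s ^- 5)); last by rewrite /A2; ring.
  rewrite ler_pM2r ?mulr_gt0 ?divr_gt0// (_ : r ^+ 4 = (r ^+ 2) ^+ 2); last by ring.
  by rewrite ler_pXn2r// nnegrE ?exprn_ge0// addr_ge0// exprn_ge0// ltW.
have w0 : 0 < Num.sqrt (r ^+ 2 - 1) by rewrite sqrtr_gt0 (lt_trans s20).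
have sw : s <= Num.sqrt (r ^+ 2 - 1).
  by rewrite -[leLHS](gtr0_norm s0) -sqrtr_sqr ler_sqrt// ltW.
have w2 : r ^+ 2 = 1 + Num.sqrt (r ^+ 2 - 1) ^+ 2 by rewrite sqr_sqrtr// addrC subrK.
rewrite psi_large// dpsi_large// opprK.
move: w0 sw w2; move: (Num.sqrt _) => w w0 sw w2.
have iw : w^-1 <= s^-1 by rewrite lef_pV2 ?posrE.
have rc : r ^+ 2 <= c * w ^+ 2.
  rewrite w2 /c mulrDl mul1r addrC lerD2l mulrC ler_pdivlMr ?exprn_gt0// mul1r.
  by rewrite ler_pXn2r// nnegrE ltW.
split.
  apply: (@le_trans _ _ (c * w ^+ 2 * w ^- 3)).
    by rewrite ler_pM2r ?invr_gt0 ?exprn_gt0.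
  rewrite (_ : c * _ * _ = c * w^-1); last by field; rewrite gt_eqF.
  by rewrite ler_pM2l.
apply: (@le_trans _ _ ((c * w ^+ 2) ^+ 2 * (3 / 2 * w ^- 5))).
  rewrite ler_pM2r; last by rewrite mulr_gt0 ?divr_gt0// invr_gt0 exprn_gt0.
  rewrite (_ : r ^+ 4 = (r ^+ 2) ^+ 2); last by ring.
  by rewrite ler_pXn2r// nnegrE ?mulr_ge0 ?exprn_ge0// ltW.
rewrite (_ : _ * _ = 3 / 2 * (c ^+ 2 * w^-1)); last by field; rewrite gt_eqF.
by rewrite ler_pM2l// ler_pM2l// exprn_gt0.
Qed.
End Profile.
End Inequalities.

(** * Continuity of the kernel and the volume of the shell *)

Section Continuity.
Variable R : realType.
Notation V := 'rV[R]_3.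
Implicit Types (p q : V) (i j k : 'I_3).

Lemma ctD (f g : V -> R) : continuous f -> continuous g -> continuous (fun q => f q + g q).
Proof. by move=> cf cg x; exact: (cvgD (cf x) (cg x)). Qed.
Lemma ctN (f : V -> R) : continuous f -> continuous (fun q => - f q).
Proof. by move=> cf x; exact: (cvgN (cf x)). Qed.
Lemma ctM (f g : V -> R) : continuous f -> continuous g -> continuous (fun q => f q * g q).
Proof. by move=> cf cg x; exact: (cvgM (cf x) (cg x)). Qed.
Lemma ctV (f : V -> R) : (forall q, f q != 0) -> continuous f -> continuous (fun q => (f q)^-1).
Proof. by move=> f0 cf x; exact: (cvgV (f0 x) (cf x)). Qed.
Lemma ctX (f : V -> R) n : continuous f -> continuous (fun q => f q ^+ n).
Proof.
move=> cf x; apply: (@continuous_comp _ _ _ f (fun y => y ^+ n)); first exact: cf.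
exact: exprn_continuous.
Qed.
Lemma ctC (c : R) : continuous (fun _ : V => c).
Proof. exact: cst_continuous. Qed.
Lemma ct_coord i : continuous (fun q : V => q 0 i).
Proof. exact: coord_continuous. Qed.
Lemma ct_comp (f : V -> R) (h : R -> R) : continuous f -> continuous h ->
  continuous (fun q => h (f q)).
Proof. by move=> cf ch x; apply: (@continuous_comp _ _ _ f h); [exact: cf|exact: ch]. Qed.
End Continuity.

Ltac cont_step :=
  match goal with
  | |- continuous (fun x => ?c) => exact: ctC
  | |- continuous (fun x => - @?f x) => apply: (ctN (f := f))
  | |- continuous (fun x => @?f x + @?g x) => apply: (ctD (f := f) (g := g))
  | |- continuous (fun x => @?f x * @?g x) => apply: (ctM (f := f) (g := g))
  | |- continuous (fun x => @?f x ^+ ?n) => apply: (@ctX _ f n)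
  | |- continuous (fun x => (@?f x)^-1) => apply: (ctV (f := f))
  | |- _ => exact: ct_coord
  end.

Section ContinuityKernel.
Variable R : realType.
Notation V := 'rV[R]_3.
Implicit Types (p q : V) (i j k : 'I_3).

Lemma ct_jb : continuous (@jbracket R).
Proof.
rewrite (_ : @jbracket R = (fun p => Num.sqrt (1 + (p 0 i0 ^+ 2 + p 0 i1 ^+ 2 + p 0 i2 ^+ 2)))).
  apply: (ct_comp (f := fun p : V => 1 + (p 0 i0 ^+ 2 + p 0 i1 ^+ 2 + p 0 i2 ^+ 2))
    (h := Num.sqrt)); last exact: sqrt_continuous.
  by repeat cont_step.
by apply/funext => q; rewrite /jbracket -/(nsq q) nsqE.
Qed.

Lemma ct_dot p : continuous (fun q => dotv p q).
Proof.
rewrite (_ : (fun q => _) = (fun q => p 0 i0 * q 0 i0 + p 0 i1 * q 0 i1 + p 0 i2 * q 0 i2)).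
  by repeat cont_step.
by apply/funext => q; rewrite dotvE.
Qed.

Lemma ct_rho p : continuous (fun q => rho p q).
Proof. by rewrite /rho; repeat (cont_step || exact: ct_jb || exact: ct_dot). Qed.

Lemma ct_Sm p i j : continuous (fun q => Sm p q i j).
Proof. by rewrite /Sm; repeat (cont_step || exact: ct_rho). Qed.

Lemma ct_Ker (L : R -> R) p i j : continuous L -> continuous (fun q => Ker L p q i j).
Proof.
move=> cL; have cLr := ct_comp (@ct_rho p) cL.
rewrite /Ker; repeat (cont_step || exact: cLr || exact: ct_Sm || exact: ct_jb).
by move=> q; rewrite mulf_neq0// jb_neq0.
Qed.

Lemma ct_divK (L : R -> R) p i : continuous L -> continuous (fun q => divK L p q i).
Proof.
move=> cL; have cLr := ct_comp (@ct_rho p) cL.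
rewrite /divK; repeat (cont_step || exact: cLr || exact: ct_rho || exact: ct_jb).
by move=> q; rewrite mulf_neq0// jb_neq0.
Qed.

(** Stated in the first slot, because derivatives in q are taken after exchanging
the arguments of the kernel. *)
Lemma ct_dKer1 (L dL : R -> R) p i j : continuous L -> continuous dL ->
  continuous (fun q => dKer L dL q p i j).
Proof.
move=> cL cdL.
have cr : continuous (fun q => rho q p).
  by rewrite (_ : (fun q => _) = (fun q => rho p q)); [exact: ct_rho|apply/funext => q; rewrite rhoC].
have cs : continuous (fun q => srho q p i).
  rewrite /srho; repeat (cont_step || exact: ct_jb); move=> q; exact: jb_neq0.
have cS : continuous (fun q => Sm q p i j).
  by rewrite (_ : (fun q => _) = (fun q => Sm p q i j)); [exact: ct_Sm|apply/funext => q; rewrite Sm_swap].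
have cd : continuous (fun q => dSm q p i j).
  by rewrite /dSm; repeat (cont_step || exact: cr || exact: cs).
have cLr := ct_comp cr cL; have cdLr := ct_comp cr cdL.
rewrite /dKer; repeat (cont_step || exact: cLr || exact: cdLr || exact: cs || exact: cS
  || exact: cd || exact: ct_jb).
all: by move=> q; rewrite mulf_neq0// ?expf_neq0// jb_neq0.
Qed.
End ContinuityKernel.

Section ShellVolume.
Variable R : realType.
Notation V := 'rV[R]_3.
Implicit Types (p q : V) (i j k : 'I_3).

(** A neighbourhood of p of radius about s <p> along p and about s across p. *)
Definition shell p (s : R) : set V := [set q | rho p q ^+ 2 - 1 < 2 * s ^+ 2].

Lemma open_shell p s : open (shell p s).
Proof.
rewrite (_ : shell p s = (fun q => rho p q ^+ 2 - 1) @^-1` [set y | y < 2 * s ^+ 2])//.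
apply: open_comp; last exact: open_lt.
move=> q _; have : continuous (fun q => rho p q ^+ 2 - 1).
  by repeat (cont_step || exact: ct_rho).
exact.
Qed.

Lemma shell_nsq p s q : 0 < s -> s <= 2^-1 -> shell p s q ->
  nsq (q - p) + nsq (cross p q) <= 6 * s ^+ 2 * jbracket p ^+ 2.
Proof.
move=> s0 s2 /=; rewrite /shell /= => hu.
have r1 := rho_ge1 p q; have h := nsq_le_rho p q; have hQ := jb_le_rho p q.
have P0 := jb_gt0 p; have Q0 := jb_gt0 q.
have s4 : s ^+ 2 <= 2^-1 * 2^-1 by rewrite expr2; apply: ler_pM => //; exact: ltW.
have r2 : rho p q <= 3 / 2 by nra.
have Q3 : jbracket q <= 3 * jbracket p by nra.
apply: le_trans h _.
have hr : rho p q - 1 <= s ^+ 2.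
  have : 2 * (rho p q - 1) <= rho p q ^+ 2 - 1 by nra.
  lra.
apply: (@le_trans _ _ (s ^+ 2 * (2 * jbracket p * (3 * jbracket p)))).
  apply: ler_pM => //; first lra.
    by rewrite !mulr_ge0// ltW.
  by rewrite ler_pM2l// mulr_gt0.
by rewrite le_eqVlt; apply/orP; left; apply/eqP; ring.
Qed.

Lemma shell_near p s q : 0 < s -> s <= 2^-1 -> shell p s q -> `|q - p| < 3 * s * jbracket p.
Proof.
move=> s0 s2 hq; have h := shell_nsq s0 s2 hq; have hn := vnorm_sqr_le (q - p).
have := nsq_ge0 (cross p q); have P0 := jb_gt0 p => h0.
rewrite -(@ltr_pXn2r _ 2)// ?nnegrE ?normr_ge0 ?mulr_ge0 ?(ltW s0) ?(ltW P0)//.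
have : 0 < s ^+ 2 * jbracket p ^+ 2 by rewrite mulr_gt0// exprn_gt0.
by rewrite !exprMn; lra.
Qed.

Lemma max_coord p : exists i, forall k, `|p 0 k| <= `|p 0 i|.
Proof.
have [h|h] := leP `|p 0 i0| `|p 0 i1|; have [h'|h'] := leP `|p 0 i1| `|p 0 i2|;
  have [h2|h2] := leP `|p 0 i0| `|p 0 i2|.
all: first [by exists i2; apply: ord3P => //; lra | by exists i1; apply: ord3P => //; lra
  | by exists i0; apply: ord3P => //; lra].
Qed.

(** A bound on p x q controls q_j up to a shear along q_i; taking p_i to be the
largest coordinate of p makes the error O(s) uniformly in p. *)
Lemma shell_shear p s q i j : 0 < s -> s <= 2^-1 -> shell p s q ->
  (forall k, `|p 0 k| <= `|p 0 i|) ->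
  (p 0 i * (q 0 j - p 0 j) - p 0 j * (q 0 i - p 0 i)) ^+ 2 <= nsq (cross p q) ->
  `|q 0 j - (p 0 j + p 0 j / p 0 i * (q 0 i - p 0 i))| < 6 * s.
Proof.
move=> s0 s2 hq hi hc; have h := shell_nsq s0 s2 hq.
set m := p 0 j / p 0 i.
have pm : p 0 j = p 0 i * m.
  have [e|e] := eqVneq (p 0 i) 0; last by rewrite /m mulrC divfK.
  by have := hi j; rewrite e normr0 mul0r normr_le0 => /eqP.
have m1 : m ^+ 2 <= 1.
  have [e|e] := eqVneq (p 0 i) 0; first by rewrite /m e invr0 mulr0 expr0n.
  rewrite -real_normK ?num_real// exprn_ile1// /m normf_div ler_pdivrMr ?normr_gt0// mul1r.
  exact: hi.
have hP : jbracket p ^+ 2 <= 1 + 3 * p 0 i ^+ 2.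
  have hh k : p 0 k ^+ 2 <= p 0 i ^+ 2.
    rewrite -(@real_normK _ (p 0 k)) ?num_real// -(@real_normK _ (p 0 i)) ?num_real//.
    by rewrite ler_pXn2r// nnegrE.
  rewrite jb_sqr; have := hh i0; have := hh i1; have := hh i2; lra.
rewrite opprD addrA; set zj := q 0 j - p 0 j; set zi := q 0 i - p 0 i.
have hz : zj ^+ 2 + zi ^+ 2 <= 2 * nsq (q - p).
  rewrite nsqE !mxE /zj /zi.
  have a0 := sqr_ge0 (q 0 i0 - p 0 i0); have a1 := sqr_ge0 (q 0 i1 - p 0 i1).
  have a2 := sqr_ge0 (q 0 i2 - p 0 i2).
  have hh k : (q 0 k - p 0 k) ^+ 2 <= (q 0 i0 - p 0 i0) ^+ 2 + (q 0 i1 - p 0 i1) ^+ 2 +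
     (q 0 i2 - p 0 i2) ^+ 2 by elim/ord3P: k; lra.
  have := hh i; have := hh j; lra.
have e1 : (p 0 i) ^+ 2 * (zj - m * zi) ^+ 2 <= nsq (cross p q).
  apply: le_trans _ hc; rewrite -exprMn pm -/zi.
  by rewrite le_eqVlt; apply/orP; left; apply/eqP; rewrite /zj pm; ring.
have e2 : (zj - m * zi) ^+ 2 <= 4 * nsq (q - p).
  apply: (@le_trans _ _ (2 * (zj ^+ 2 + m ^+ 2 * zi ^+ 2))).
    have := sqr_ge0 (zj + m * zi); nra.
  have : m ^+ 2 * zi ^+ 2 <= zi ^+ 2 by rewrite ler_piMl// sqr_ge0.
  lra.
have P0 := jb_gt0 p.
have P2 : 0 < jbracket p ^+ 2 by rewrite exprn_gt0.
have D : jbracket p ^+ 2 * (zj - m * zi) ^+ 2 <= jbracket p ^+ 2 * (24 * s ^+ 2).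
  apply: (@le_trans _ _ ((1 + 3 * p 0 i ^+ 2) * (zj - m * zi) ^+ 2)).
    by rewrite ler_wpM2r// sqr_ge0.
  have := nsq_ge0 (q - p); have := nsq_ge0 (cross p q); lra.
rewrite ler_pM2l// in D.
rewrite -(@ltr_pXn2r _ 2)// ?nnegrE ?normr_ge0 ?mulr_ge0 ?(ltW s0)//.
rewrite real_normK ?num_real//; apply: le_lt_trans D _.
have : 0 < s ^+ 2 by rewrite exprn_gt0.
rewrite exprMn; lra.
Qed.

(** The shell lies in a sheared box with two sides of length O(s P) and one of
length O(s). The volume O(s^3 P^2) instead of the crude O(s^3 P^3) is what makes
the zeroth order term bounded in p. *)
Lemma shell_volume p s : 0 < s -> s <= 2^-1 ->
  integ3 (\1_(shell p s)) /\ int3 (\1_(shell p s)) <= 432 * s ^+ 3 * jbracket p ^+ 2.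
Proof.
move=> s0 s2; have P0 := jb_gt0 p.
have ms := meas3_indic (@open_shell p s).
have i0' q : 0 <= (\1_(shell p s) q : R) by rewrite indicE.
have a0 : 0 < 3 * s * jbracket p by rewrite !mulr_gt0.
have b0 : 0 < 6 * s by rewrite mulr_gt0.
have -> : 432 * s ^+ 3 * jbracket p ^+ 2 = 8 * (3 * s * jbracket p) ^+ 2 * (6 * s) by ring.
have out q : ~ shell p s q -> (\1_(shell p s) q : R) = 0 by move=> h; rewrite indicE memNset.
have crd q k : shell p s q -> `|q 0 k - p 0 k| < 3 * s * jbracket p.
  move=> h; apply: le_lt_trans (shell_near s0 s2 h).
  by have := le_vnorm (q - p) k; rewrite !mxE.
have [i] := max_coord p; elim/ord3P: i => hi.
- apply: (sheared_box_mid (c0 := p 0 i0) (c2 := p 0 i2)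
    (c := fun x z => p 0 i1 + p 0 i1 / p 0 i0 * (x - p 0 i0))) => // x y z.
  have [h|h] := pselect (shell p s (vec3 (x, y, z))); last first.
    by rewrite out// !mulr_ge0// ival_ge0.
  rewrite indicE mem_set// !ivalE.
  have := crd _ i0 h; have := crd _ i2 h; rewrite vec3_0 vec3_2 /= => -> ->.
  have := @shell_shear p s _ i0 i1 s0 s2 h hi; rewrite vec3_0 vec3_1 /= => -> //.
    by rewrite !mulr1.
  rewrite nsqE !mxE /=; have := sqr_ge0 (p 0 i1 * z - p 0 i2 * y).
  by have := sqr_ge0 (p 0 i2 * x - p 0 i0 * z); nra.
- apply: (sheared_box_left (c0 := p 0 i1) (c2 := p 0 i2)
    (c := fun y z => p 0 i0 + p 0 i0 / p 0 i1 * (y - p 0 i1))) => // x y z.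
  have [h|h] := pselect (shell p s (vec3 (x, y, z))); last first.
    by rewrite out// !mulr_ge0// ival_ge0.
  rewrite indicE mem_set// !ivalE.
  have := crd _ i1 h; have := crd _ i2 h; rewrite vec3_1 vec3_2 /= => -> ->.
  have := @shell_shear p s _ i1 i0 s0 s2 h hi; rewrite vec3_0 vec3_1 /= => -> //.
    by rewrite !mulr1.
  rewrite nsqE !mxE /=; have := sqr_ge0 (p 0 i1 * z - p 0 i2 * y).
  by have := sqr_ge0 (p 0 i2 * x - p 0 i0 * z); nra.
- apply: (sheared_box_left (c0 := p 0 i1) (c2 := p 0 i2)
    (c := fun y z => p 0 i0 + p 0 i0 / p 0 i2 * (z - p 0 i2))) => // x y z.
  have [h|h] := pselect (shell p s (vec3 (x, y, z))); last first.
    by rewrite out// !mulr_ge0// ival_ge0.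
  rewrite indicE mem_set// !ivalE.
  have := crd _ i1 h; have := crd _ i2 h; rewrite vec3_1 vec3_2 /= => -> ->.
  have := @shell_shear p s _ i2 i0 s0 s2 h hi; rewrite vec3_0 vec3_2 /= => -> //.
    by rewrite !mulr1.
  rewrite nsqE !mxE /=; have := sqr_ge0 (p 0 i1 * z - p 0 i2 * y).
  by have := sqr_ge0 (p 0 i0 * y - p 0 i1 * x); nra.
Qed.
End ShellVolume.

(** * Calculus in several variables *)

Section MultivariateCalculus.
Variable R : realType.
Notation V := 'rV[R]_3.
Implicit Types (p q : V) (i j k : 'I_3) (F : V -> R).
Local Notation D k F := ('D_(basis3 k) F).

Lemma line_mvt F (e a : V) (t : R) : (forall q, derivable F q e) ->
  exists2 s, `|s| <= `|t| & F (t *: e + a) - F a = 'D_e F (s *: e + a) * t.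
Proof.
move=> dF.
have dG (x : R) : is_derive x (1:R) (fun s => F (s *: e + a)) ('D_e F (x *: e + a)).
  by apply: (is_derive_line F e a x _).1; exact: derivableP.
have cG : continuous (fun s : R => F (s *: e + a)).
  by move=> s; apply/differentiable_continuous/derivable1_diffP; case: (dG s).
have Fa : F a = F (0 *: e + a) by rewrite scale0r add0r.
have [t0|t0] := leP 0 t.
  have [s] := MVT_segment t0 (fun x _ => dG x) (continuous_subspaceT cG).
  rewrite in_itv /= => /andP[s0 st] E; exists s; last by rewrite Fa E subr0.
  by rewrite !ger0_norm.
have [s] := MVT_segment (ltW t0) (fun x _ => dG x) (continuous_subspaceT cG).
rewrite in_itv /= => /andP[s0 st] E; exists s.
  by rewrite ler0_norm// ltr0_norm// lerN2.
by rewrite Fa -[LHS]opprB E sub0r mulrN opprK.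
Qed.

(** Moving one coordinate at a time. *)
Lemma mvt3 F q q' : (forall p i, derivable F p (basis3 i)) ->
  exists2 xi : 'I_3 -> V, (forall k, `|xi k - q| <= `|q' - q|) &
    F q' - F q = \sum_(k < 3) D k F (xi k) * (q' - q) 0 k.
Proof.
move=> dF.
pose z := q' - q.
(* the corners of the path from q to q' that changes one coordinate at a time *)
pose a1 := z 0 i0 *: basis3 i0 + q; pose a2 := z 0 i1 *: basis3 i1 + a1.
have a3 : z 0 i2 *: basis3 i2 + a2 = q'.
  by apply/rowP; apply: ord3P; rewrite !mxE /=; ring.
have [s0 h0 E0] := line_mvt q (z 0 i0) (fun q => dF q i0).
have [s1 h1 E1] := line_mvt a1 (z 0 i1) (fun q => dF q i1).
have [s2 h2 E2] := line_mvt a2 (z 0 i2) (fun q => dF q i2).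
pose x0 := s0 *: basis3 i0 + q; pose x1 := s1 *: basis3 i1 + a1.
pose x2 := s2 *: basis3 i2 + a2.
exists (fun k => if k == i0 then x0 else if k == i1 then x1 else x2); last first.
  rewrite sum3 /= -/z -E0 -E1 -E2 a3 /a2 /a1; ring.
have zk k : `|z 0 k| <= `|z| by exact: le_vnorm.
have w (x : V) : (forall k, `|(x - q) 0 k| <= `|z 0 k|) -> `|x - q| <= `|z|.
  by move=> h; apply/vnorm_leP => // k; exact: le_trans (h k) (zk k).
apply: ord3P => /=; apply: w; apply: ord3P; rewrite !mxE /= ?mulr1 ?mulr0 ?addr0 ?add0r ?addrK ?subrr ?normr0//.
- by move: h0; rewrite !mxE.
- by move: h1; rewrite !mxE.
- by move: h2; rewrite !mxE.
Qed.

Lemma local_lipschitz F (p0 : V) (r : R) : (forall p i, derivable F p (basis3 i)) ->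
  (forall i, continuous (D i F)) ->
  exists2 C, 0 <= C & forall q q', `|q - p0| <= r -> `|q' - p0| <= r ->
    `|F q' - F q| <= C * `|q' - q|.
Proof.
move=> dF cF.
have [C0 C00 h0] := bounded_on_cube (3 * r + `|p0|) (cF i0).
have [C1 C10 h1] := bounded_on_cube (3 * r + `|p0|) (cF i1).
have [C2 C20 h2] := bounded_on_cube (3 * r + `|p0|) (cF i2).
exists (C0 + C1 + C2) => [|q q' hq hq']; first by rewrite !addr_ge0.
have [xi hxi ->] := mvt3 q q' dF.
have hx k : `|xi k| <= 3 * r + `|p0|.
  have -> : xi k = (xi k - q) + (q - p0) + p0 by rewrite addrA !subrK.
  apply: le_trans (ler_normD _ _) _; rewrite lerD2r.
  apply: le_trans (ler_normD _ _) _.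
  have : `|q' - q| <= `|q' - p0| + `|q - p0|.
    rewrite (_ : q' - q = (q' - p0) - (q - p0)); first exact: ler_normB.
    by rewrite opprB addrA subrK.
  have := hxi k; lra.
have hz k : `|(q' - q) 0 k| <= `|q' - q| by exact: le_vnorm.
rewrite sum3 !mulrDl.
apply: le_trans (ler_normD _ _) _; apply: lerD; last first.
  by rewrite normrM; apply: ler_pM => //; exact: h2.
apply: le_trans (ler_normD _ _) _; apply: lerD; rewrite normrM; apply: ler_pM => //.
  exact: h0.
exact: h1.
Qed.

(** Continuous partial derivatives suffice for all directional derivatives. *)
Lemma chain_rule F p (e : V) : (forall p i, derivable F p (basis3 i)) ->
  (forall i, continuous (D i F)) ->
  is_derive p e F (\sum_(k < 3) D k F p * e 0 k).
Proof.
move=> dF cF.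
have H : h^-1 *: ((F \o shift p) (h *: e) - F p) @[h --> (0:R)^'] -->
    (\sum_(k < 3) D k F p * e 0 k : R).
  apply/cvgrPdist_lt => eps e0.
  pose A := 3 * (`|e| + 1).
  have A0 : 0 < A by rewrite mulr_gt0// ltr_wpDl.
  have hk k : \forall q \near p, `|D k F p - D k F q| < eps / A.
    have /cvgrPdist_lt := cF k p; apply; exact: divr_gt0.
  have hd' k : exists2 d, 0 < d & forall q, `|p - q| < d -> `|D k F p - D k F q| < eps / A.
    by have /nbhs_normP[d /= d0 hd] := hk k; exists d.
  have [d [d0 hd]] : exists d, 0 < d /\ forall q, ball_ Num.norm p d q ->
      forall k, `|D k F p - D k F q| < eps / A.
    have [a a0 ha] := hd' i0; have [b b0 hb] := hd' i1; have [c c0 hc] := hd' i2.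
    exists (Num.min a (Num.min b c)); split; first by rewrite !lt_min a0 b0.
    move=> q; rewrite /ball_ /= !lt_min => /and3P[qa qb qc].
    by elim/ord3P; [exact: ha|exact: hb|exact: hc].
  near=> h.
  have h0 : h != 0 by near: h; exact: nbhs_dnbhs_neq.
  rewrite /=; have [xi hxi ->] := mvt3 p (h *: e + p) dF.
  rewrite addrK.
  have hx k : `|D k F p - D k F (xi k)| < eps / A.
    have : ball_ Num.norm p d (xi k).
      rewrite /ball_ /= distrC; apply: le_lt_trans (hxi k) _; rewrite addrK normrZ.
      apply: (@le_lt_trans _ _ (`|h| * (`|e| + 1))).
        by rewrite ler_wpM2l// lerDl.
      rewrite -ltr_pdivlMr; last by rewrite ltr_wpDl.
      near: h; apply: dnbhs0_lt; by rewrite divr_gt0// ltr_wpDl.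
    by move=> /hd /(_ k).
  rewrite (_ : h^-1 *: _ = \sum_(k < 3) D k F (xi k) * e 0 k); last first.
    rewrite -[LHS]/(h^-1 * _) big_distrr /=; apply: eq_bigr => k _.
    by rewrite mxE mulrCA mulKf.
  rewrite -sumrB; under eq_bigr do rewrite -mulrBl.
  have b k : `|(D k F p - D k F (xi k)) * e 0 k| <= eps / A * `|e|.
    rewrite normrM; apply: ler_pM => //; [exact: ltW|exact: le_vnorm].
  rewrite sum3.
  apply: (@le_lt_trans _ _ (3 * (eps / A * `|e|))).
    apply: le_trans (ler_normD _ _) _.
    have := ler_normD ((D i0 F p - D i0 F (xi i0)) * e 0 i0) ((D i1 F p - D i1 F (xi i1)) * e 0 i1).
    have := b i0; have := b i1; have := b i2; lra.
  have -> : 3 * (eps / A * `|e|) = eps * (`|e| / (`|e| + 1)).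
    by rewrite /A; field; rewrite gt_eqF// ltr_wpDl.
  by rewrite gtr_pMr// ltr_pdivrMr ?mul1r ?ltrDl// ltr_wpDl.
by apply: DeriveDef; [apply/cvg_ex; eexists; exact: H|exact: cvg_lim H].
Unshelve. all: by end_near. Qed.

(** Were c positive, dg would be positive just to the right of 0 and g would
increase. *)
Lemma second_derivative_test (g dg : R -> R) (c d : R) : 0 < d ->
  (forall s : R, is_derive s (1:R) g (dg s)) ->
  is_derive (0:R) (1:R) dg c -> (forall s, `|s| < d -> g s <= g 0) ->
  dg 0 = 0 /\ c <= 0.
Proof.
move=> d0 hg [dc1 dc2] mx.
have dg0 : dg 0 = 0.
  have [|||t|_ h] := @derive1_at_max _ g (- d) d 0; last by have [_ <-] := hg 0.
  - by lra.
  - by move=> t _; case: (hg t).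
  - by rewrite in_itv /= oppr_lt0 d0.
  - by rewrite in_itv /= -ltr_norml; exact: mx.
split=> //; rewrite leNgt; apply/negP => c0.
have cv : h^-1 *: ((dg \o shift 0) (h *: (1:R)) - dg 0) @[h --> (0:R)^'] --> c.
  by rewrite -dc2; exact: dc1.
have /nbhs_normP[r /= r0 hr] : \forall h \near (0:R)^', 0 < h^-1 *: ((dg \o shift 0) (h *: (1:R)) - dg 0).
  by move: cv => /cvgr_gt; apply.
pose s := Num.min (r / 2) (d / 2).
have s0 : 0 < s by rewrite lt_min !divr_gt0.
have sd : s < d by rewrite gt_min; apply/orP; right; lra.
have sr : s < r by rewrite gt_min; apply/orP; left; lra.
have cg : continuous g.
  by move=> x; apply/differentiable_continuous/derivable1_diffP; case: (hg x).
have [x] := MVT s0 (fun x _ => hg x) (continuous_subspaceT cg).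
rewrite in_itv /= subr0 => /andP[x0 xs] E.
have : 0 < dg x.
  have := hr x; rewrite /ball_ /= sub0r normrN gtr0_norm// => /(_ (lt_trans xs sr)).
  rewrite gt_eqF// => /(_ isT); rewrite dg0 subr0 addr0.
  by rewrite -[_ *: _]/(x^-1 * dg (x * 1)) mulr1 pmulr_rgt0// invr_gt0.
move=> dx; have : 0 < g s - g 0 by rewrite E mulr_gt0.
by rewrite subr_gt0 ltNge mx// gtr0_norm.
Qed.

(** The second derivative test along the line through p in the direction e. *)
Lemma hessian_test F p (d : R) (e : V) : 0 < d ->
  (forall p i, derivable F p (basis3 i)) ->
  (forall i, continuous (D i F)) ->
  (forall p i j, derivable (D j F) p (basis3 i)) ->
  (forall i j, continuous (D i (D j F))) ->
  (forall q, `|q - p| < d -> F q <= F p) ->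
  (\sum_(j < 3) D j F p * e 0 j = 0) /\
  \sum_(j < 3) \sum_(i < 3) D i (D j F) p * (e 0 i * e 0 j) <= 0.
Proof.
move=> d0 dF cF ddF cdF mx.
pose g (s : R) := F (s *: e + p).
pose dg (s : R) := \sum_(j < 3) D j F (s *: e + p) * e 0 j.
have h1 (s : R) : is_derive s (1:R) g (dg s).
  by apply: (is_derive_line F e p s _).1; exact: chain_rule.
have h2 : is_derive (0:R) (1:R) dg
    (\sum_(j < 3) \sum_(i < 3) D i (D j F) p * (e 0 i * e 0 j)).
  rewrite /dg (_ : (fun s => _) = \sum_(j < 3) (fun s => D j F (s *: e + p) * e 0 j)); last first.
    by apply/funext => s; rewrite fct_sumE.
  apply: is_derive_sum => j.
  have hj : is_derive (0:R) (1:R) (fun s => D j F (s *: e + p)) (\sum_(i < 3) D i (D j F) p * e 0 i).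
    apply: (is_derive_line (D j F) e p 0 _).1; rewrite scale0r add0r.
    by apply: chain_rule => // q i; exact: ddF.
  eapply is_derive_eq; first exact: (dvM hj (dvC _ _ _)).
  rewrite mulr0 add0r mulrC mulr_suml; apply: eq_bigr => i _; ring.
have e1 : 0 < `|e| + 1 by rewrite ltr_wpDl.
have [] := @second_derivative_test g dg _ (d / (`|e| + 1)) _ h1 h2.
- exact: divr_gt0.
- move=> s hs; rewrite /g scale0r add0r; apply: mx; rewrite addrK normrZ.
  apply: (@le_lt_trans _ _ (`|s| * (`|e| + 1))); first by rewrite ler_wpM2l// lerDl.
  by rewrite -ltr_pdivlMr.
- move=> + h; rewrite /dg => h'; split => //; apply: etrans h'; apply: eq_bigr => j _.
  by rewrite scale0r add0r.
Qed.
End MultivariateCalculus.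

(** * The kernel near the diagonal *)

Section SingularKernel.
Variable R : realType.
Notation V := 'rV[R]_3.
Implicit Types (p q : V) (i j k : 'I_3).
Local Notation jb := jbracket.
Local Notation D k F := ('D_(basis3 k) F).

(** The profile of the relativistic Landau kernel. *)
Definition lam (r : R) : R := r ^+ 2 * (Num.sqrt (r ^+ 2 - 1)) ^- 3.
Definition dlam (r : R) : R :=
  2 * r * (Num.sqrt (r ^+ 2 - 1)) ^- 3 - 3 * r ^+ 3 * (Num.sqrt (r ^+ 2 - 1)) ^- 5.

Lemma powR_m32 (x : R) : 0 <= x -> x `^ (- (3 / 2)) = (Num.sqrt x) ^- 3.
Proof.
rewrite le_eqVlt => /predU1P[<-|x0].
  by rewrite powR0 ?sqrtr0 ?expr0n ?invr0// oppr_eq0 mulf_neq0// invr_neq0.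
have w0 : 0 <= Num.sqrt x by exact: sqrtr_ge0.
rewrite -[in LHS](@sqr_sqrtr _ x) ?(ltW x0)// -powR_mulrn// -powRrM.
by rewrite (_ : 2%:R * - (3 / 2) = - 3%:R) ?powR_invn//; field.
Qed.

Lemma PhiRLE p q i j : PhiRL p q i j = Ker lam p q i j.
Proof.
have r1 := rho_ge1 p q.
rewrite /PhiRL mxE SRLE /LambdaRL /= tauE.
rewrite (_ : (rho p q + 1) * (rho p q + 1 - 2) = rho p q ^+ 2 - 1); last by ring.
rewrite powR_m32; last by rewrite subr_ge0 exprn_ege1.
by rewrite addrK /Ker /lam; ring.
Qed.

Lemma lam_derive (r : R) : 1 < r -> is_derive r (1:R) lam (dlam r).
Proof.
move=> r1; have u0 : 0 < r ^+ 2 - 1 by rewrite subr_gt0 exprn_egt1.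
have w0 : Num.sqrt (r ^+ 2 - 1) != 0 by rewrite gt_eqF// sqrtr_gt0.
have h1 : is_derive r (1:R) (fun r : R => r ^+ 2) (2 * r).
  by eapply is_derive_eq; [exact: (dvX 2 (is_derive_id r 1))|rewrite /= expr1 mulr1].
have h2 : is_derive r (1:R) (fun r : R => r ^+ 2 - 1) (2 * r).
  by eapply is_derive_eq; [exact: (dvD h1 (dvC r 1 (-1)))|rewrite addr0].
have h3 := dv_comp h2 (is_derive1_sqrt u0).
have h4 := dvX 3 h3.
have f0 : (fun y : R => Num.sqrt (y ^+ 2 - 1) ^+ 3) r != 0 by rewrite expf_neq0.
have h5 := dvV (f := fun y : R => Num.sqrt (y ^+ 2 - 1) ^+ 3) f0 h4.
rewrite /lam; eapply is_derive_eq; first exact: (dvM h1 h5).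
by rewrite /dlam /=; field.
Qed.

Section Diff.
Variable s : R.
Hypothesis s0 : 0 < s.

(** What the regularisation removes; it is supported in u <= s^2. *)
Definition kap (r : R) : R := lam r - Lreg s r.
Definition dkap (r : R) : R := dlam r - dLreg s r.

Lemma kap_derive (r : R) : 1 < r -> is_derive r (1:R) kap (dkap r).
Proof.
move=> r1; have h1 := lam_derive r1; have h2 := Lreg_derive s0 r.
exact: (dvD h1 (dvN h2)).
Qed.

Lemma kap_far (r : R) : s ^+ 2 < r ^+ 2 - 1 -> kap r = 0.
Proof. by move=> h; rewrite /kap /Lreg psi_large// subrr. Qed.

Lemma kap_bound (r : R) : 1 < r -> `|kap r| <= r ^+ 2 * (Num.sqrt (r ^+ 2 - 1)) ^- 3.
Proof.
move=> r1; have u0 : 0 < r ^+ 2 - 1 by rewrite subr_gt0 exprn_egt1.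
have h := psi_le s0 u0; have h2 := psi_ge0 s0 (r ^+ 2 - 1).
have r2 : 0 <= r ^+ 2 by exact: sqr_ge0.
rewrite /kap /lam /Lreg -mulrBr normrM ger0_norm// ler_wpM2l// ger0_norm ?subr_ge0//.
lra.
Qed.

Lemma dkap_bound (r : R) : 1 < r -> `|dkap r| <=
  2 * r * (Num.sqrt (r ^+ 2 - 1)) ^- 3 + 3 * r ^+ 3 * (Num.sqrt (r ^+ 2 - 1)) ^- 5.
Proof.
move=> r1; have u0 : 0 < r ^+ 2 - 1 by rewrite subr_gt0 exprn_egt1.
have h := psi_le s0 u0; have h2 := psi_ge0 s0 (r ^+ 2 - 1).
have h3 := dpsi_le0 s0 (r ^+ 2 - 1).
have h4 : - (3 / 2 * (Num.sqrt (r ^+ 2 - 1)) ^- 5) <= dpsi s (r ^+ 2 - 1).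
  have [us|us] := leP (r ^+ 2 - 1) (s ^+ 2); last by rewrite dpsi_large.
  rewrite dpsi_small// lerN2 ler_pM2l ?divr_gt0// lef_pV2 ?posrE ?exprn_gt0 ?sqrtr_gt0//.
  rewrite ler_pXn2r// ?nnegrE ?sqrtr_ge0 ?(ltW s0)//.
  by rewrite -[leRHS](gtr0_norm s0) -sqrtr_sqr ler_sqrt// exprn_ge0// ltW.
rewrite /dkap /dlam /dLreg.
have -> : 2 * r / Num.sqrt (r ^+ 2 - 1) ^+ 3 - 3 * r ^+ 3 / Num.sqrt (r ^+ 2 - 1) ^+ 5 -
  (2 * r * psi s (r ^+ 2 - 1) + 2 * r ^+ 3 * dpsi s (r ^+ 2 - 1)) = 2 * r * ((Num.sqrt (r ^+ 2 - 1)) ^- 3 - psi s (r ^+ 2 - 1))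
   - 2 * r ^+ 3 * (dpsi s (r ^+ 2 - 1) + 3 / 2 * (Num.sqrt (r ^+ 2 - 1)) ^- 5).
  by move: (_ ^- 3) (_ ^- 5) => a b; field.
have r3 : 0 < r ^+ 3 by rewrite exprn_gt0// (lt_trans ltr01).
apply: le_trans (ler_normB _ _) _; apply: lerD.
  rewrite normrM ger0_norm; last lra.
  by rewrite ler_pM2l; [rewrite ger0_norm; lra|lra].
rewrite normrM ger0_norm; last lra.
rewrite ger0_norm; last lra.
rewrite (_ : 3 * r ^+ 3 * _ = 2 * r ^+ 3 * (3 / 2 * (Num.sqrt (r ^+ 2 - 1)) ^- 5)); last first.
  by move: (_ ^- 5) => b; field.
by rewrite ler_pM2l; lra.
Qed.
End Diff.

Section Bounds.
Variable A : R.
Hypothesis A1 : 1 <= A.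

Section TwoPoints.
Variables p q : V.
Hypotheses (hP : jb p <= A) (hQ : jb q <= A).
Let t := `|q - p|.
Let P1 : 1 <= jb p. Proof. exact: jb_ge1 p. Qed.
Let Q1 : 1 <= jb q. Proof. exact: jb_ge1 q. Qed.
Let P0 : 0 < jb p. Proof. exact: jb_gt0 p. Qed.
Let Q0 : 0 < jb q. Proof. exact: jb_gt0 q. Qed.
Let t0 : 0 <= t. Proof. exact: normr_ge0. Qed.
Let r1 : 1 <= rho p q. Proof. exact: rho_ge1 p q. Qed.
Let AA0 : 1 <= A ^+ 2. Proof. exact: exprn_ege1. Qed.

(** In this section p and q range over a bounded set, and t = |q - p|. The kernel
quantities are compared with powers of t: rho - 1 and S are O(t^2), while the
gradient of rho and the derivative of S are O(t). *)
Lemma diag_rho_le : rho p q <= 2 * A ^+ 2.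
Proof.
have [lP1 lQ1 lP0 lQ0] := And4 P1 Q1 P0 Q0; have [lt0 lr1 lAA lA1] := And4 t0 r1 AA0 A1.
apply: le_trans (rho_le p q) _; rewrite -mulrA ler_pM2l// expr2.
by apply: ler_pM => //; exact: jb_ge0.
Qed.

Lemma diag_rho1 : rho p q - 1 <= 3 * A ^+ 2 * t ^+ 2.
Proof.
have [lP1 lQ1 lP0 lQ0] := And4 P1 Q1 P0 Q0; have [lt0 lr1 lAA lA1] := And4 t0 r1 AA0 A1.
have h := rho1E p q.
have hc : nsq (cross p q) <= (A ^+ 2 - 1) * (3 * t ^+ 2).
  have -> : nsq (cross p q) = nsq (cross p (q - p)).
    by rewrite !nsqE !mxE /=; ring.
  have -> : nsq (cross p (q - p)) = nsq p * nsq (q - p) - dotv p (q - p) ^+ 2.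
    by rewrite !nsqE dotvE !mxE /=; ring.
  apply: (@le_trans _ _ (nsq p * nsq (q - p))); first by rewrite gerBl sqr_ge0.
  apply: ler_pM; rewrite ?nsq_ge0//; last exact: nsq_le_vnorm.
  by rewrite nsq_jb lerD2r ler_pXn2r ?nnegrE ?jb_ge0//; exact: le_trans ler01 A1.
have hz := nsq_le_vnorm (q - p); rewrite -/t in hz.
have D : 1 <= jb p * jb q + dotv p q + 1.
  have := dot_le_jb p q; have := ler_norm (- dotv p q); rewrite normrN; lra.
have : rho p q - 1 <= (rho p q - 1) * (jb p * jb q + dotv p q + 1).
  by rewrite ler_peMr// subr_ge0.
rewrite h; lra.
Qed.

Lemma diag_u : rho p q ^+ 2 - 1 <= 9 * A ^+ 4 * t ^+ 2.
Proof.
have [lP1 lQ1 lP0 lQ0] := And4 P1 Q1 P0 Q0; have [lt0 lr1 lAA lA1] := And4 t0 r1 AA0 A1.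
have -> : rho p q ^+ 2 - 1 = (rho p q - 1) * (rho p q + 1) by ring.
have -> : 9 * A ^+ 4 * t ^+ 2 = (3 * A ^+ 2 * t ^+ 2) * (3 * A ^+ 2) by ring.
apply: ler_pM; [lra|lra|exact: diag_rho1|have := diag_rho_le; lra].
Qed.

Lemma diag_sqrt : 0 < t -> 0 < Num.sqrt (rho p q ^+ 2 - 1) /\
   (Num.sqrt (rho p q ^+ 2 - 1))^-1 <= A / t.
Proof.
have [lP1 lQ1 lP0 lQ0] := And4 P1 Q1 P0 Q0; have [lt0 lr1 lAA lA1] := And4 t0 r1 AA0 A1.
move=> tp.
have r2 : 1 < rho p q.
  have h := nsq_le_rho p q; have := nsq_ge0 (cross p q); have := vnorm_sqr_le (q - p) => h1 h2.
  have : 0 < t ^+ 2 by rewrite exprn_gt0.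
  rewrite -/t in h1; rewrite -subr_gt0 => h3.
  have : 0 < (rho p q - 1) * (2 * jb p * jb q) by lra.
  by rewrite pmulr_lgt0// !mulr_gt0.
have u0 : 0 < rho p q ^+ 2 - 1 by rewrite subr_gt0 exprn_egt1.
split; first by rewrite sqrtr_gt0.
apply: le_trans (sqrtu_bound r2).2 _.
rewrite -/t ler_pM2r ?invr_gt0//.
rewrite -[leRHS](@ger0_norm _ A) ?(le_trans ler01)// -sqrtr_sqr ler_sqrt ?sqr_ge0// expr2.
by apply: ler_pM => //; exact: jb_ge0.
Qed.

Let zi k : `|p 0 k - q 0 k| <= t.
Proof. by have := le_vnorm (q - p) k; rewrite !mxE distrC. Qed.

Lemma diag_S i j : `|Sm p q i j| <= 16 * A ^+ 4 * t ^+ 2.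
Proof.
have [lP1 lQ1 lP0 lQ0] := And4 P1 Q1 P0 Q0; have [lt0 lr1 lAA lA1] := And4 t0 r1 AA0 A1.
have hd : `|(i == j)%:R : R| <= 1 by case: eqP; rewrite ?normr1 ?normr0.
have hu : 0 <= rho p q ^+ 2 - 1 by rewrite subr_ge0 exprn_ege1.
have h1 : `|(rho p q ^+ 2 - 1) * (i == j)%:R| <= 9 * A ^+ 4 * t ^+ 2.
  by rewrite normrM -[leRHS]mulr1; apply: ler_pM => //; rewrite ger0_norm//; exact: diag_u.
have h2 : `|(p 0 i - q 0 i) * (p 0 j - q 0 j)| <= t ^+ 2.
  by rewrite normrM expr2; apply: ler_pM.
have h3 : `|p 0 i * q 0 j + p 0 j * q 0 i| <= 2 * A ^+ 2.
  apply: le_trans (ler_normD _ _) _; rewrite !normrM.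
  have b k l : `|p 0 k| * `|q 0 l| <= A ^+ 2.
    by rewrite expr2; apply: ler_pM => //; exact: le_trans (le_coord_jb _ _) _.
  have := b i j; have := b j i; lra.
have h4 : `|(rho p q - 1) * (p 0 i * q 0 j + p 0 j * q 0 i)| <= 6 * A ^+ 4 * t ^+ 2.
  rewrite normrM ger0_norm ?subr_ge0//.
  rewrite (_ : 6 * _ * _ = 3 * A ^+ 2 * t ^+ 2 * (2 * A ^+ 2)); last by ring.
  apply: ler_pM => //; [lra|exact: diag_rho1].
rewrite /Sm; apply: le_trans (ler_normD _ _) _.
have := ler_normB ((rho p q ^+ 2 - 1) * (i == j)%:R) ((p 0 i - q 0 i) * (p 0 j - q 0 j)).
have : t ^+ 2 <= A ^+ 4 * t ^+ 2 by rewrite ler_peMl ?exprn_ege1 ?sqr_ge0.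
lra.
Qed.

Lemma diag_srho i : `|srho p q i| <= 3 * t.
Proof.
have [lP1 lQ1 lP0 lQ0] := And4 P1 Q1 P0 Q0; have [lt0 lr1 lAA lA1] := And4 t0 r1 AA0 A1.
have -> : srho p q i = (p 0 i - q 0 i) + (jb q - jb p) * (p 0 i / jb p).
  by rewrite /srho; field; rewrite gt_eqF.
apply: le_trans (ler_normD _ _) _; rewrite (_ : 3 * t = t + (2 * t) * 1); last by ring.
apply: lerD => //; rewrite normrM; apply: ler_pM => //.
  rewrite ler_norml; have := jb_lip p q; have := jb_lip q p; rewrite distrC -/t; lra.
by rewrite normrM normfV (gtr0_norm P0) ler_pdivrMr// mul1r le_coord_jb.
Qed.

Lemma diag_dS i j : t <= 2 * A -> `|dSm p q i j| <= 32 * A ^+ 4 * t.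
Proof.
have [lP1 lQ1 lP0 lQ0] := And4 P1 Q1 P0 Q0; have [lt0 lr1 lAA lA1] := And4 t0 r1 AA0 A1.
move=> tA.
have hd : `|(i == j)%:R : R| <= 1 by case: eqP; rewrite ?normr1 ?normr0.
have A4 : A ^+ 2 <= A ^+ 4 by rewrite ler_weXn2l.
have A3 : A ^+ 3 <= A ^+ 4 by rewrite ler_weXn2l.
have h0 : `|2 * rho p q * srho p q i * (i == j)%:R| <= 12 * A ^+ 2 * t.
  rewrite normrM -[leRHS]mulr1; apply: ler_pM => //.
  rewrite normrM (_ : 12 * _ * _ = 4 * A ^+ 2 * (3 * t)); last by ring.
  apply: ler_pM => //; last exact: diag_srho.
  rewrite ger0_norm; [have := diag_rho_le; lra|lra].
have h1 : `|(p 0 j - q 0 j) + (p 0 i - q 0 i) * (i == j)%:R| <= 2 * t.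
  apply: le_trans (ler_normD _ _) _; rewrite (_ : 2 * t = t + t * 1); last by ring.
  by apply: lerD => //; rewrite normrM; apply: ler_pM.
have h3 : `|p 0 i * q 0 j + p 0 j * q 0 i| <= 2 * A ^+ 2.
  apply: le_trans (ler_normD _ _) _; rewrite !normrM.
  have b k l : `|p 0 k| * `|q 0 l| <= A ^+ 2.
    by rewrite expr2; apply: ler_pM => //; exact: le_trans (le_coord_jb _ _) _.
  have := b i j; have := b j i; lra.
have h4 : `|srho p q i * (p 0 i * q 0 j + p 0 j * q 0 i)| <= 6 * A ^+ 2 * t.
  rewrite normrM (_ : 6 * _ * _ = 3 * t * (2 * A ^+ 2)); last by ring.
  by apply: ler_pM => //; exact: diag_srho.
have h5 : `|(rho p q - 1) * (q 0 j + q 0 i * (i == j)%:R)| <= 12 * A ^+ 4 * t.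
  rewrite normrM (_ : 12 * _ * _ = 6 * A ^+ 3 * t * (2 * A)); last by ring.
  apply: ler_pM => //.
    rewrite ger0_norm ?subr_ge0//; apply: le_trans diag_rho1 _.
    rewrite (_ : 3 * _ * _ = 3 * A ^+ 2 * t * t); last by ring.
    rewrite (_ : 6 * _ * _ = 3 * A ^+ 2 * t * (2 * A)); last by ring.
    apply: ler_wpM2l => //; apply: mulr_ge0 => //; lra.
  apply: le_trans (ler_normD _ _) _; rewrite (_ : 2 * A = A + A * 1); last by ring.
  apply: lerD; first exact: le_trans (le_coord_jb _ _) _.
  by rewrite normrM; apply: ler_pM => //; exact: le_trans (le_coord_jb _ _) _.
have hA2 : A ^+ 2 * t <= A ^+ 4 * t by rewrite ler_wpM2r.
have hA0 : t <= A ^+ 4 * t by rewrite ler_peMl// exprn_ege1.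
have tri (x y z w : R) : `|x - y + (z + w)| <= `|x| + `|y| + `|z| + `|w|.
  have := ler_normD (x - y) (z + w); have := ler_normB x y; have := ler_normD z w; lra.
apply: le_trans (tri _ _ _ _) _; lra.
Qed.
End TwoPoints.
End Bounds.
End SingularKernel.

Section RemainderKernel.
Variable R : realType.
Notation V := 'rV[R]_3.
Implicit Types (p q : V) (i j k : 'I_3).
Local Notation jb := jbracket.
Local Notation D k F := ('D_(basis3 k) F).

(** The profile is O(t^-3) and its derivative O(t^-5), while S is O(t^2), its
derivative O(t) and the gradient of rho O(t). The constant does not depend on s. *)
Lemma kap_kernel_bound (A : R) : 1 <= A -> exists2 C, 0 <= C &
  forall s p q i j, 0 < s -> jb p <= A -> jb q <= A -> 0 < `|q - p| ->
    `|Ker (kap s) p q i j| <= C / `|q - p| /\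
    `|dKer (kap s) (dkap s) p q i j| <= C / `|q - p| ^+ 2.
Proof.
move=> A1; have A0 : 0 < A by exact: lt_le_trans A1.
pose K1 := 4 * A ^+ 7; pose K2 := 40 * A ^+ 11; pose K3 := 16 * A ^+ 4; pose K4 := 32 * A ^+ 4.
have An n : 0 < A ^+ n by rewrite exprn_gt0.
have K10 : 0 < K1 by rewrite mulr_gt0.
have K20 : 0 < K2 by rewrite mulr_gt0.
have K30 : 0 < K3 by rewrite mulr_gt0.
have K40 : 0 < K4 by rewrite mulr_gt0.
have K130 := mulr_gt0 K10 K30; have K140 := mulr_gt0 K10 K40; have K230 := mulr_gt0 K20 K30.
have K13A := mulr_gt0 K130 A0.
exists (K1 * K3 + (3 * (K2 * K3) + K1 * K4 + 2 * (K1 * K3 * A))); first lra.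
move=> s p q i j s0 hP hQ t0; set t := `|q - p| in t0 *.
have tA : t <= 2 * A.
  rewrite /t; apply: le_trans (ler_normB _ _) _.
  have h (x : V) : jb x <= A -> `|x| <= A.
    by move=> h; apply/vnorm_leP; [exact: ltW|move=> k; exact: le_trans (le_coord_jb _ _) h].
  have := h _ hP; have := h _ hQ; lra.
have [w0 hw] := diag_sqrt A1 hP hQ t0; rewrite -/t in hw.
have r1 : 1 < rho p q.
  have := rho_ge1 p q; rewrite le_eqVlt => /predU1P[E|//].
  by exfalso; move: w0; rewrite -E expr1n subrr sqrtr0 ltxx.
have r2 := diag_rho_le A1 hP hQ.
have hk := kap_bound s0 r1; have hdk := dkap_bound s0 r1.
have hS := diag_S A1 hP hQ i j; have hs := diag_srho A1 p q i; have hdS := diag_dS A1 hP hQ i j tA.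
rewrite -/t in hS hs hdS.
have it0 : 0 < t^-1 by rewrite invr_gt0.
have pw n : (Num.sqrt (rho p q ^+ 2 - 1)) ^- n <= A ^+ n * t ^- n.
  by rewrite -!exprVn -exprMn lerXn2r// nnegrE ?invr_ge0 ?sqrtr_ge0// mulr_ge0// ltW.
have tn n : 0 < t ^- n by rewrite invr_gt0 exprn_gt0.
have wn n : 0 <= (Num.sqrt (rho p q ^+ 2 - 1)) ^- n by rewrite invr_ge0 exprn_ge0// ltW.
have r0 : 0 <= rho p q by lra.
have rn n : rho p q ^+ n <= (2 * A ^+ 2) ^+ n.
  by rewrite lerXn2r// nnegrE// mulr_ge0// ltW.
have t2 : t ^- 3 <= 4 * A ^+ 2 * t ^- 5.
  rewrite (_ : t ^- 3 = t ^+ 2 * t ^- 5); last by field; rewrite gt_eqF.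
  rewrite ler_pM2r// (_ : 4 * A ^+ 2 = (2 * A) ^+ 2); last by ring.
  by rewrite lerXn2r// nnegrE ?mulr_ge0// ltW.
have kb : `|kap s (rho p q)| <= K1 * t ^- 3.
  apply: le_trans hk _.
  rewrite (_ : K1 * t ^- 3 = (2 * A ^+ 2) ^+ 2 * (A ^+ 3 * t ^- 3)); last by rewrite /K1; ring.
  by apply: ler_pM; [exact: sqr_ge0|exact: wn|exact: rn|exact: pw].
have dkb : `|dkap s (rho p q)| <= K2 * t ^- 5.
  apply: le_trans hdk _.
  have h1 : 2 * rho p q * Num.sqrt (rho p q ^+ 2 - 1) ^- 3 <= 16 * A ^+ 11 * t ^- 5.
    apply: (@le_trans _ _ (2 * (2 * A ^+ 2) * (A ^+ 3 * t ^- 3))).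
      by apply: ler_pM; [lra|exact: wn|lra|exact: pw].
    apply: (@le_trans _ _ (4 * A ^+ 5 * (4 * A ^+ 2 * t ^- 5))).
      rewrite (_ : 2 * (2 * A ^+ 2) * (A ^+ 3 * t ^- 3) = 4 * A ^+ 5 * t ^- 3); last by ring.
      by rewrite ler_pM2l// mulr_gt0.
    rewrite (_ : 4 * A ^+ 5 * (4 * A ^+ 2 * t ^- 5) = 16 * (A ^+ 7 * t ^- 5)); last by ring.
    by rewrite -mulrA ler_pM2l// ler_pM2r// ler_weXn2l.
  have h2 : 3 * rho p q ^+ 3 * Num.sqrt (rho p q ^+ 2 - 1) ^- 5 <= 24 * A ^+ 11 * t ^- 5.
    rewrite (_ : 24 * A ^+ 11 * t ^- 5 = 3 * (2 * A ^+ 2) ^+ 3 * (A ^+ 5 * t ^- 5)); last by ring.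
    apply: ler_pM; [|exact: wn| |exact: pw]; first by rewrite mulr_ge0// exprn_ge0.
    by rewrite ler_pM2l//; exact: rn.
  rewrite /K2; lra.
have PQ1 : (jb p * jb q)^-1 <= 1.
  by rewrite invf_le1 ?mulr_gt0 ?jb_gt0// mulr_ege1// jb_ge1.
have PQ0 : 0 <= (jb p * jb q)^-1 by rewrite invr_ge0 mulr_ge0// jb_ge0.
have kS : `|kap s (rho p q) * Sm p q i j| <= K1 * K3 * t^-1.
  rewrite normrM (_ : K1 * K3 * t^-1 = K1 * t ^- 3 * (K3 * t ^+ 2)); last by field; rewrite gt_eqF.
  exact: ler_pM.
have m1 (x y z : R) : `|x| <= y -> 0 <= z -> z <= 1 -> `|x * z| <= y.
  move=> h z0 z1; rewrite normrM (ger0_norm z0) -[leRHS]mulr1; exact: ler_pM.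
have tt : t^-1 = t * t ^- 2 by field; rewrite gt_eqF.
have i2 : 0 <= t ^- 2 by exact: ltW.
split.
  rewrite /Ker; apply: le_trans (m1 _ _ _ kS PQ0 PQ1) _.
  by rewrite ler_pM2r//; lra.
have e1 : `|dkap s (rho p q) * srho p q i * Sm p q i j / (jb p * jb q)| <= 3 * (K2 * K3) * t ^- 2.
  apply: m1 => //; rewrite !normrM.
  rewrite (_ : 3 * (K2 * K3) * t ^- 2 = K2 * t ^- 5 * (3 * t) * (K3 * t ^+ 2)); last by field; rewrite gt_eqF.
  by apply: ler_pM => //; apply: ler_pM.
have e2 : `|kap s (rho p q) * dSm p q i j / (jb p * jb q)| <= K1 * K4 * t ^- 2.
  apply: m1 => //; rewrite normrM.
  rewrite (_ : K1 * K4 * t ^- 2 = K1 * t ^- 3 * (K4 * t)); last by field; rewrite gt_eqF.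
  exact: ler_pM.
have e3 : `|kap s (rho p q) * Sm p q i j * p 0 i / (jb p ^+ 3 * jb q)| <= 2 * (K1 * K3 * A) * t ^- 2.
  apply: (@le_trans _ _ (K1 * K3 * t^-1)).
    rewrite -mulrA normrM -[leRHS]mulr1; apply: ler_pM => //.
    rewrite normrM normfV ler_pdivrMr ?normr_gt0 ?mulf_neq0 ?expf_neq0 ?jb_neq0//.
    rewrite mul1r [leRHS]ger0_norm; last by rewrite mulr_ge0 ?exprn_ge0 ?jb_ge0.
    apply: le_trans (le_coord_jb _ _) _.
    rewrite -[leLHS]mulr1; apply: ler_pM; rewrite ?jb_ge0 ?jb_ge1//.
    by rewrite ler_eXnr// jb_ge1.
  rewrite (_ : 2 * (K1 * K3 * A) * t ^- 2 = 2 * A * (K1 * K3 * t ^- 2)); last by ring.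
  rewrite (_ : K1 * K3 * t^-1 = t * (K1 * K3 * t ^- 2)); last by rewrite tt; ring.
  by apply: ler_wpM2r => //; rewrite mulr_ge0// ltW.
rewrite /dKer.
have tri (x y z : R) : `|x + y - z| <= `|x| + `|y| + `|z|.
  have := ler_normB (x + y) z; have := ler_normD x y; lra.
apply: le_trans (tri _ _ _) _; move: e1 e2 e3.
have : 0 <= K1 * K3 * t ^- 2 by rewrite mulr_ge0// ltW.
rewrite /t in i2 *; move: (_ ^- 2) i2 => y y0; move: `|dkap _ _ * _ * _ / _| `|_ * dSm _ _ _ _ / _| `|_ / (_ ^+ 3 * _)|
  => a b c; lra.
Qed.

End RemainderKernel.

(** * Regular part and remainder of the flux *)

Lemma norm_sum3_le (R : realType) (F : 'I_3 -> R) (C : R) :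
  (forall k, `|F k| <= C) -> `|\sum_(k < 3) F k| <= 3 * C.
Proof.
move=> h; apply: le_trans (ler_norm_sum _ _ _) _; rewrite sum3.
have := h i0; have := h i1; have := h i2; lra.
Qed.

Section RemainderDerivative.
Variable R : realType.
Notation V := 'rV[R]_3.
Implicit Types (p q : V) (i j k : 'I_3) (s : R).
Local Notation jb := jbracket.
Local Notation D k F := ('D_(basis3 k) F).

Variable f : V -> R.
Hypothesis cf : continuous f.
Hypothesis dF : forall p i, derivable f p (basis3 i).
Hypothesis cdF : forall i, continuous (D i f).
Hypothesis ddF : forall p i j, derivable (D j f) p (basis3 i).
Hypothesis cddF : forall i j, continuous (D i (D j f)).
Hypothesis hQ : forall p i, integ3 (RL_integrand f f i p).

(** The factor of the collision integrand that vanishes on the diagonal. *)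
Definition commutator j p q : R := f q * D j f p - f p * D j f q.
(** The part of the flux integrand that carries the singularity, supported near
the diagonal by [Nrem_far]. *)
Definition Nrem s i p q : R := \sum_(j < 3) Ker (kap s) p q i j * commutator j p q.
Definition Mreg s i p q : R := \sum_(j < 3) Ker (Lreg s) p q i j * commutator j p q.

Lemma RL_integrand_split s i p q :
  RL_integrand f f i p q = Mreg s i p q + Nrem s i p q.
Proof.
rewrite /RL_integrand /Mreg /Nrem -big_split /=; apply: eq_bigr => j _.
by rewrite PhiRLE /Ker /kap /commutator; ring.
Qed.

Lemma continuous_Lreg s : 0 < s -> continuous (Lreg s).
Proof.
move=> s0 x; apply/differentiable_continuous/derivable1_diffP.
by case: (Lreg_derive s0 x).
Qed.

Lemma continuous_Mreg s i p : 0 < s -> continuous (Mreg s i p).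
Proof.
move=> s0; rewrite (_ : Mreg s i p = (fun q => Ker (Lreg s) p q i i0 * commutator i0 p q
   + Ker (Lreg s) p q i i1 * commutator i1 p q + Ker (Lreg s) p q i i2 * commutator i2 p q)); last first.
  by apply/funext => q; rewrite /Mreg sum3.
have cL := continuous_Lreg s0.
have cK j : continuous (fun q => Ker (Lreg s) p q i j) by exact: ct_Ker.
have cD j : continuous (D j f) by exact: cdF.
have cG j : continuous (commutator j p).
  by apply: ctD; [apply: ctM; [exact: cf|exact: ctC]|apply: ctN; apply: ctM; [exact: ctC|exact: cD]].
by apply: ctD; [apply: ctD|]; apply: ctM.
Qed.

Lemma meas_Nrem s i p : 0 < s -> meas3 (Nrem s i p).
Proof.
move=> s0; rewrite (_ : Nrem s i p = (fun q => RL_integrand f f i p q - Mreg s i p q)).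
  apply: measurable_funB; first exact: integ3_meas (hQ p i).
  exact: (meas3_continuous (@continuous_Mreg s i p s0)).
by apply/funext => q; rewrite (RL_integrand_split s) addrAC subrr add0r.
Qed.

Lemma Nrem_far s i p q : 0 < s -> s <= 2^-1 -> 3 * s * jb p <= `|q - p| -> Nrem s i p q = 0.
Proof.
move=> s0 s2 h; rewrite /Nrem big1// => j _.
rewrite /Ker kap_far ?mul0r//; rewrite ltNge; apply/negP => hu.
have : shell p s q by rewrite /shell /=; have := exprn_gt0 2 s0; lra.
by move=> /(shell_near s0 s2); rewrite ltNge h.
Qed.

Section AtPoint.
Variable p0 : V.
Let A := jb p0 + 8.

Lemma near_jb q : `|q - p0| <= 4 -> jb q <= A.
Proof. by move=> h; have := jb_lip q p0; rewrite distrC /A; lra. Qed.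

(** The commutator is O(|q - p|) and compensates one power of the singularity both
in the integrand and in its derivative. *)
Lemma Nrem_bounds i : exists2 C, 0 <= C & forall s, 0 < s ->
  (forall p q, `|p - p0| <= 2 -> `|q - p0| <= 4 -> `|Nrem s i p q| <= C) /\
  (forall p q, `|p - p0| <= 2 -> `|q - p0| <= 4 -> q != p ->
     exists2 d, is_derive p (basis3 i) (fun p => Nrem s i p q) d & `|d| <= C / `|q - p|).
Proof.
have A1 : 1 <= A by have := jb_ge1 p0; rewrite /A; lra.
have [C C0 hC] := kap_kernel_bound A1.
pose M (F : V -> R) (M : R) := forall q, `|q - p0| <= 4 -> `|F q| <= M.
have bnd F : continuous F -> exists2 M0, 0 <= M0 & M F M0.
  move=> cF; have [M0 M00 h] := bounded_on_cube (4 + `|p0|) cF; exists M0 => // q hq.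
  by apply: h; rewrite -(subrK p0 q); apply: le_trans (ler_normD _ _) _; rewrite lerD2r.
have [Bf Bf0 hBf] := bnd _ cf.
have [B10 B100 hB10] := bnd _ (@cdF i0); have [B11 B110 hB11] := bnd _ (@cdF i1).
have [B12 B120 hB12] := bnd _ (@cdF i2).
have [B20 B200 hB20] := bnd _ (@cddF i i0); have [B21 B210 hB21] := bnd _ (@cddF i i1).
have [B22 B220 hB22] := bnd _ (@cddF i i2).
have [Lf Lf0 hLf] := local_lipschitz p0 4 dF cdF.
have [L0 L00 hL0] := local_lipschitz p0 4 (fun p k => @ddF p k i0) (fun k => @cddF k i0).
have [L1 L10 hL1] := local_lipschitz p0 4 (fun p k => @ddF p k i1) (fun k => @cddF k i1).
have [L2 L20 hL2] := local_lipschitz p0 4 (fun p k => @ddF p k i2) (fun k => @cddF k i2).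
pose B := Bf + B10 + B11 + B12 + B20 + B21 + B22.
pose L := Lf + L0 + L1 + L2.
have B0 : 0 <= B by rewrite /B; clear -Bf0 B100 B110 B120 B200 B210 B220; lra.
have L_0 : 0 <= L by rewrite /L; clear -Lf0 L00 L10 L20; lra.
have bf q : `|q - p0| <= 4 -> `|f q| <= B.
  by move=> h; apply: le_trans (hBf _ h) _; rewrite /B; clear -Bf0 B100 B110 B120 B200 B210 B220; lra.
have bd j q : `|q - p0| <= 4 -> `|D j f q| <= B.
  move=> h; elim/ord3P: j;
    [apply: le_trans (hB10 _ h) _|apply: le_trans (hB11 _ h) _|apply: le_trans (hB12 _ h) _];
    rewrite /B; clear -Bf0 B100 B110 B120 B200 B210 B220; lra.
have bdd j q : `|q - p0| <= 4 -> `|D i (D j f) q| <= B.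
  move=> h; elim/ord3P: j;
    [apply: le_trans (hB20 _ h) _|apply: le_trans (hB21 _ h) _|apply: le_trans (hB22 _ h) _];
    rewrite /B; clear -Bf0 B100 B110 B120 B200 B210 B220; lra.
have lf p q : `|p - p0| <= 4 -> `|q - p0| <= 4 -> `|f p - f q| <= L * `|q - p|.
  move=> hp hq; have := hLf _ _ hq hp; rewrite (distrC p) => h; apply: le_trans h _.
  by rewrite ler_wpM2r// /L; clear -Lf0 L00 L10 L20; lra.
have ld j p q : `|p - p0| <= 4 -> `|q - p0| <= 4 -> `|D j f p - D j f q| <= L * `|q - p|.
  move=> hp hq; rewrite (distrC q).
  have mm (x y : R) : x <= y * `|p - q| -> y <= L -> x <= L * `|p - q|.
    by move=> h1 h2; apply: le_trans h1 _; rewrite ler_wpM2r.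
  elim/ord3P: j; [have := hL0 _ _ hq hp|have := hL1 _ _ hq hp|have := hL2 _ _ hq hp];
    move=> /mm; apply; rewrite /L; clear -Lf0 L00 L10 L20; lra.
clearbody B L; clear Bf Bf0 hBf B10 B100 hB10 B11 B110 hB11 B12 B120 hB12.
clear B20 B200 hB20 B21 B210 hB21 B22 B220 hB22 Lf Lf0 hLf L0 L00 hL0 L1 L10 hL1 L2 L20 hL2.
have bG j p q : `|p - p0| <= 4 -> `|q - p0| <= 4 -> `|commutator j p q| <= 2 * B * L * `|q - p|.
  move=> hp hq; have -> : commutator j p q = f q * (D j f p - D j f q) - D j f q * (f p - f q).
    by rewrite /commutator; ring.
  apply: le_trans (ler_normB _ _) _; rewrite !normrM.
  have := ler_pM (normr_ge0 _) (normr_ge0 _) (bf q hq) (ld j p q hp hq).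
  have := ler_pM (normr_ge0 _) (normr_ge0 _) (bd j q hq) (lf p q hp hq).
  lra.
exists (3 * (2 * B * L * C + 2 * B ^+ 2 * C)); first by rewrite !mulr_ge0// addr_ge0 ?mulr_ge0 ?exprn_ge0.
move=> s s0; split=> p q hp hq.
  have hp4 : `|p - p0| <= 4 by lra.
  have [->|qp] := eqVneq q p.
    rewrite /Nrem big1 ?normr0; last by move=> j _; rewrite /commutator; ring.
    by rewrite !mulr_ge0// addr_ge0 ?mulr_ge0 ?exprn_ge0.
  have t0 : 0 < `|q - p| by rewrite normr_gt0 subr_eq0.
  have bj j : `|Ker (kap s) p q i j * commutator j p q| <= 2 * B * L * C.
    rewrite normrM (_ : 2 * B * L * C = C / `|q - p| * (2 * B * L * `|q - p|)); last first.
      by field; rewrite gt_eqF.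
    apply: ler_pM => //; last exact: bG.
    by case: (hC s p q i j s0 (near_jb hp4) (near_jb hq) t0).
  have BC : 0 <= 2 * B ^+ 2 * C by rewrite !mulr_ge0 ?exprn_ge0.
  by apply: le_trans (norm_sum3_le bj) _; rewrite ler_pM2l// lerDl.
move=> qp; have hp4 : `|p - p0| <= 4 by lra.
have t0 : 0 < `|q - p| by rewrite normr_gt0 subr_eq0.
have r1 : 1 < rho p q.
  have [w0 _] := diag_sqrt A1 (near_jb hp4) (near_jb hq) t0.
  have := rho_ge1 p q; rewrite le_eqVlt => /predU1P[E|//].
  by exfalso; move: w0; rewrite -E expr1n subrr sqrtr0 ltxx.
have dG j : is_derive p (basis3 i) (fun p => commutator j p q) (f q * D i (D j f) p - D i f p * D j f q).
  have h1 : is_derive p (basis3 i) (D j f) (D i (D j f) p) by exact: derivableP.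
  have h2 : is_derive p (basis3 i) f (D i f p) by exact: derivableP.
  eapply is_derive_eq.
    exact: (dvD (dvM (dvC _ _ (f q)) h1) (dvN (dvM h2 (dvC _ _ (D j f q))))).
  by rewrite /=; ring.
pose dj j := Ker (kap s) p q i j * (f q * D i (D j f) p - D i f p * D j f q)
    + commutator j p q * dKer (kap s) (dkap s) p q i j.
exists (\sum_(j < 3) dj j).
  rewrite /Nrem (_ : (fun p => _) = \sum_(j < 3) (fun p => Ker (kap s) p q i j * commutator j p q)); last first.
    by apply/funext => x; rewrite fct_sumE.
  apply: is_derive_sum => j.
  exact: (dvM (Ker_derive i j (kap_derive s0 r1)) (dG j)).
have bj j : `|dj j| <= (2 * B * L * C + 2 * B ^+ 2 * C) / `|q - p|.
  have [k1 k2] := hC s p q i j s0 (near_jb hp4) (near_jb hq) t0.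
  apply: le_trans (ler_normD _ _) _; rewrite [leRHS]mulrDl [leRHS]addrC; apply: lerD.
    rewrite (normrM (Ker (kap s) p q i j)).
    rewrite (_ : 2 * B ^+ 2 * C / _ = C / `|q - p| * (2 * B ^+ 2)); last by ring.
    apply: ler_pM; [exact: normr_ge0|exact: normr_ge0|exact: k1|].
    apply: le_trans (ler_normB _ _) _; rewrite !normrM expr2.
    have := ler_pM (normr_ge0 _) (normr_ge0 _) (bf q hq) (bdd j p hp4).
    have := ler_pM (normr_ge0 _) (normr_ge0 _) (bd i p hp4) (bd j q hq).
    lra.
  rewrite (normrM (commutator j p q)) (_ : 2 * B * L * C / _ = 2 * B * L * `|q - p| * (C / `|q - p| ^+ 2)); last first.
    by field; rewrite gt_eqF.
  by apply: ler_pM => //; exact: bG.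
by apply: le_trans (norm_sum3_le bj) _; rewrite mulrA.
Qed.
End AtPoint.
End RemainderDerivative.

Section RemainderOfFlux.
Variable R : realType.
Notation V := 'rV[R]_3.
Implicit Types (p q : V) (i j k : 'I_3) (s : R).
Local Notation jb := jbracket.
Local Notation D k F := ('D_(basis3 k) F).

Lemma norm_basis (h : R) i : `|h *: (basis3 i : V)| <= `|h|.
Proof.
apply/vnorm_leP => // k; rewrite !mxE /= normrM -[leRHS]mulr1 ler_wpM2l//.
by case: (_ == _); rewrite ?normr1 ?normr0.
Qed.

Lemma mvt_bound (g : R -> R) (h M : R) :
  (forall x, `|x| <= `|h| -> exists2 d, is_derive x (1:R) g d & `|d| <= M) ->
  `|g h - g 0| <= M * `|h|.
Proof.
move=> hd.
have dg x : `|x| <= `|h| -> is_derive x (1:R) g ((derive1 g) x) /\ `|(derive1 g) x| <= M.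
  move=> /hd[d [hd0 hd1] hd2]; rewrite derive1E hd1; split; [exact: DeriveDef|exact: hd2].
have cg x : `|x| <= `|h| -> {for x, continuous g}.
  by move=> /dg[[hx _] _]; apply/differentiable_continuous/derivable1_diffP.
have [h0|h0] := leP 0 h.
  have [||c] := @MVT_segment _ g (derive1 g) 0 h h0.
  - move=> x; rewrite in_itv /= => /andP[x0 xh]; apply: (dg x _).1.
    by rewrite !ger0_norm// ltW.
  - apply: continuous_in_subspaceT => x; rewrite inE /= in_itv /= => /andP[x0 xh].
    by apply: cg; rewrite !ger0_norm.
  rewrite in_itv /= => /andP[c0 ch] ->; rewrite subr0 normrM ler_wpM2r//.
  by apply: (dg c _).2; rewrite !ger0_norm.
have h0' := ltW h0.
have [||c] := @MVT_segment _ g (derive1 g) h 0 h0'.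
- move=> x; rewrite in_itv /= => /andP[x0 xh]; apply: (dg x _).1.
  by rewrite !ler0_norm ?lerN2 ltW.
- apply: continuous_in_subspaceT => x; rewrite inE /= in_itv /= => /andP[x0 xh].
  by apply: cg; rewrite !ler0_norm ?lerN2.
rewrite in_itv /= => /andP[c0 ch] E; rewrite distrC E sub0r normrM normrN ler_wpM2r//.
by apply: (dg c _).2; rewrite !ler0_norm ?lerN2.
Qed.

Variable f : V -> R.
Hypothesis cf : continuous f.
Hypothesis dF : forall p i, derivable f p (basis3 i).
Hypothesis cdF : forall i, continuous (D i f).
Hypothesis ddF : forall p i j, derivable (D j f) p (basis3 i).
Hypothesis cddF : forall i j, continuous (D i (D j f)).
Hypothesis hQ : forall p i, integ3 (RL_integrand f f i p).

(** The difference quotient of step h is split at |q - p0| = 3|h|. Inside, the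
integrand is bounded and the volume is O(|h|^3). Outside, the mean value theorem
and the slope O(1 / |q - p0|) leave |h| times a Newton potential over a cube of
radius O(s), that is |h| O(s^2). No differentiability of the remainder is
assumed or proved: its derivative is bounded if it exists. *)
Lemma remainder_derive p0 i : exists K s1, [/\ 0 <= K, 0 < s1, s1 <= 2^-1 &
  forall s, 0 < s -> s <= s1 ->
    (forall p, `|p - p0| <= 1 -> integ3 (Nrem f s i p)) /\
    forall d, is_derive p0 (basis3 i) (fun p => int3 (Nrem f s i p)) d -> `|d| <= K * s ^+ 2].
Proof.
have [C C0 hC] := Nrem_bounds cf dF cdF ddF cddF p0 i.
pose A := jb p0 + 8.
have A9 : 9 <= A by have := jb_ge1 p0; rewrite /A; lra.
have A0 : 0 < A by lra.
pose c1 := 2 * C * 6 ^+ 3 + 3 / 2 * C * (32 * 2 ^+ 2).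
have c10 : 0 <= c1 by rewrite /c1 addr_ge0 ?mulr_ge0 ?divr_ge0.
(* A bounds <q> for |q - p0| <= 4, so that the support of the remainder has
   radius at most r = 3 s A, and r <= 1. *)
exists (c1 * (3 * A) ^+ 2), (3 * A)^-1; split.
- by rewrite mulr_ge0// sqr_ge0.
- by rewrite invr_gt0 mulr_gt0.
- by rewrite lef_pV2 ?posrE ?mulr_gt0//; lra.
move=> s s0 ss1; have [hC1 hC2] := hC s s0.
pose r := 3 * s * A.
have r0 : 0 < r by rewrite !mulr_gt0.
have r1 : r <= 1.
  by rewrite /r mulrAC -ler_pdivlMl ?mulr_gt0// mulr1.
have s2 : s <= 2^-1.
  by apply: le_trans ss1 _; rewrite lef_pV2 ?posrE ?mulr_gt0//; lra.
have far p q : `|p - p0| <= 4 -> r <= `|q - p| -> Nrem f s i p q = 0.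
  move=> hp h; apply: (Nrem_far f i s0 s2); apply: le_trans h; rewrite /r.
  by rewrite ler_pM2l ?mulr_gt0//; exact: near_jb.
have intN p : `|p - p0| <= 1 -> integ3 (Nrem f s i p).
  move=> hp; have [ii _] := @int3_cube _ p 1 ltr01.
  apply: (integ3_le (meas_Nrem cf cdF hQ i p s0) (integ3Z C ii)) => q.
  have [h|h] := ltP `|q - p| 1; last first.
    rewrite far ?normr0 ?mulr_ge0// ?indicE//; [lra|exact: le_trans r1 h].
  rewrite indicE mem_set// mulr1; apply: hC1; first lra.
  rewrite -(subrK p q) -addrA; apply: le_trans (ler_normD _ _) _; lra.
split=> // d [hd <-].
have bnd h : `|h| <= r -> `|int3 (Nrem f s i (h *: basis3 i + p0)) - int3 (Nrem f s i p0)|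
    <= `|h| * (c1 * r ^+ 2).
  move=> hr; have [->|h0] := eqVneq h 0.
    by rewrite scale0r add0r subrr normr0 mul0r.
  have hp0 : 0 < `|h| by rewrite normr_gt0.
  have hpx x : `|x| <= `|h| -> `|x *: basis3 i + p0 - p0| <= `|h|.
    by move=> hx; rewrite addrK; exact: le_trans (norm_basis x i) hx.
  have hp := hpx h (lexx _).
  have i1' : integ3 (Nrem f s i (h *: basis3 i + p0)) by apply: intN; lra.
  have i2' : integ3 (Nrem f s i p0) by apply: intN; rewrite subrr normr0.
  have h3 : 0 < 3 * `|h| by rewrite mulr_gt0.
  have r2 : 0 < 2 * r by rewrite mulr_gt0.
  have [ic vc] := int3_cube p0 h3; have [inw vn] := newton_int p0 r2.
  rewrite -int3B//; apply: le_trans (norm_int3 (integ3B i1' i2')) _.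
  pose G q := 2 * C * \1_[set q | `|q - p0| < 3 * `|h|] q + 3 / 2 * C * `|h| * newton p0 (2 * r) q.
  have iG : integ3 G by apply: integ3D; apply: integ3Z.
  apply: (@le_trans _ _ (int3 G)).
    apply: le_int3 => //; first by apply: integ3_norm; exact: integ3B.
    move=> q; rewrite /G indicE newtonE.
    (* Inside the cube of radius 3|h| the bound on the integrand, outside it the
       bound on its derivative; there the segment from p0 to p0 + h e_i stays at
       distance at least 2/3 |q - p0| from q. *)
    have [hq|hq] := ltP `|q - p0| (3 * `|h|).
      have hq4 : `|q - p0| <= 4 by lra.
      rewrite mem_set// mulr1; apply: le_trans (ler_normB _ _) _.
      have hp2 : `|h *: basis3 i + p0 - p0| <= 2.
        by apply: le_trans hp _; apply: le_trans hr _; apply: le_trans r1 _; rewrite ler1n.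
      have hp3 : `|p0 - p0| <= 2 by rewrite subrr normr0.
      have := hC1 _ q hp2 hq4; have := hC1 _ q hp3 hq4.
      have : 0 <= 3 / 2 * C * `|h| * (if `|q - p0| < 2 * r then `|q - p0|^-1 else 0).
        by apply: mulr_ge0; [rewrite !mulr_ge0// divr_ge0|case: ifP].
      lra.
    rewrite memNset /= ?mulr0 ?add0r; last by apply/negP; rewrite -leNgt.
    have [hq2|hq2] := ltP `|q - p0| (2 * r); last first.
      have tri : `|q - p0| <= `|q - (h *: basis3 i + p0)| + `|h *: basis3 i + p0 - p0|.
        by rewrite -[X in `|X| <= _](subrKA (h *: basis3 i + p0)); exact: ler_normD.
      have e1 : Nrem f s i (h *: basis3 i + p0) q = 0 by apply: far; lra.
      have e2 : Nrem f s i p0 q = 0 by apply: far; rewrite ?subrr ?normr0; lra.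
      by rewrite mulr0 e1 e2 subrr normr0.
    have q0 : 0 < `|q - p0| by apply: lt_le_trans hq.
    have := @mvt_bound (fun x => Nrem f s i (x *: basis3 i + p0) q) h (3 / 2 * C / `|q - p0|).
    rewrite scale0r add0r => /(_ _)/le_trans; apply; last first.
      by rewrite mulrAC lexx.
    move=> x hx.
    have hqx : 2 / 3 * `|q - p0| <= `|q - (x *: basis3 i + p0)|.
      have : `|q - p0| <= `|q - (x *: basis3 i + p0)| + `|x *: basis3 i + p0 - p0|.
        by rewrite -[X in `|X| <= _](subrKA (x *: basis3 i + p0)); exact: ler_normD.
      have := hpx _ hx; lra.
    have qx0 : 0 < `|q - (x *: basis3 i + p0)|.
      by apply: lt_le_trans hqx; rewrite mulr_gt0// divr_gt0.
    have hx2 : `|x *: basis3 i + p0 - p0| <= 2 by have := hpx _ hx; lra.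
    have hq4 : `|q - p0| <= 4 by lra.
    have hne : q != x *: basis3 i + p0 by rewrite -subr_eq0 -normr_gt0.
    have [e he1 he2] := hC2 _ q hx2 hq4 hne.
    exists e; first exact: (is_derive_line (fun p => Nrem f s i p q) (basis3 i) p0 x e).1.
    apply: le_trans he2 _; rewrite (_ : 3 / 2 * C / `|q - p0| = C / (2 / 3 * `|q - p0|)).
      by rewrite ler_wpM2l// lef_pV2// posrE mulr_gt0// divr_gt0.
    by field; rewrite gt_eqF.
  rewrite /G int3D ?int3Z//; try exact: integ3Z.
  rewrite vc.
  have hh : `|h| ^+ 2 <= r ^+ 2 by rewrite ler_pXn2r// nnegrE// ltW.
  apply: (@le_trans _ _ (2 * C * (2 * (3 * `|h|)) ^+ 3 + 3 / 2 * C * `|h| * (32 * (2 * r) ^+ 2))).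
    by rewrite lerD2l ler_wpM2l// !mulr_ge0// divr_ge0.
  rewrite (_ : _ + _ = `|h| * (2 * C * 6 ^+ 3 * `|h| ^+ 2 + 3 / 2 * C * (32 * 2 ^+ 2) * r ^+ 2)); last by ring.
  have C2 : 0 <= 2 * C * 6 ^+ 3 by rewrite !mulr_ge0.
  rewrite ler_pM2l// /c1; have := ler_wpM2l C2 hh.
  by move: (2 * C * 6 ^+ 3) (3 / 2 * C * (32 * 2 ^+ 2)) => a b; lra.
rewrite leNgt; apply/negP => hlt.
have E : c1 * (3 * A) ^+ 2 * s ^+ 2 = c1 * r ^+ 2 by rewrite /r; ring.
rewrite E in hlt.
have cv : `|h^-1 *: (((fun p => int3 (Nrem f s i p)) \o shift p0) (h *: basis3 i) -
   int3 (Nrem f s i p0))| @[h --> (0:R)^'] --> `|'D_(basis3 i) (fun p => int3 (Nrem f s i p)) p0|.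
  by apply: cvg_norm; exact: hd.
have n1 : \forall h \near (0:R)^', c1 * r ^+ 2 < `|h^-1 *: (((fun p => int3 (Nrem f s i p)) \o shift p0) (h *: basis3 i) -
   int3 (Nrem f s i p0))|.
  by move: cv => /cvgr_gt; apply.
have n2 : \forall h \near (0:R)^', `|h| < r by exact: dnbhs0_lt.
have n3 : \forall h \near (0:R)^', h != 0 by exact: nbhs_dnbhs_neq.
have [h [[h1 h2] h3]] := filter_ex (filterI (filterI n1 n2) n3).
have := bnd h (ltW h2); rewrite leNgt => /negP; apply.
move: h1; rewrite /= normrZ normfV ltr_pdivlMl ?normr_gt0//.
Qed.
End RemainderOfFlux.

(** * Growth of the regularised kernel *)

Section KernelGrowth.
Variable R : realType.
Notation V := 'rV[R]_3.
Implicit Types (p q : V) (i j k : 'I_3).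
Local Notation jb := jbracket.

Lemma normM_le (x y a b : R) : `|x| <= a -> `|y| <= b -> `|x * y| <= a * b.
Proof. by move=> ha hb; rewrite normrM; apply: ler_pM. Qed.

Lemma normD_le (x y a b : R) : `|x| <= a -> `|y| <= b -> `|x + y| <= a + b.
Proof. by move=> ha hb; apply: le_trans (ler_normD _ _) _; exact: lerD. Qed.

Lemma normB_le (x y a b : R) : `|x| <= a -> `|y| <= b -> `|x - y| <= a + b.
Proof. by move=> ha hb; apply: le_trans (ler_normB _ _) _; exact: lerD. Qed.

Lemma norm_delta i j : `|(i == j)%:R : R| <= 1.
Proof. by case: (i == j); rewrite ?normr1 ?normr0. Qed.

Lemma Sm_growth p q i j : `|Sm p q i j| <= 12 * (jb p ^+ 2 * jb q ^+ 2).
Proof.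
have P1 := jb_ge1 p; have Q1 := jb_ge1 q; have r1 := rho_ge1 p q; have r2 := rho_le p q.
have a : `|rho p q ^+ 2 - 1| <= (2 * jb p * jb q) ^+ 2.
  rewrite ger0_norm ?subr_ge0 ?exprn_ege1//.
  have : rho p q ^+ 2 <= (2 * jb p * jb q) ^+ 2 by rewrite ler_pXn2r// nnegrE; lra.
  lra.
have b k : `|p 0 k - q 0 k| <= jb p + jb q by apply: normB_le; exact: le_coord_jb.
have c : `|rho p q - 1| <= 2 * jb p * jb q by rewrite ger0_norm; lra.
have d k l : `|p 0 k * q 0 l| <= jb p * jb q by apply: normM_le; exact: le_coord_jb.
apply: le_trans (normD_le (normB_le (normM_le a (norm_delta i j)) (normM_le (b i) (b j)))
  (normM_le c (normD_le (d i j) (d j i)))) _.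
have : jb p + jb q <= 2 * (jb p * jb q) by nra.
move=> h; have h2 : (jb p + jb q) * (jb p + jb q) <= 2 * (jb p * jb q) * (2 * (jb p * jb q)).
  by apply: ler_pM => //; lra.
lra.
Qed.

Lemma srho_growth p q i : `|srho p q i| <= 2 * jb q.
Proof.
have P0 := jb_gt0 p; have Q0 := jb_gt0 q; rewrite /srho.
have a : `|jb q * p 0 i / jb p| <= jb q.
  rewrite !normrM (gtr0_norm Q0) normfV (gtr0_norm P0) -mulrA ger_pMr// ler_pdivrMr// mul1r.
  exact: le_coord_jb.
by apply: le_trans (normB_le a (le_coord_jb q i)) _; lra.
Qed.

Lemma drift_growth p q i : `|rho p q * p 0 i - q 0 i| <= 3 * (jb p ^+ 2 * jb q).
Proof.
have P1 := jb_ge1 p; have Q1 := jb_ge1 q; have r1 := rho_ge1 p q; have r2 := rho_le p q.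
have a : `|rho p q| <= 2 * jb p * jb q by rewrite ger0_norm; lra.
apply: le_trans (normB_le (normM_le a (le_coord_jb p i)) (le_coord_jb q i)) _.
nra.
Qed.

Lemma dSm_growth p q i j : `|dSm p q i j| <= 20 * (jb p * jb q ^+ 2).
Proof.
have P1 := jb_ge1 p; have Q1 := jb_ge1 q; have r1 := rho_ge1 p q; have r2 := rho_le p q.
have a : `|2 * rho p q| <= 2 * (2 * jb p * jb q) by rewrite ger0_norm; lra.
have b k : `|p 0 k - q 0 k| <= jb p + jb q by apply: normB_le; exact: le_coord_jb.
have c : `|rho p q - 1| <= 2 * jb p * jb q by rewrite ger0_norm; lra.
have d k l : `|p 0 k * q 0 l| <= jb p * jb q by apply: normM_le; exact: le_coord_jb.
have e := srho_growth p q i.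
apply: le_trans (normD_le (normB_le (normM_le (normM_le a e) (norm_delta i j))
   (normD_le (b j) (normM_le (b i) (norm_delta i j))))
  (normD_le (normM_le e (normD_le (d i j) (d j i)))
    (normM_le c (normD_le (le_coord_jb q j) (normM_le (le_coord_jb q i) (norm_delta i j)))))) _.
have h : jb p + jb q <= 2 * (jb p * jb q) by nra.
have h2 : jb p * jb q <= jb p * jb q * jb q by rewrite ler_peMr// mulr_ge0//; lra.
lra.
Qed.

Variables (L dL : R -> R) (C : R).
Hypothesis hL : forall r, 1 <= r -> `|L r| <= C /\ r * `|dL r| <= C.

Let C0 : 0 <= C.
Proof. by have [h _] := hL (lexx 1); exact: le_trans h. Qed.

Let bL p q : `|L (rho p q)| <= C.
Proof. by have [] := hL (rho_ge1 p q). Qed.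

Let bdL p q : `|dL (rho p q)| <= 2 * C * jb p / jb q.
Proof.
have r1 := rho_ge1 p q; have [_ h] := hL r1; have hq := jb_le_rho p q.
have r0 : 0 < rho p q by lra.
have Q0 := jb_gt0 q; have P0 := jb_gt0 p.
rewrite ler_pdivlMr//; apply: (@le_trans _ _ (`|dL (rho p q)| * (2 * jb p * rho p q))).
  by rewrite ler_wpM2l.
have := @ler_wpM2l _ (2 * jb p) _ _ _ h; rewrite mulr_ge0 ?(ltW P0)// => /(_ isT).
lra.
Qed.

Let iPQ p q : `|(jb p * jb q)^-1| <= (jb p * jb q)^-1.
Proof. by rewrite ger0_norm// invr_ge0 mulr_ge0// jb_ge0. Qed.

Lemma Ker_growth p q i j : `|Ker L p q i j| <= 12 * C * jb p * jb q.
Proof.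
have P0 := jb_neq0 p; have Q0 := jb_neq0 q.
apply: le_trans (normM_le (normM_le (bL p q) (Sm_growth p q i j)) (iPQ p q)) _.
by rewrite le_eqVlt; apply/orP; left; apply/eqP; field; rewrite ?P0 ?Q0.
Qed.

Lemma divK_growth p q i : `|divK L p q i| <= 6 * C * jb p * jb q.
Proof.
have P0 := jb_neq0 p; have Q0 := jb_neq0 q.
have a : `|2 * L (rho p q)| <= 2 * C by rewrite normrM ger0_norm// ler_wpM2l.
apply: le_trans (normM_le (normM_le a (drift_growth p q i)) (iPQ p q)) _.
rewrite (_ : _ / _ = 6 * C * jb p); last by field; rewrite ?P0 ?Q0.
by rewrite ler_peMr ?jb_ge1// !mulr_ge0// jb_ge0.
Qed.

Lemma dKer_growth p q i j : `|dKer L dL p q i j| <= 80 * C * jb p ^+ 2 * jb q.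
Proof.
have P0 := jb_neq0 p; have Q0 := jb_neq0 q; have P1 := jb_ge1 p.
have i3 : `|(jb p ^+ 3 * jb q)^-1| <= (jb p ^+ 3 * jb q)^-1.
  by rewrite ger0_norm// invr_ge0 mulr_ge0 ?exprn_ge0// jb_ge0.
apply: le_trans (normB_le (normD_le
   (normM_le (normM_le (normM_le (bdL p q) (srho_growth p q i)) (Sm_growth p q i j)) (iPQ p q))
   (normM_le (normM_le (bL p q) (dSm_growth p q i j)) (iPQ p q)))
   (normM_le (normM_le (normM_le (bL p q) (Sm_growth p q i j)) (le_coord_jb p i)) i3)) _.
rewrite (_ : _ + _ = C * jb q * (48 * jb p ^+ 2 + 32)); last by field; rewrite ?P0 ?Q0.
have P2 : 1 <= jb p ^+ 2 by exact: exprn_ege1.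
have CQ : 0 <= C * jb q by rewrite mulr_ge0// jb_ge0.
rewrite (_ : 80 * _ * _ * _ = C * jb q * (80 * jb p ^+ 2)); last by ring.
by rewrite ler_wpM2l//; lra.
Qed.

Lemma ddivK_growth p q i : `|ddivK L dL p q i| <= 80 * C * jb p ^+ 2 * jb q.
Proof.
have P0 := jb_neq0 p; have Q0 := jb_neq0 q; have P1 := jb_ge1 p; have Q1 := jb_ge1 q.
have i3 : `|(jb p ^+ 3 * jb q)^-1| <= (jb p ^+ 3 * jb q)^-1.
  by rewrite ger0_norm// invr_ge0 mulr_ge0 ?exprn_ge0// jb_ge0.
have r1 := rho_ge1 p q; have r2 := rho_le p q.
have a : `|2 * L (rho p q)| <= 2 * C by rewrite normrM ger0_norm// ler_wpM2l.
have b : `|2 * dL (rho p q)| <= 2 * (2 * C * jb p / jb q) by rewrite normrM ger0_norm// ler_wpM2l.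
have c : `|rho p q| <= 2 * jb p * jb q by rewrite ger0_norm; lra.
apply: le_trans (normB_le (normD_le
   (normM_le (normM_le (normM_le b (srho_growth p q i)) (drift_growth p q i)) (iPQ p q))
   (normM_le (normM_le a (normD_le (normM_le (srho_growth p q i) (le_coord_jb p i)) c)) (iPQ p q)))
   (normM_le (normM_le (normM_le a (drift_growth p q i)) (le_coord_jb p i)) i3)) _.
rewrite (_ : _ + _ = C * (24 * jb p ^+ 2 + 14)); last by field; rewrite ?P0 ?Q0.
have P2 : 1 <= jb p ^+ 2 by exact: exprn_ege1.
rewrite (_ : 80 * _ * _ * _ = C * (80 * (jb p ^+ 2 * jb q))); last by ring.
have h : jb p ^+ 2 <= jb p ^+ 2 * jb q by rewrite ler_peMr// exprn_ge0// jb_ge0.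
by rewrite ler_wpM2l//; lra.
Qed.
End KernelGrowth.

(** * Integration by parts in the flux *)

Section FluxFormula.
Variable R : realType.
Notation V := 'rV[R]_3.
Implicit Types (p q : V) (i j k : 'I_3) (s : R).
Local Notation jb := jbracket.
Local Notation D k F := ('D_(basis3 k) F).

(** A C^1 cutoff that vanishes from n on; applied to rho it makes the kernel
compactly supported in q. *)
Definition cutoff (n : R) : R -> R := glue n (fun r => (1 - r / n) ^+ 2) (fun=> 0).
Definition dcutoff (n : R) : R -> R := glue n (fun r => - (2 / n) * (1 - r / n)) (fun=> 0).

Lemma cutoff_derive (n r : R) : 0 < n -> is_derive r (1:R) (cutoff n) (dcutoff n r).
Proof.
move=> n0; have n1 : n != 0 by rewrite gt_eqF.
apply: glue_derive.
- by rewrite divff// subrr expr0n.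
- by rewrite divff// subrr mulr0.
- move=> x _; eapply is_derive_eq; first by repeat (derive_step || exact: is_derive_id).
  by rewrite /GRing.scale /=; field.
Qed.

Lemma dcutoff_continuous (n : R) : 0 < n -> continuous (dcutoff n).
Proof.
move=> n0; have n1 : n != 0 by rewrite gt_eqF.
apply: glue_continuous; first by rewrite divff// subrr mulr0.
- move=> x _; apply: cvgM; first exact: cvg_cst.
  by apply: cvgB; [exact: cvg_cst|apply: cvgM; [exact: cvg_id|exact: cvg_cst]].
- by move=> x _; exact: cvg_cst.
Qed.

Lemma cutoff_bound (n r : R) : 0 < n -> 0 <= r -> 0 <= cutoff n r <= 1.
Proof.
move=> n0 r0; rewrite /cutoff /glue; case: ifPn => h; last by rewrite lexx ler01.
rewrite sqr_ge0 /= expr_le1// ?subr_ge0 ?ler_pdivrMr ?mul1r//.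
by rewrite gerBl divr_ge0// ltW.
Qed.

Lemma cutoff_cvg (r : R) : cutoff n.+1%:R r @[n --> \oo] --> (1 : R).
Proof.
apply: cvg_trans (_ : (1 - r / n.+1%:R) ^+ 2 @[n --> \oo] --> _).
  apply: near_eq_cvg; near=> n; rewrite /cutoff /glue ifT//.
  near: n; exists (Num.truncn `|r|) => // n /= hn.
  apply: le_trans (ler_norm r) _; apply: ltW; apply: lt_le_trans (truncnS_gt _) _.
  by rewrite ler_nat.
have h : 1 - r / n.+1%:R @[n --> \oo] --> 1 - r * 0.
  apply: cvgB; first exact: cvg_cst.
  by apply: cvgM; [exact: cvg_cst|exact: cvg_harmonic].
have := cvgM h h; rewrite mulr0 subr0 mulr1 => hh.
suff -> : (fun n : nat => (1 - r / n.+1%:R) ^+ 2) = (fun n => (1 - r / n.+1%:R) * (1 - r / n.+1%:R)) by exact: hh.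
by apply/funext => n; rewrite expr2.
Unshelve. all: by end_near. Qed.

Variable f : V -> R.
Hypothesis cf : continuous f.
Hypothesis dF : forall p i, derivable f p (basis3 i).
Hypothesis cdF : forall i, continuous (D i f).

(** The divergence theorem for Ker f, the divergence of Ker being [divK]. *)
Lemma ibp_compact (L dL : R -> R) (r0 : R) p i : 0 < r0 ->
  (forall r, is_derive r (1:R) L (dL r)) -> continuous dL ->
  (forall r, r0 <= r -> L r = 0) ->
  int3 (fun q => \sum_(j < 3) Ker L p q i j * D j f q) = - int3 (fun q => divK L p q i * f q).
Proof.
move=> r00 hL cdL L0.
have cL : continuous L.
  by move=> r; apply/differentiable_continuous/derivable1_diffP; case: (hL r).
pose A := 2 * jb p * r0.
have A0 : 0 < A by rewrite !mulr_gt0// jb_gt0.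
have far q : A <= `|q| -> L (rho p q) = 0.
  move=> hq; apply: L0; have hQ := jb_le_rho p q.
  have P2 : 0 < 2 * jb p by rewrite mulr_gt0// jb_gt0.
  by rewrite -(ler_pM2l P2); exact: le_trans hq (le_trans (vnorm_le_jb q) hQ).
pose F j q := Ker L p q i j * f q.
have FE j : F j = (fun q => Ker L q p j i * f q).
  by apply/funext => q; rewrite /F (Ker_swap L p).
have dFj j q : is_derive q (basis3 j) (F j)
    (Ker L p q i j * D j f q + f q * dKer L dL q p j i).
  rewrite FE Ker_swap; apply: dvM; last exact: derivableP.
  exact: Ker_derive.
have E j : D j (F j) = (fun q => Ker L p q i j * D j f q + f q * dKer L dL q p j i).
  by apply/funext => q; case: (dFj j q).
have Eq j q : D j (F j) q = Ker L p q i j * D j f q + f q * dKer L dL q p j i.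
  by case: (dFj j q).
have cK j : continuous (fun q => Ker L p q i j) by exact: ct_Ker.
have cD j : continuous (D j f) by exact: cdF.
have cdK j : continuous (fun q => dKer L dL q p j i) by exact: ct_dKer1.
have cB : continuous (fun q => divK L p q i) by exact: ct_divK.
have c1 j : continuous (fun q => Ker L p q i j * D j f q) by apply: ctM.
have c2 j : continuous (fun q => f q * dKer L dL q p j i) by apply: ctM.
have c3 : continuous (fun q => divK L p q i * f q) by apply: ctM.
have H j : integ3 (D j (F j)) /\ int3 (D j (F j)) = 0.
  apply: (int3_derive_compact A0).
  - by move=> q; case: (dFj j q).
  - by rewrite E; exact: ctD.
  - by move=> q /far h; rewrite /F /Ker h !mul0r.
have i1' j : integ3 (fun q => Ker L p q i j * D j f q).
  by apply: (integ3_compact A0 (@c1 j)) => q /far h; rewrite /Ker h !mul0r.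
have i2' : integ3 (fun q => divK L p q i * f q).
  by apply: (integ3_compact A0 c3) => q /far h; rewrite /divK h mulr0 !mul0r.
have [I0 z0] := H i0; have [I1 z1] := H i1; have [I2 z2] := H i2.
have X : int3 (fun q => (\sum_(j < 3) Ker L p q i j * D j f q) + divK L p q i * f q) = 0.
  have Z : int3 (fun q => D i0 (F i0) q + D i1 (F i1) q + D i2 (F i2) q) = 0.
    by rewrite !int3D ?z0 ?z1 ?z2 ?addr0//; exact: integ3D.
  apply: etrans Z.
  apply: eq_int3 => q; rewrite -(sum_dKer L dL q p i) !sum3 !Eq; ring.
have iS : integ3 (fun q => \sum_(j < 3) Ker L p q i j * D j f q).
  apply: (@eq_integ3 _ (fun q => Ker L p q i i0 * D i0 f q + Ker L p q i i1 * D i1 f q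
     + Ker L p q i i2 * D i2 f q)); first by move=> q; rewrite sum3.
  by do 2! apply: integ3D => //.
by move: X; rewrite int3D// => /eqP; rewrite addr_eq0 => /eqP.
Qed.

Hypothesis f0 : forall q, 0 <= f q.
Hypothesis iE : integ3 (fun q => jb q * f q).

(** The integrand of the regularised flux after integration by parts, without its
factor f(q). *)
Definition drift (L : R -> R) p i q : R :=
  \sum_(j < 3) D j f p * Ker L p q i j + f p * divK L p q i.

Lemma integ3_weight (w : V -> R) (C : R) : continuous w -> (forall q, `|w q| <= C * jb q) ->
  integ3 (fun q => w q * f q).
Proof.
move=> cw hw; have cwf : continuous (fun q => w q * f q) by exact: ctM.
apply: (integ3_le (meas3_continuous cwf) (integ3Z C iE)) => q.
by rewrite normrM (ger0_norm (f0 q)) mulrA ler_wpM2r.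
Qed.

(** A nonnegative function has a minimum where it vanishes. *)
Lemma min_grad p j : f p = 0 -> D j f p = 0.
Proof.
move=> fp; have E : p = 0 *: basis3 j + p by rewrite scale0r add0r.
have dg t : is_derive t (1:R) (fun s => f (s *: basis3 j + p)) (D j f (t *: basis3 j + p)).
  by apply: (is_derive_line f (basis3 j) p t _).1; exact: derivableP.
have [|||t|_ h] := @derive1_at_min _ (fun s => f (s *: basis3 j + p)) (- 1) 1 0.
- by lra.
- by move=> t _; case: (dg t).
- by rewrite in_itv /= oppr_lt0 ltr01.
- by move=> _; rewrite -E fp.
by have [_] := dg 0; rewrite -E h.
Qed.
End FluxFormula.

Section FluxSplitting.
Variable R : realType.
Notation V := 'rV[R]_3.
Implicit Types (p q : V) (i j k : 'I_3) (s : R).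
Local Notation jb := jbracket.
Local Notation D k F := ('D_(basis3 k) F).

Lemma continuous_dLreg s : 0 < s -> continuous (dLreg s).
Proof.
move=> s0 r.
have cu : {for r, continuous (fun r : R => r ^+ 2 - 1)}.
  by apply: cvgB; [exact: exprn_continuous|exact: cvg_cst].
have c1 : {for r, continuous (fun r : R => psi s (r ^+ 2 - 1))}.
  apply: (@continuous_comp _ _ _ (fun r : R => r ^+ 2 - 1) (psi s)); first exact: cu.
  by apply/differentiable_continuous/derivable1_diffP; case: (psi_derive s0 (r ^+ 2 - 1)).
have c2 : {for r, continuous (fun r : R => dpsi s (r ^+ 2 - 1))}.
  apply: (@continuous_comp _ _ _ (fun r : R => r ^+ 2 - 1) (dpsi s)); first exact: cu.
  exact: dpsi_continuous.
rewrite /dLreg; apply: cvgD; apply: cvgM; [|exact: c1| |exact: c2].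
  by apply: cvgM; [exact: cvg_cst|exact: cvg_id].
by apply: cvgM; [exact: cvg_cst|exact: exprn_continuous].
Qed.

Variable f : V -> R.
Hypothesis cf : continuous f.
Hypothesis dF : forall p i, derivable f p (basis3 i).
Hypothesis cdF : forall i, continuous (D i f).
Hypothesis f0 : forall q, 0 <= f q.
Hypothesis iE : integ3 (fun q => jb q * f q).

Section AtScale.
Variable s : R.
Hypothesis s0 : 0 < s.

Lemma integ3_Ker p i j : integ3 (fun q => Ker (Lreg s) p q i j * f q).
Proof.
have [C _ hC] := Lreg_growth s0; apply: (integ3_weight cf f0 iE (C := 12 * C * jb p)).
  by apply: ct_Ker; exact: continuous_Lreg.
by move=> q; exact: Ker_growth hC p q i j.
Qed.

Lemma integ3_divK p i : integ3 (fun q => divK (Lreg s) p q i * f q).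
Proof.
have [C _ hC] := Lreg_growth s0; apply: (integ3_weight cf f0 iE (C := 6 * C * jb p)).
  by apply: ct_divK; exact: continuous_Lreg.
by move=> q; exact: divK_growth hC p q i.
Qed.

Lemma integ3_drift p i : integ3 (fun q => drift f (Lreg s) p i q * f q).
Proof.
apply: (@eq_integ3 _ (fun q => D i0 f p * (Ker (Lreg s) p q i i0 * f q)
   + D i1 f p * (Ker (Lreg s) p q i i1 * f q) + D i2 f p * (Ker (Lreg s) p q i i2 * f q)
   + f p * (divK (Lreg s) p q i * f q))).
  by move=> q; rewrite /drift sum3; ring.
by repeat (apply: integ3D); apply: integ3Z; (exact: integ3_Ker || exact: integ3_divK).
Qed.

(** The cutoff in [ibp_compact] is removed by dominated convergence. Integrability
of the left integrand is a hypothesis because nothing is known about the decay of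
the gradient of f. *)
Lemma ibp_reg p i : integ3 (fun q => \sum_(j < 3) Ker (Lreg s) p q i j * D j f q) ->
  int3 (fun q => \sum_(j < 3) Ker (Lreg s) p q i j * D j f q) =
  - int3 (fun q => divK (Lreg s) p q i * f q).
Proof.
move=> iX; set X := fun q => _ in iX *.
have cL := continuous_Lreg s0.
pose L n r := Lreg s r * cutoff n.+1%:R r.
pose dL n r := Lreg s r * dcutoff n.+1%:R r + cutoff n.+1%:R r * dLreg s r.
have hL n r : is_derive r (1:R) (L n) (dL n r).
  by apply: dvM; [exact: Lreg_derive|exact: cutoff_derive].
have cc n : continuous (cutoff n.+1%:R : R -> R).
  by move=> r; apply/differentiable_continuous/derivable1_diffP; case: (@cutoff_derive _ n.+1%:R r (ltr0Sn R n)).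
have cdL n : continuous (dL n).
  move=> r; apply: cvgD; apply: cvgM; [exact: cL|exact: dcutoff_continuous|exact: cc|].
  exact: continuous_dLreg.
have L0 n r : n.+1%:R <= r -> L n r = 0.
  rewrite /L /cutoff /glue => h; case: ifP => h'; last by rewrite mulr0.
  have -> : r = n.+1%:R by apply/eqP; rewrite eq_le h h'.
  by rewrite divff// subrr expr0n mulr0.
have E n : int3 (fun q => cutoff n.+1%:R (rho p q) * X q) =
    - int3 (fun q => cutoff n.+1%:R (rho p q) * (divK (Lreg s) p q i * f q)).
  have := ibp_compact cf dF cdF p i (ltr0Sn R n) (hL n) (@cdL n) (@L0 n).
  move=> h; apply: etrans (etrans h _).
    by apply: eq_int3 => q; rewrite /X big_distrr /=; apply: eq_bigr => j _; rewrite /Ker /L; ring.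
  by congr (- _); apply: eq_int3 => q; rewrite /divK /L; ring.
have bc n q : `|cutoff n.+1%:R (rho p q)| <= 1.
  have r0 : 0 <= rho p q by have := rho_ge1 p q; lra.
  by have /andP[h1 h2] := cutoff_bound (ltr0Sn R n) r0; rewrite ger0_norm.
have mc n : meas3 (fun q => cutoff n.+1%:R (rho p q)).
  by exact: (meas3_continuous (ct_comp (@ct_rho _ p) (@cc n))).
have key g : integ3 g ->
    int3 (fun q => cutoff n.+1%:R (rho p q) * g q) @[n --> \oo] --> int3 g.
  move=> ig; have [] // := @int3_cvg _ (fun n q => cutoff n.+1%:R (rho p q) * g q) g (fun q => `|g q|).
  - by move=> n; apply: meas3M => //; exact: integ3_meas.
  - exact: integ3_norm.
  - by move=> n q; rewrite normrM ler_piMl.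
  - move=> q; rewrite -[X in _ --> X]mul1r; apply: cvgM; [exact: cutoff_cvg|exact: cvg_cst].
have h1 := key _ iX; have h2 := key _ (integ3_divK p i).
have EE : (fun n => int3 (fun q => cutoff n.+1%:R (rho p q) * X q)) =
    (fun n => - int3 (fun q => cutoff n.+1%:R (rho p q) * (divK (Lreg s) p q i * f q))).
  exact/funext.
rewrite EE in h1; apply: etrans (esym (cvg_lim (@Rhausdorff R) h1)) _.
by apply: (cvg_lim (@Rhausdorff R)); exact: cvgN.
Qed.

(** If f p = 0 then the gradient of f vanishes as well and both integrals are zero.
Otherwise the flux integrand, integrable by hypothesis, can be solved for the
term with the gradient of f(q), which makes it integrable and allows integration
by parts. *)
Lemma flux_split p i : integ3 (RL_integrand f f i p) -> integ3 (Nrem f s i p) ->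
  int3 (RL_integrand f f i p) =
  int3 (fun q => drift f (Lreg s) p i q * f q) + int3 (Nrem f s i p).
Proof.
move=> iQ iN.
have iM : integ3 (Mreg f s i p).
  apply: (@eq_integ3 _ (fun q => RL_integrand f f i p q - Nrem f s i p q)).
    by move=> q; rewrite (RL_integrand_split f s) addrK.
  exact: integ3B.
rewrite (eq_int3 (RL_integrand_split f s i p)) int3D//; congr (_ + _).
have [fp|fp] := eqVneq (f p) 0.
  apply: eq_int3 => q; rewrite /Mreg /drift big1 ?fp ?mul0r ?addr0.
    by rewrite big1 ?mul0r// => j _; rewrite (min_grad dF f0)// mul0r.
  by move=> j _; rewrite /commutator fp (min_grad dF f0)// mulr0 mul0r subrr mulr0.
pose S1 q := \sum_(j < 3) D j f p * (Ker (Lreg s) p q i j * f q).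
have iS : integ3 S1.
  apply: (@eq_integ3 _ (fun q => D i0 f p * (Ker (Lreg s) p q i i0 * f q)
   + D i1 f p * (Ker (Lreg s) p q i i1 * f q) + D i2 f p * (Ker (Lreg s) p q i i2 * f q))).
    by move=> q; rewrite /S1 sum3.
  by repeat (apply: integ3D); apply: integ3Z; exact: integ3_Ker.
pose X q := \sum_(j < 3) Ker (Lreg s) p q i j * D j f q.
have MX q : Mreg f s i p q = S1 q - f p * X q.
  by rewrite /Mreg /S1 /X /commutator !sum3; ring.
have iX : integ3 X.
  apply: (@eq_integ3 _ (fun q => (f p)^-1 * (S1 q - Mreg f s i p q))).
    by move=> q; rewrite MX opprB addrC subrK mulKf.
  by apply: integ3Z; exact: integ3B.
rewrite (eq_int3 MX) int3B ?int3Z//; last exact: integ3Z.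
rewrite (ibp_reg iX) mulrN opprK -int3Z; last exact: integ3_divK.
rewrite -int3D//; last by apply: integ3Z; exact: integ3_divK.
by apply: eq_int3 => q; rewrite /S1 /drift !sum3; ring.
Qed.
End AtScale.
End FluxSplitting.

(** * Differentiating the flux *)

Section DifferentiatedFlux.
Variable R : realType.
Notation V := 'rV[R]_3.
Implicit Types (p q : V) (i j k : 'I_3) (s : R).
Local Notation jb := jbracket.
Local Notation D k F := ('D_(basis3 k) F).

Lemma int3_derive (m dm : V -> V -> R) p i (G : V -> R) :
  (forall x q, `|x - p| <= 1 -> is_derive x (basis3 i) (fun x => m x q) (dm x q)) ->
  (forall x, `|x - p| <= 1 -> integ3 (m x)) -> integ3 G ->
  (forall x q, `|x - p| <= 1 -> `|dm x q| <= G q) ->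
  integ3 (dm p) /\ is_derive p (basis3 i) (fun x => int3 (m x)) (int3 (dm p)).
Proof.
move=> hm im iG hG.
have np (t : R) : `|t| <= 1 -> `|t *: basis3 i + p - p| <= 1.
  by move=> ht; rewrite addrK; exact: le_trans (norm_basis t i) ht.
have hm' q (t : R) : `|t| <= 1 ->
    is_derive t (1:R) (fun t => m (t *: basis3 i + p) q) (dm (t *: basis3 i + p) q).
  by move=> /np h; apply: (is_derive_line (fun x => m x q) (basis3 i) p t _).1; exact: hm.
have E0 : 0 *: basis3 i + p = p by rewrite scale0r add0r.
pose F t (z : R * R * R) := m (t *: basis3 i + p) (vec3 z).
have hI (t : R) : `]-1, 1[%classic t -> `|t| <= 1.
  by rewrite /= in_itv /= -ltr_norml => /ltW.
have d1 t z : `|t| <= 1 -> partial1of2 F t z = dm (t *: basis3 i + p) (vec3 z).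
  by move=> /(hm' (vec3 z) t)[_ <-]; rewrite partial1of2E.
split.
  have h1 n : 0 < n.+1%:R^-1 :> R by rewrite invr_gt0.
  have h2 n : `|n.+1%:R^-1| <= 1 :> R by rewrite gtr0_norm// invf_le1 ?ler1n.
  pose Q n q := (m (n.+1%:R^-1 *: basis3 i + p) q - m p q) / n.+1%:R^-1.
  have p0 : `|p - p| <= 1 by rewrite subrr normr0.
  have [] // := @int3_cvg _ Q (dm p) G.
  - move=> n; rewrite /Q; apply: meas3M; last exact: measurable_cst.
    by apply: integ3_meas; apply: integ3B; apply: im => //; exact: np.
  - move=> n q; rewrite /Q normf_div ler_pdivrMr ?normr_gt0 ?gt_eqF//.
    have := @mvt_bound _ (fun t => m (t *: basis3 i + p) q) n.+1%:R^-1 (G q).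
    rewrite E0; apply=> x hx; have hx1 := le_trans hx (h2 n).
    by exists (dm (x *: basis3 i + p) q); [exact: hm'|apply: hG; exact: np].
  - move=> q; have := hm' q 0; rewrite normr0 ler01 => /(_ isT)[dv de].
    have cv : h^-1 *: (((fun t => m (t *: basis3 i + p) q) \o shift 0) (h *: (1:R)) -
       m (0 *: basis3 i + p) q) @[h --> (0:R)^'] --> dm p q.
      by move: de; rewrite E0 => <-; rewrite -{2}E0; exact: dv.
    have tn : (forall n, (n.+1%:R^-1 : R) != 0) /\ (n.+1%:R^-1 : R) @[n --> \oo] --> 0.
      by split; [move=> n; rewrite gt_eqF|exact: cvg_harmonic].
    have := (cvgr_dnbhsP _ _ _).1 cv _ tn.
    rewrite (_ : (fun n => _) = Q^~ q)//; apply/funext => n.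
    rewrite /Q /= E0 addr0 [_ *: 1]mulr1; exact: mulrC.
have h0 : `]-1, 1[%classic (0:R) by rewrite /= in_itv /= oppr_lt0 ltr01.
have G0 y : 0 <= G (vec3 y).
  by apply: le_trans (hG p (vec3 y) _); rewrite ?subrr ?normr0.
have cv : h^-1 *: (int3 (m ((h + 0) *: basis3 i + p)) - int3 (m (0 *: basis3 i + p)))
    @[h --> (0:R)^'] --> int3 (dm p).
  have := @cvg_differentiation_under_integral R _ _ leb3 F setT measurableT 0 (-1) 1 h0
    (fun t ht => im _ (np t (hI t ht))) _ (fun z => G (vec3 z)) G0 iG.
  have -> : \int[leb3]_y partial1of2 F 0 y = int3 (dm p).
    by rewrite /int3; apply: eq_Rintegral => z _; rewrite d1 ?normr0// E0.
  apply.
  - by move=> t z ht _; case: (hm' (vec3 z) t (hI t ht)).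
  - by move=> t z ht _; rewrite d1 ?hG//; [exact/np/hI|exact: hI].
rewrite -{1}E0; apply: (is_derive_line _ (basis3 i) p 0 _).2.
have cv' : h^-1 *: (((fun t => int3 (m (t *: basis3 i + p))) \o shift 0) (h *: (1:R)) -
     int3 (m (0 *: basis3 i + p))) @[h --> (0:R)^'] --> int3 (dm p).
  apply: cvg_trans cv; apply: near_eq_cvg; apply: nearW => h /=.
  by rewrite [h *: 1]mulr1.
by apply: DeriveDef; [apply/cvg_ex; exists (int3 (dm p))|exact: cvg_lim cv'].
Qed.
End DifferentiatedFlux.

Section CollisionFormula.
Variable R : realType.
Notation V := 'rV[R]_3.
Implicit Types (p q : V) (i j k : 'I_3) (s : R).
Local Notation jb := jbracket.
Local Notation D k F := ('D_(basis3 k) F).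

Variable f : V -> R.
Hypothesis cf : continuous f.
Hypothesis dF : forall p i, derivable f p (basis3 i).
Hypothesis cdF : forall i, continuous (D i f).
Hypothesis ddF : forall p i j, derivable (D j f) p (basis3 i).
Hypothesis cddF : forall i j, continuous (D i (D j f)).
Hypothesis f0 : forall q, 0 <= f q.
Hypothesis iE : integ3 (fun q => jb q * f q).
Hypothesis hQ : QRL_defined f f.

Definition ddrift (L dL : R -> R) p i q : R :=
  \sum_(j < 3) (D i (D j f) p * Ker L p q i j + D j f p * dKer L dL p q i j)
  + (D i f p * divK L p q i + f p * ddivK L dL p q i).

Lemma ddrift_derive (L dL : R -> R) p i q : is_derive (rho p q) (1:R) L (dL (rho p q)) ->
  is_derive p (basis3 i) (fun p => drift f L p i q) (ddrift L dL p i q).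
Proof.
move=> hL.
have h1 : is_derive p (basis3 i) f (D i f p) by exact: derivableP.
have h2 j : is_derive p (basis3 i) (D j f) (D i (D j f) p) by exact: derivableP.
have E : (fun p => drift f L p i q) =
    (fun p => \sum_(j < 3) (D j f p * Ker L p q i j) + f p * divK L p q i) by [].
rewrite E; apply: dvD; last first.
  eapply is_derive_eq; first exact: (dvM h1 (divK_derive i hL)).
  by rewrite /=; ring.
rewrite (_ : (fun p => \sum_(j < 3) _) = \sum_(j < 3) (fun p => D j f p * Ker L p q i j)); last first.
  by apply/funext => x; rewrite fct_sumE.
apply: is_derive_sum => j.
eapply is_derive_eq; first exact: (dvM (h2 j) (Ker_derive i j hL)).
by rewrite /=; ring.
Qed.

(** The divergence of [drift] in nondivergence form. The two contributions of the
first derivatives of f combine, and the sum rho q - p + rho p - q factors as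
(rho - 1)(p + q). *)
Definition ndiv (L dL : R -> R) p q : R :=
  \sum_(j < 3) \sum_(i < 3) D i (D j f) p * Ker L p q i j
  + \sum_(j < 3) D j f p * (2 * L (rho p q) * (rho p q - 1) * (p 0 j + q 0 j) / (jb p * jb q))
  + f p * (2 / (jb p * jb q) * ((rho p q ^+ 2 - 1) * dL (rho p q) + 3 * rho p q * L (rho p q))).

Lemma sum_ddrift (L dL : R -> R) p q : \sum_(i < 3) ddrift L dL p i q = ndiv L dL p q.
Proof.
rewrite /ndiv -sum_ddivK.
have -> : \sum_(j < 3) D j f p * (2 * L (rho p q) * (rho p q - 1) * (p 0 j + q 0 j) / (jb p * jb q))
   = \sum_(j < 3) D j f p * (\sum_(i < 3) dKer L dL p q i j) + \sum_(i < 3) D i f p * divK L p q i.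
  rewrite -big_split /=; apply: eq_bigr => j _; rewrite sum_dKer /divK (rhoC q).
  by field; rewrite !jb_neq0.
rewrite /ddrift big_split /= exchange_big /= big_split /= -!addrA addrA [RHS]addrA.
under eq_bigr do rewrite big_split /=.
rewrite big_split /= !mulr_sumr -!addrA; congr (_ + (_ + _)).
by apply: eq_bigr => j _; rewrite mulr_sumr.
Qed.

(** The regular part is differentiated under the integral sign; the derivative of
the remainder exists as a difference and is O(s^2) by [remainder_derive]. *)
Lemma flux_derivative_bound p0 : exists K s1, [/\ 0 <= K, 0 < s1, s1 <= 2^-1 &
  forall s, 0 < s -> s <= s1 ->
   integ3 (fun q => ndiv (Lreg s) (dLreg s) p0 q * f q) /\
   QRL f f p0 <= int3 (fun q => ndiv (Lreg s) (dLreg s) p0 q * f q) + K * s ^+ 2].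
Proof.
have hI p i : integ3 (RL_integrand f f i p) by case: (hQ p i).
have rem i := remainder_derive cf dF cdF ddF cddF hI p0 i.
have [K0 [s0 [K00 s00 s02 h0]]] := rem i0.
have [K1 [s1 [K10 s10 s12 h1]]] := rem i1.
have [K2 [s2 [K20 s20 s22 h2]]] := rem i2.
exists (K0 + K1 + K2), (Num.min s0 (Num.min s1 s2)); split.
- by rewrite !addr_ge0.
- by rewrite !lt_min s00 s10.
- by rewrite ge_min s02.
move=> s sp; rewrite !le_min => /and3P[ss0 ss1 ss2].
have [C Cp hC] := Lreg_growth sp.
have hL r : is_derive r (1:R) (Lreg s) (dLreg s r) by exact: Lreg_derive.
have bnd (F : V -> R) : continuous F -> exists2 M, 0 <= M & forall q, `|q - p0| <= 1 -> `|F q| <= M.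
  move=> cF; have [M0 M00 h] := bounded_on_cube (1 + `|p0|) cF; exists M0 => // q hq.
  by apply: h; rewrite -(subrK p0 q); apply: le_trans (ler_normD _ _) _; rewrite lerD2r.
have main i Ki : (forall p, `|p - p0| <= 1 -> integ3 (Nrem f s i p)) ->
   (forall d, is_derive p0 (basis3 i) (fun p => int3 (Nrem f s i p)) d -> `|d| <= Ki) ->
   integ3 (fun q => ddrift (Lreg s) (dLreg s) p0 i q * f q) /\
   D i (RL_flux f f i) p0 <= int3 (fun q => ddrift (Lreg s) (dLreg s) p0 i q * f q) + Ki.
  move=> iN hN.
  have [B0 B00 hB0] := bnd _ cf.
  have [B1 B10 hB1] := bnd _ (@cdF i).
  have dd j : exists2 M, 0 <= M & forall q, `|q - p0| <= 1 -> `|D i (D j f) q| <= M /\ `|D j f q| <= M.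
    have [Ma Ma0 ha] := bnd _ (@cddF i j); have [Mb Mb0 hb] := bnd _ (@cdF j).
    exists (Ma + Mb); first exact: addr_ge0.
    by move=> q hq; have := ha q hq; have := hb q hq; split; lra.
  have [M0 M00 hM0] := dd i0; have [M1 M10 hM1] := dd i1; have [M2 M20 hM2] := dd i2.
  pose B := B0 + B1 + M0 + M1 + M2.
  have Bp : 0 <= B by rewrite /B; clear -B00 B10 M00 M10 M20; lra.
  have bf q : `|q - p0| <= 1 -> `|f q| <= B.
    by move=> h; apply: le_trans (hB0 q h) _; rewrite /B; clear -B00 B10 M00 M10 M20; lra.
  have bdi q : `|q - p0| <= 1 -> `|D i f q| <= B.
    by move=> h; apply: le_trans (hB1 q h) _; rewrite /B; clear -B00 B10 M00 M10 M20; lra.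
  have bj j q : `|q - p0| <= 1 -> `|D i (D j f) q| <= B /\ `|D j f q| <= B.
    move=> h; suff [M [hM ha hb]] : exists M, [/\ M <= B, `|D i (D j f) q| <= M & `|D j f q| <= M].
      by split; [exact: le_trans ha hM|exact: le_trans hb hM].
    elim/ord3P: j; [exists M0; have [? ?] := hM0 q h|exists M1; have [? ?] := hM1 q h
      |exists M2; have [? ?] := hM2 q h]; split=> //; rewrite /B; clear -B00 B10 M00 M10 M20; lra.
  clearbody B.
  pose A := jb p0 + 2.
  have hA x : `|x - p0| <= 1 -> jb x <= A.
    by move=> h; have := jb_lip x p0; rewrite distrC /A; lra.
  pose U := B * (80 * C * A ^+ 2).
  have A1 : 1 <= A by have := jb_ge1 p0; rewrite /A; lra.
  have C0 : 0 <= C by exact: ltW.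
  have A0 : 0 <= A by lra.
  have U0 : 0 <= U by rewrite /U !mulr_ge0.
  have grow x q (y c : R) : `|x - p0| <= 1 -> `|y| <= c -> c <= 80 * C * jb x ^+ 2 * jb q ->
     forall z, `|z| <= B -> `|z * y| <= U * jb q.
    move=> hx hy hc z hz; rewrite /U -mulrA; apply: normM_le hz _.
    apply: le_trans hy (le_trans hc _); apply: ler_wpM2r; first exact: jb_ge0.
    apply: ler_wpM2l; first by rewrite mulr_ge0.
    by apply: lerXn2r; rewrite ?nnegrE ?jb_ge0 ?hA//; lra.
  have lowK x q : 12 * C * jb x * jb q <= 80 * C * jb x ^+ 2 * jb q.
    have := jb_ge1 x => h; apply: ler_wpM2r; first exact: jb_ge0.
    rewrite -!mulrA [80 * _]mulrC -!mulrA mulrCA ler_wpM2l//; nra.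
  have lowB x q : 6 * C * jb x * jb q <= 80 * C * jb x ^+ 2 * jb q.
    apply: le_trans (lowK x q); rewrite !ler_wpM2r ?jb_ge0//; lra.
  have bound x q : `|x - p0| <= 1 ->
      `|ddrift (Lreg s) (dLreg s) x i q * f q| <= 8 * U * (jb q * f q).
    move=> hx; rewrite normrM (ger0_norm (f0 q)) mulrA ler_wpM2r//.
    have t1 j : `|D i (D j f) x * Ker (Lreg s) x q i j| <= U * jb q.
      exact: grow hx (Ker_growth hC x q i j) (lowK x q) _ (bj j x hx).1.
    have t2 j : `|D j f x * dKer (Lreg s) (dLreg s) x q i j| <= U * jb q.
      exact: grow hx (dKer_growth hC x q i j) (lexx _) _ (bj j x hx).2.
    have t3 : `|D i f x * divK (Lreg s) x q i| <= U * jb q.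
      exact: grow hx (divK_growth hC x q i) (lowB x q) _ (bdi x hx).
    have t4 : `|f x * ddivK (Lreg s) (dLreg s) x q i| <= U * jb q.
      exact: grow hx (ddivK_growth hC x q i) (lexx _) _ (bf x hx).
    apply: le_trans (normD_le (norm_sum3_le (fun j => normD_le (t1 j) (t2 j))) (normD_le t3 t4)) _.
    by rewrite le_eqVlt; apply/orP; left; apply/eqP; ring.
  have dm x q : `|x - p0| <= 1 -> is_derive x (basis3 i)
      (fun x => drift f (Lreg s) x i q * f q) (ddrift (Lreg s) (dLreg s) x i q * f q).
    move=> _; eapply is_derive_eq.
      by apply: dvM; apply: ddrift_derive; exact: hL.
    by rewrite mulr0 add0r mulrC.
  have [ii di] := @int3_derive _ (fun x q => drift f (Lreg s) x i q * f q)
    (fun x q => ddrift (Lreg s) (dLreg s) x i q * f q) p0 i _ dm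
    (fun x _ => integ3_drift cf f0 iE sp x i) (integ3Z (8 * U) iE) bound.
  split; first exact: ii.
  have [_ dflux] := hQ p0 i.
  have dN : is_derive p0 (basis3 i) (fun p => int3 (Nrem f s i p))
      (D i (RL_flux f f i) p0 - int3 (fun q => ddrift (Lreg s) (dLreg s) p0 i q * f q)).
    have dfl : is_derive p0 (basis3 i) (RL_flux f f i) (D i (RL_flux f f i) p0) by exact: derivableP.
    apply: near_eq_is_derive (dvD dfl (dvN di)).
    near=> p.
    have hp : `|p - p0| <= 1.
      apply: ltW; near: p; have : nbhs p0 [set q | `|q - p0| < 1].
        by apply: open_nbhs_nbhs; split; [exact: open_cube|rewrite /= subrr normr0].
      exact.
    have := flux_split cf dF cdF f0 iE sp (hI p i) (iN p hp).
    by rewrite /RL_flux -/(int3 (RL_integrand f f i p)) => ->; rewrite addrAC subrr add0r.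
  have := hN _ dN; have := ler_norm (D i (RL_flux f f i) p0 - int3 (fun q => ddrift (Lreg s) (dLreg s) p0 i q * f q)).
  by move=> /le_trans h /h; rewrite lerBlDl.
have [a0 b0] := main i0 _ (h0 s sp ss0).1 (h0 s sp ss0).2.
have [a1 b1] := main i1 _ (h1 s sp ss1).1 (h1 s sp ss1).2.
have [a2 b2] := main i2 _ (h2 s sp ss2).1 (h2 s sp ss2).2.
have E q : ddrift (Lreg s) (dLreg s) p0 i0 q * f q + ddrift (Lreg s) (dLreg s) p0 i1 q * f q
    + ddrift (Lreg s) (dLreg s) p0 i2 q * f q = ndiv (Lreg s) (dLreg s) p0 q * f q.
  by rewrite -!mulrDl -sum_ddrift sum3.
have i01 := integ3D a0 a1.
split; first exact: (eq_integ3 E (integ3D i01 a2)).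
rewrite -(eq_int3 E) int3D// int3D// /QRL sum3; lra.
Unshelve. all: by end_near. Qed.
End CollisionFormula.

(** * The collision operator at a maximum *)

Section MaximumPoint.
Variable R : realType.
Notation V := 'rV[R]_3.
Implicit Types (p q : V) (i j k : 'I_3) (s : R).
Local Notation jb := jbracket.
Local Notation D k F := ('D_(basis3 k) F).

Section Barrier.
Variables W dW ddW : R -> R.
Hypothesis hW : forall r : R, 0 < r -> is_derive r (1:R) W (dW r).
Hypothesis hdW : forall r : R, 0 < r -> is_derive r (1:R) dW (ddW r).
Hypothesis cddW : forall r : R, 0 < r -> {for r, continuous ddW}.

Lemma ct_jb_comp (h : R -> R) : (forall r : R, 0 < r -> {for r, continuous h}) ->
  continuous (fun p : V => h (jb p)).
Proof.
move=> ch p; apply: (@continuous_comp _ _ _ (@jbracket R) h); first exact: ct_jb.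
exact/ch/jb_gt0.
Qed.

Lemma barrier_derive p i : is_derive p (basis3 i) (fun p => W (jb p)) (dW (jb p) * (p 0 i / jb p)).
Proof. exact: dv_comp (jb_derive p i) (hW (jb_gt0 p)). Qed.

(** The Hessian of W(<p>). *)
Definition barrier_hess p i j : R :=
  ddW (jb p) * (p 0 i * p 0 j / jb p ^+ 2)
  + dW (jb p) * ((i == j)%:R / jb p - p 0 i * p 0 j / jb p ^+ 3).

Lemma barrier_derive2 p i j :
  is_derive p (basis3 i) (fun p => dW (jb p) * (p 0 j / jb p)) (barrier_hess p i j).
Proof.
have h1 := dv_comp (jb_derive p i) (hdW (jb_gt0 p)).
eapply is_derive_eq.
  apply: (dvM h1); apply: dvM; first exact: coord_derive.
  by apply: dvV; [exact: jb_neq0|exact: jb_derive].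
by rewrite /barrier_hess eq_sym /=; field; exact: jb_neq0.
Qed.

Lemma ct_barrier1 j : continuous (fun p : V => dW (jb p) * (p 0 j / jb p)).
Proof.
have c1 : continuous (fun p : V => dW (jb p)).
  apply: ct_jb_comp => r r0; apply/differentiable_continuous/derivable1_diffP.
  by case: (hdW r0).
repeat (cont_step || exact: c1 || exact: ct_jb); move=> q; exact: jb_neq0.
Qed.

Lemma ct_barrier2 i j : continuous (fun p : V => barrier_hess p i j).
Proof.
have c1 : continuous (fun p : V => dW (jb p)).
  apply: ct_jb_comp => r r0; apply/differentiable_continuous/derivable1_diffP.
  by case: (hdW r0).
have c2 := ct_jb_comp cddW.
rewrite /barrier_hess; repeat (cont_step || exact: c1 || exact: c2 || exact: ct_jb).
all: by move=> q; rewrite ?expf_neq0 ?jb_neq0.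
Qed.

Variable f : V -> R.
Hypothesis cf : continuous f.
Hypothesis dF : forall p i, derivable f p (basis3 i).
Hypothesis cdF : forall i, continuous (D i f).
Hypothesis ddF : forall p i j, derivable (D j f) p (basis3 i).
Hypothesis cddF : forall i j, continuous (D i (D j f)).

(** First and second order conditions at the local maximum of f - W(<.>). *)
Lemma touching_from_below p d : 0 < d ->
  (forall q, `|q - p| < d -> f q - W (jb q) <= f p - W (jb p)) ->
  (forall j, D j f p = dW (jb p) * (p 0 j / jb p)) /\
  forall e : V, \sum_(j < 3) \sum_(i < 3) D i (D j f) p * (e 0 i * e 0 j) <=
    \sum_(j < 3) \sum_(i < 3) barrier_hess p i j * (e 0 i * e 0 j).
Proof.
move=> d0 mx; pose F q := f q - W (jb q).
have F1 q j : is_derive q (basis3 j) F (D j f q - dW (jb q) * (q 0 j / jb q)).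
  by apply: dvD; [exact: derivableP|apply: dvN; exact: barrier_derive].
have E1 j : D j F = (fun q => D j f q - dW (jb q) * (q 0 j / jb q)).
  by apply/funext => q; case: (F1 q j).
have F2 q i j : is_derive q (basis3 i) (D j F) (D i (D j f) q - barrier_hess q i j).
  rewrite E1; apply: dvD; [exact: derivableP|apply: dvN; exact: barrier_derive2].
have E2 i j : D i (D j F) = (fun q => D i (D j f) q - barrier_hess q i j).
  by apply/funext => q; case: (F2 q i j).
have c1 j : continuous (D j f) by exact: cdF.
have c2 i j : continuous (D i (D j f)) by exact: cddF.
have g1 q i : derivable F q (basis3 i) by case: (F1 q i).
have g2 i : continuous (D i F).
  by rewrite E1; apply: ctD; [exact: c1|apply: ctN; exact: ct_barrier1].
have g3 q i j : derivable (D j F) q (basis3 i) by case: (F2 q i j).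
have g4 i j : continuous (D i (D j F)).
  by rewrite E2; apply: ctD; [exact: c2|apply: ctN; exact: ct_barrier2].
have H e := hessian_test e d0 g1 g2 g3 g4 mx.
split=> [j|e].
  have [+ _] := H (basis3 j); rewrite (bigD1 j)//= big1 => [|k kj]; last first.
    by rewrite !mxE (negbTE kj) mulr0.
  rewrite !mxE !eqxx mulr1 addr0; case: (F1 p j) => _ -> /eqP.
  by rewrite subr_eq0 => /eqP.
have [_] := H e.
rewrite (_ : \sum_(j < 3) _ = \sum_(j < 3) \sum_(i < 3) D i (D j f) p * (e 0 i * e 0 j)
   - \sum_(j < 3) \sum_(i < 3) barrier_hess p i j * (e 0 i * e 0 j)); first by rewrite subr_le0.
rewrite -sumrB; apply: eq_bigr => j _; rewrite -sumrB; apply: eq_bigr => i _.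
by case: (F2 p i j) => _ ->; rewrite mulrBl.
Qed.
End Barrier.
End MaximumPoint.

Section PointwiseBound.
Variable R : realType.
Notation V := 'rV[R]_3.
Implicit Types (p q : V) (i j k : 'I_3) (s : R).
Local Notation jb := jbracket.
Local Notation D k F := ('D_(basis3 k) F).
Variables W dW ddW : R -> R.
Variable f : V -> R.
Variable p : V.
Hypothesis h1 : forall j, D j f p = dW (jb p) * (p 0 j / jb p).
Hypothesis h2 : forall e : V, \sum_(j < 3) \sum_(i < 3) D i (D j f) p * (e 0 i * e 0 j) <=
    \sum_(j < 3) \sum_(i < 3) barrier_hess dW ddW p i j * (e 0 i * e 0 j).

(** Contraction with the kernel is a nonnegative combination of evaluations along
the vectors eta. *)
Lemma sum_Ker_squares (A : 'I_3 -> 'I_3 -> R) (L : R -> R) q :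
  \sum_(j < 3) \sum_(i < 3) A i j * Ker L p q i j =
  L (rho p q) / (jb p * jb q) * \sum_(k < 3) \sum_(j < 3) \sum_(i < 3) A i j *
    (eta p q k 0 i * eta p q k 0 j).
Proof.
rewrite [in RHS]exchange_big /= mulr_sumr; apply: eq_bigr => j _.
rewrite [in RHS]exchange_big /= mulr_sumr; apply: eq_bigr => i _.
by rewrite -mulr_sumr -S_squares /Ker; ring.
Qed.

Lemma barrier_hess_Ker (L : R -> R) q :
  \sum_(j < 3) \sum_(i < 3) barrier_hess dW ddW p i j * Ker L p q i j =
  L (rho p q) / (jb p * jb q) * (ddW (jb p) * nsq (cross p q)
    + dW (jb p) * (2 * (rho p q ^+ 2 - 1) / jb p)).
Proof.
have P0 := jb_neq0 p; have Q0 := jb_neq0 q.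
have -> : \sum_(j < 3) \sum_(i < 3) barrier_hess dW ddW p i j * Ker L p q i j =
  L (rho p q) / (jb p * jb q) * ((ddW (jb p) / jb p ^+ 2 - dW (jb p) / jb p ^+ 3) *
     (\sum_(j < 3) \sum_(i < 3) Sm p q j i * (p 0 j * p 0 i))
   + dW (jb p) / jb p * \sum_(j < 3) Sm p q j j).
  rewrite mulrDr !mulr_sumr -big_split /=; apply: eq_bigr => j _.
  have -> : Sm p q j j = \sum_(i < 3) (i == j)%:R * Sm p q i j.
    rewrite (bigD1 j)//= eqxx mul1r big1 ?addr0// => i ij.
    by rewrite (negbTE ij) mul0r.
  rewrite !mulr_sumr -big_split /=; apply: eq_bigr => i _.
  by rewrite /barrier_hess /Ker (SmC p q j i); field; rewrite ?P0 ?Q0.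
by rewrite S_pp S_trace; field; rewrite ?P0 ?Q0.
Qed.

Lemma first_order_sum (L : R -> R) q :
  \sum_(j < 3) D j f p * (2 * L (rho p q) * (rho p q - 1) * (p 0 j + q 0 j) / (jb p * jb q)) =
  L (rho p q) / (jb p * jb q) * (dW (jb p) * (2 * (rho p q - 1) / jb p) *
    (jb p ^+ 2 + jb p * jb q - 1 - rho p q)).
Proof.
have P0 := jb_neq0 p; have Q0 := jb_neq0 q.
have -> : jb p ^+ 2 + jb p * jb q - 1 - rho p q = \sum_(j < 3) p 0 j * (p 0 j + q 0 j).
  by rewrite jb_sqr sum3 /rho dotvE; ring.
rewrite !mulr_sumr; apply: eq_bigr => j _.
by rewrite h1; field; rewrite ?P0 ?Q0.
Qed.

(** The Hessian of f may be replaced by that of the barrier, since the kernel is a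
sum of squares. The barrier terms then simplify by [S_pp], [S_trace] and the
identity |p|^2 + p.q = P^2 + P Q - 1 - rho. *)
Lemma ndiv_le (L dL : R -> R) q : 0 <= L (rho p q) ->
  ndiv f L dL p q <= L (rho p q) * (ddW (jb p) * nsq (cross p q) / (jb p * jb q)
      + 2 * dW (jb p) * (rho p q - 1) * ((jb p)^-1 + (jb q)^-1))
    + f p * (2 / (jb p * jb q) * ((rho p q ^+ 2 - 1) * dL (rho p q) + 3 * rho p q * L (rho p q))).
Proof.
move=> L0; have P0 := jb_neq0 p; have Q0 := jb_neq0 q.
rewrite /ndiv lerD2r first_order_sum.
have le1 : \sum_(j < 3) \sum_(i < 3) D i (D j f) p * Ker L p q i j <=
   \sum_(j < 3) \sum_(i < 3) barrier_hess dW ddW p i j * Ker L p q i j.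
  rewrite !sum_Ker_squares ler_wpM2l//; last by apply: ler_sum => k _; exact: h2.
  by rewrite divr_ge0// mulr_ge0// jb_ge0.
rewrite barrier_hess_Ker in le1.
have {}le1 := lerD le1 (lexx (L (rho p q) / (jb p * jb q) * (dW (jb p) * (2 * (rho p q - 1) / jb p) *
    (jb p ^+ 2 + jb p * jb q - 1 - rho p q)))).
apply: le_trans le1 _; rewrite le_eqVlt; apply/orP; left; apply/eqP.
by field; rewrite ?P0 ?Q0.
Qed.
End PointwiseBound.

Section CollisionAtMaximum.
Variable R : realType.
Notation V := 'rV[R]_3.
Implicit Types (p q : V) (i j k : 'I_3) (s : R).
Local Notation jb := jbracket.
Local Notation D k F := ('D_(basis3 k) F).

Variables W dW ddW : R -> R.
Hypothesis hW : forall r : R, 0 < r -> is_derive r (1:R) W (dW r).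
Hypothesis hdW : forall r : R, 0 < r -> is_derive r (1:R) dW (ddW r).
Hypothesis cddW : forall r : R, 0 < r -> {for r, continuous ddW}.

Variable f : V -> R.
Hypothesis cf : continuous f.
Hypothesis dF : forall p i, derivable f p (basis3 i).
Hypothesis cdF : forall i, continuous (D i f).
Hypothesis ddF : forall p i j, derivable (D j f) p (basis3 i).
Hypothesis cddF : forall i j, continuous (D i (D j f)).
Hypothesis f0 : forall q, 0 <= f q.
Hypothesis iE : integ3 (fun q => jb q * f q).
Hypothesis hQ : QRL_defined f f.

Variables (p : V) (d E B d1 d2 : R).
Hypothesis d0 : 0 < d.
Hypothesis mx : forall q, `|q - p| < d -> f q - W (jb q) <= f p - W (jb p).
Hypothesis hE : int3 (fun q => jb q * f q) <= E.
Hypothesis hB : forall q, `|q - p| < 1 -> f q <= B.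
Hypothesis hd1 : dW (jb p) <= d1.
Hypothesis hd2 : ddW (jb p) <= d2.
Hypothesis d10 : 0 <= d1.
Hypothesis d20 : 0 <= d2.

(** Each of the three terms is matched with the corresponding weight of
[kernel_size_far_near]. *)
Lemma ndiv_bound s q : 0 < s -> s <= 2^-1 ->
  ndiv f (Lreg s) (dLreg s) p q <=
  2 * d2 * (3 * jb q + 2 * jb p * newton p 1 q) + 2 * d1 * (6 * jb q + 8 * newton p 1 q)
  + f p * (4 * (3 * jb q + 2 * newton p 1 q) + 60 * s ^- 3 / (jb p * jb q) * \1_(shell p s) q).
Proof.
move=> s0 s2; have [t1 t2] := touching_from_below hW hdW cddW dF cdF ddF cddF d0 mx.
have P0 := jb_gt0 p; have Q0 := jb_gt0 q.
have r1 := rho_ge1 p q; have L0 := Lreg_ge0 s0 (rho p q).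
have [k1 [k2 k3]] := kernel_size_far_near p q.
have iPQ : 0 <= (jb p)^-1 + (jb q)^-1 by rewrite addr_ge0// invr_ge0 ltW.
have LK := Lreg_bound s0 p q.
have dvb := div_bound s0 p q s2.
apply: le_trans (ndiv_le t1 t2 (dLreg s) L0) _.
have e1 : Lreg s (rho p q) * (ddW (jb p) * nsq (cross p q) / (jb p * jb q)) <=
    2 * d2 * (3 * jb q + 2 * jb p * newton p 1 q).
  have n1 : nsq (cross p q) / (jb p * jb q) <= 2 * (rho p q - 1).
    rewrite ler_pdivrMr ?mulr_gt0//; have := nsq_le_rho p q; have := nsq_ge0 (q - p); lra.
  have n0 : 0 <= nsq (cross p q) / (jb p * jb q) by rewrite divr_ge0 ?nsq_ge0// mulr_ge0// ltW.
  apply: (@le_trans _ _ (2 * d2 * (Lreg s (rho p q) * (rho p q - 1)))); last first.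
    by apply: ler_wpM2l; [rewrite mulr_ge0|exact: le_trans LK k1].
  rewrite -mulrA (_ : 2 * d2 * _ = Lreg s (rho p q) * (d2 * (2 * (rho p q - 1)))); last by ring.
  apply: ler_wpM2l => //; apply: le_trans (ler_wpM2r n0 hd2) _; exact: ler_wpM2l.
have e2 : Lreg s (rho p q) * (2 * dW (jb p) * (rho p q - 1) * ((jb p)^-1 + (jb q)^-1)) <=
    2 * d1 * (6 * jb q + 8 * newton p 1 q).
  apply: (@le_trans _ _ (2 * d1 * (Lreg s (rho p q) * (rho p q - 1) * ((jb p)^-1 + (jb q)^-1)))); last first.
    apply: ler_wpM2l; first by rewrite mulr_ge0.
    by apply: le_trans k2; apply: ler_wpM2r.
  rewrite (_ : Lreg s (rho p q) * _ = dW (jb p) * (2 * (Lreg s (rho p q) * (rho p q - 1) *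
    ((jb p)^-1 + (jb q)^-1)))); last by ring.
  rewrite (_ : 2 * d1 * _ = d1 * (2 * (Lreg s (rho p q) * (rho p q - 1) *
    ((jb p)^-1 + (jb q)^-1)))); last by ring.
  have r0 : 0 <= rho p q - 1 by rewrite subr_ge0.
  apply: ler_wpM2r => //; apply: mulr_ge0 => //; apply: mulr_ge0 => //; exact: mulr_ge0.
have e3 : f p * (2 / (jb p * jb q) * ((rho p q ^+ 2 - 1) * dLreg s (rho p q) + 3 * rho p q * Lreg s (rho p q)))
   <= f p * (4 * (3 * jb q + 2 * newton p 1 q) + 60 * s ^- 3 / (jb p * jb q) * \1_(shell p s) q).
  apply: ler_wpM2l; first exact: f0.
  have c0 : 0 <= 2 / (jb p * jb q) by rewrite divr_ge0// mulr_ge0// ltW.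
  apply: le_trans (ler_wpM2l c0 dvb) _.
  rewrite (_ : 2 / _ * _ = 4 * (kernel_size p q / (jb p * jb q)) + 60 * s ^- 3 / (jb p * jb q) * \1_(shell p s) q).
    by rewrite lerD2r ler_wpM2l.
  rewrite -/(shell p s); move: (s ^- 3) (\1_(shell p s) q) (kernel_size p q) => a b c.
  by field; rewrite ?jb_neq0.
rewrite mulrDr; exact: lerD (lerD e1 e2) e3.
Qed.

Let B0 : 0 <= B.
Proof. by apply: le_trans (f0 p) (hB _); rewrite subrr normr0. Qed.

(** On the shell Q >= P / 2, so that 1 / (P Q) provides the factor P^-2 that
compensates the volume of the shell. *)
Lemma shell_weight s q : 0 < s -> s <= 12^-1 -> 3 * s * jb p <= 1 ->
  60 * s ^- 3 / (jb p * jb q) * \1_(shell p s) q * f q <=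
  120 * B * s ^- 3 * (jb p)^-2 * \1_(shell p s) q.
Proof.
move=> s0 s12 sP; have P0 := jb_gt0 p; have Q0 := jb_gt0 q.
rewrite indicE; case: (boolP (q \in shell p s)) => hq; last by rewrite !mulr0 mul0r.
rewrite !mulr1; move: hq; rewrite inE => hq.
have s2 : s <= 2^-1 by apply: le_trans s12 _; rewrite lef_pV2 ?posrE//; lra.
have h := shell_near s0 s2 hq.
have fB : f q <= B by apply: hB; exact: lt_le_trans h sP.
have PQ : jb p <= 2 * jb q.
  have := jb_lip p q; have : s * jb p <= 12^-1 * jb p by rewrite ler_wpM2r// ltW.
  lra.
have s3 : 0 <= s ^- 3 by rewrite invr_ge0 exprn_ge0// ltW.
have i1 : (jb p * jb q)^-1 <= 2 * (jb p) ^- 2.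
  rewrite (_ : 2 * jb p ^- 2 = (jb p ^+ 2 / 2)^-1); last by field; exact: jb_neq0.
  rewrite lef_pV2 ?posrE ?divr_gt0 ?mulr_gt0 ?exprn_gt0//.
  by rewrite expr2 -mulrA; apply: ler_wpM2l; [exact: ltW|lra].
have i0 : 0 <= (jb p * jb q)^-1 by rewrite invr_ge0 mulr_ge0// ltW.
have m : (jb p * jb q)^-1 * f q <= 2 * (jb p) ^- 2 * B by apply: ler_pM.
have := @ler_wpM2l _ (60 * s ^- 3) _ _ _ m; rewrite mulr_ge0// => /(_ isT).
by move: (s ^- 3) (jb p ^- 2) ((jb p * jb q)^-1) => a b c; lra.
Qed.

(** Integrating [ndiv_bound] against f, with the energy for the weight Q, the sup
bound near p for the Newton potential and for the shell, and letting s tend to 0. *)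
Lemma collision_at_maximum :
  QRL f f p <= 2 * d2 * (3 * E + 64 * jb p * B) + 2 * d1 * (6 * E + 256 * B)
    + f p * (12 * E + 256 * B + 120 * 432 * B).
Proof.
have [K [s1 [K0 s10 s12 hs]]] := flux_derivative_bound cf dF cdF ddF cddF f0 iE hQ p.
have P0 := jb_gt0 p; have P1 := jb_ge1 p.
pose T := 2 * d2 * (3 * E + 64 * jb p * B) + 2 * d1 * (6 * E + 256 * B)
    + f p * (12 * E + 256 * B + 120 * 432 * B).
rewrite -/T.
have [inw vnw] := @newton_int _ p 1 ltr01.
have fn q : newton p 1 q * f q <= B * newton p 1 q.
  rewrite newtonE; case: ifP => h; last by rewrite mul0r mulr0.
  by rewrite mulrC ler_wpM2r// ?invr_ge0// hB.
have mf : meas3 f by exact: meas3_continuous.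
have iNf : integ3 (fun q => newton p 1 q * f q).
  apply: (integ3_le _ (integ3Z B inw)); first by apply: meas3M => //; exact: integ3_meas.
  by move=> q; rewrite ger0_norm ?fn// mulr_ge0// newton_ge0.
have vNf : int3 (fun q => newton p 1 q * f q) <= 32 * B.
  apply: le_trans (le_int3 iNf (integ3Z B inw) fn) _; rewrite int3Z// [32 * B]mulrC.
  by apply: ler_wpM2l => //; move: vnw; rewrite expr1n mulr1.
(* K s^2 is smaller than any margin once s is small. *)
suff H s : 0 < s -> s <= s1 -> s <= 12^-1 -> 3 * s * jb p <= 1 -> QRL f f p <= T + K * s ^+ 2.
  rewrite leNgt; apply/negP => hlt; pose e := QRL f f p - T.
  have e0 : 0 < e by rewrite subr_gt0.
  pose s := Num.min (Num.min s1 12^-1) (Num.min (3 * jb p)^-1 (e / 2 / (K + 1))).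
  have K1 : 0 < K + 1 by rewrite ltr_wpDl.
  have s0 : 0 < s.
    by rewrite !lt_min s10 /= invr_gt0 ltr0n invr_gt0 mulr_gt0//= divr_gt0// divr_gt0.
  have ss1 : s <= s1 by rewrite !ge_min lexx.
  have ss2 : s <= 12^-1 by rewrite !ge_min lexx orbT.
  have ss3 : 3 * s * jb p <= 1.
    rewrite mulrAC -ler_pdivlMl ?mulr_gt0// mulr1 !ge_min lexx !orbT; done.
  have ss4 : s * (K + 1) <= e / 2.
    by rewrite -ler_pdivlMr// !ge_min lexx !orbT.
  have := H s s0 ss1 ss2 ss3.
  have : K * s ^+ 2 <= (K + 1) * s.
    rewrite expr2 mulrA ler_wpM2r ?(ltW s0)//.
    have : s <= 1 by apply: le_trans ss2 _; rewrite invf_le1//; lra.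
    by move=> h; apply: le_trans (ler_wpM2l K0 h) _; rewrite mulr1 lerDl.
  rewrite /e in e0 ss4; lra.
move=> s0 ss1 ss2 ss3; have [ind vnd] := hs s s0 ss1.
have s2 : s <= 2^-1 by exact: le_trans ss1 s12.
apply: le_trans vnd _; rewrite lerD2r.
have [ish vsh] := shell_volume p s0 s2.
pose G q := (6 * d2 + 12 * d1 + 12 * f p) * (jb q * f q)
   + (4 * d2 * jb p + 16 * d1 + 8 * f p) * (newton p 1 q * f q)
   + f p * (120 * B * s ^- 3 * (jb p)^-2) * \1_(shell p s) q.
have iG : integ3 G by apply: integ3D; [apply: integ3D|]; exact: integ3Z.
apply: (@le_trans _ _ (int3 G)).
  apply: le_int3 => // q; apply: le_trans (ler_wpM2r (f0 q) (ndiv_bound q s0 s2)) _.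
  have := ler_wpM2l (f0 p) (shell_weight q s0 ss2 ss3); rewrite /G -[X in _ <= _ + X]mulrA.
  move: (60 * s ^- 3 / (jb p * jb q) * \1_(shell p s) q)
    (120 * B * s ^- 3 / jb p ^+ 2 * \1_(shell p s) q) (newton p 1 q) (jb q) (jb p) (f p) (f q).
  move=> a b n Q P u v; lra.
have sh : f p * (120 * B * s ^- 3 * (jb p) ^- 2) * int3 (\1_(shell p s)) <= f p * (120 * 432 * B).
  have s3 : 0 <= s ^- 3 by rewrite invr_ge0 exprn_ge0// ltW.
  have p3 : 0 <= jb p ^- 2 by rewrite invr_ge0 exprn_ge0// ltW.
  have c0 : 0 <= f p * (120 * B * s ^- 3 * (jb p) ^- 2) by rewrite mulr_ge0// mulr_ge0// mulr_ge0// mulr_ge0.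
  apply: le_trans (ler_wpM2l c0 vsh) _; rewrite le_eqVlt; apply/orP; left; apply/eqP.
  by field; rewrite jb_neq0 gt_eqF.
rewrite /G int3D ?int3D ?int3Z//; try (exact: integ3Z); try (by apply: integ3D; exact: integ3Z).
have c1 : 0 <= 6 * d2 + 12 * d1 + 12 * f p by rewrite !addr_ge0 ?mulr_ge0.
have c2 : 0 <= 4 * d2 * jb p + 16 * d1 + 8 * f p.
  by rewrite addr_ge0// ?mulr_ge0// addr_ge0// mulr_ge0// ?mulr_ge0// ltW.
have v1 := ler_wpM2l c1 hE; have v2 := ler_wpM2l c2 vNf.
apply: le_trans (lerD (lerD v1 v2) sh) _; rewrite /T.
rewrite le_eqVlt; apply/orP; left; apply/eqP.
ring.
Qed.
End CollisionAtMaximum.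

(** * Consequences of the energy and sup bounds *)

Section MeasureBounds.
Variable R : realType.
Notation V := 'rV[R]_3.
Implicit Types (p q : V) (i j k : 'I_3).
Local Notation jb := jbracket.
Local Notation mu := (@lebesgue_measure R).
Local Notation mu2 := ((@lebesgue_measure R) \x (@lebesgue_measure R))%E.
Local Notation T3 := (measurableTypeR R * measurableTypeR R * measurableTypeR R)%type.

Lemma leb3_setT_gt0 : (0 < (@leb3 R) setT)%E.
Proof.
apply: (@lt_le_trans _ _ (leb3 ((@vec3 R) @^-1` [set q | `|q - 0| < 1]))).
  by rewrite leb3_cube// lte_fin exprn_gt0// mulr_gt0.
by by apply: le_measure; rewrite ?inE//; exact: measurable_cube.
Qed.

(** For a continuous function the set where the bound fails is open, hence of
positive measure unless it is empty. *)
Lemma Linfty_pointwise (g : V -> R) (M : R) : continuous g -> (Linfty g <= M%:E)%E ->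
  forall q, g q <= M.
Proof.
move=> cg; rewrite /Linfty unlock leb3_setT_gt0 => /ess_supP hM q.
rewrite leNgt; apply/negP => hq.
have oU : open [set x : V | M < g x].
  rewrite (_ : [set x | _] = g @^-1` [set y | M < y])//.
  by apply: open_comp; [move=> x _; exact: cg|exact: open_gt].
have mU := measurable_open3 oU.
have n0 : leb3 ((@vec3 R) @^-1` [set x : V | M < g x]) = 0%E.
  apply/negligibleP => //; apply: negligibleS hM => z /= hz hn.
  have := le_trans (ler_norm _) hn => /=.
  by rewrite leNgt hz.
have /nbhs_normP[r /= r0 hr] : nbhs q [set x : V | M < g x] by apply: open_nbhs_nbhs.
have : (leb3 ((@vec3 R) @^-1` [set x | (`|x - q| < r)%R]) <= leb3 ((@vec3 R) @^-1` [set x : V | (M < g x)%R]))%E.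
  apply: le_measure; rewrite ?inE//; first exact: measurable_cube.
  by move=> z /= hz; apply: hr; rewrite /ball_ /= distrC.
by rewrite n0 leb3_cube// lee_fin leNgt exprn_gt0// mulr_gt0.
Qed.

Lemma energy_bound (g : V -> R) (E : R) : continuous g -> (forall q, 0 <= g q) ->
  (\int[leb3]_z (jb (vec3 z) * g (vec3 z))%:E <= E%:E)%E ->
  integ3 (fun q => jb q * g q) /\ int3 (fun q => jb q * g q) <= E.
Proof.
move=> cg g0 hE; apply: integ3_ge0P hE.
  by apply: meas3_continuous; apply: ctM => //; exact: ct_jb.
by move=> q; rewrite mulr_ge0// jb_ge0.
Qed.

Lemma int_oneDsqrV : (\int[mu]_x ((oneDsqr x)^-1)%:E = pi%:E)%E.
Proof.
rewrite ge0_symfun_integralT; first last.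
- by move=> x /=; rewrite /oneDsqr sqrrN.
- exact: continuous_oneDsqrV.
- by move=> x; rewrite invr_ge0.
rewrite (_ : [set x | _] = `[0, +oo[%classic); last first.
  by apply/seteqP; split => x/=; rewrite in_itv/= andbT.
by rewrite integral0y_oneDsqr -EFinM; congr (_%:E); field.
Qed.

(** The sixth power of the bracket dominates the product of the 1 + q_i^2. *)
Lemma integ3_jb6 : exists2 I0, 0 <= I0 & integ3 (fun q => (jb q) ^- 6) /\
  int3 (fun q : V => (jb q) ^- 6) <= I0.
Proof.
exists (pi ^+ 3); first by rewrite exprn_ge0// pi_ge0.
have cj : continuous (fun q : V => (jb q) ^- 6).
  by repeat (cont_step || exact: ct_jb); move=> q; rewrite expf_neq0// jb_neq0.
apply: integ3_ge0P; first exact: meas3_continuous.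
  by move=> q; rewrite invr_ge0 exprn_ge0// jb_ge0.
pose h (x : R) := (oneDsqr x)^-1.
have h0 x : 0 <= h x by rewrite /h invr_ge0.
have mh : measurable_fun setT (h : measurableTypeR R -> R).
  by apply: continuous_measurable_fun; exact: continuous_oneDsqrV.
pose H (z : T3) : \bar R := ((h z.1.1 * h z.1.2) * h z.2)%:E.
have mh2 : measurable_fun setT (fun ab : measurableTypeR R * measurableTypeR R => (h ab.1 * h ab.2)%:E).
  apply/measurable_EFinP; apply: measurable_funM.
    by apply: (measurableT_comp mh); exact: measurable_fst.
  by apply: (measurableT_comp mh); exact: measurable_snd.
have mH : measurable_fun setT H.
  apply/measurable_EFinP; apply: measurable_funM.
    by move/measurable_EFinP: mh2 => mh2; apply: (measurableT_comp mh2); exact: measurable_fst.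
  by apply: (measurableT_comp mh); exact: measurable_snd.
have -> : (pi ^+ 3)%:E = (\int[@leb3 R]_z H z)%E.
  have E1 : (\int[mu2]_ab (h ab.1 * h ab.2)%:E = (pi ^+ 2)%:E)%E.
    rewrite (fubini_tonelli1 (m1 := mu) (m2 := mu))//; last first.
      by move=> x; rewrite lee_fin mulr_ge0.
    rewrite /fubini_F /=.
    transitivity (\int[mu]_a ((h a)%:E * pi%:E))%E.
      apply: eq_integral => a _; under eq_integral do rewrite EFinM.
      by rewrite ge0_integralZl ?int_oneDsqrV//; first [exact/measurable_EFinP|by move=> x _; rewrite lee_fin|by rewrite lee_fin].
    rewrite ge0_integralZr ?int_oneDsqrV -?EFinM//; first [exact/measurable_EFinP|by rewrite lee_fin pi_ge0|by move=> x _; rewrite lee_fin|by rewrite expr2].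
  have H0 z : (0 <= H z)%E by rewrite /H lee_fin !mulr_ge0.
  symmetry; apply: etrans (@fubini_tonelli1 _ _ _ _ _ (@leb2 R) mu H mH H0) _.
  rewrite /fubini_F /=.
  have E2 : (\int[@leb2 R]_ab (h ab.1 * h ab.2)%:E = (pi ^+ 2)%:E)%E := E1.
  transitivity (\int[@leb2 R]_ab ((h ab.1 * h ab.2)%:E * pi%:E))%E.
    apply: eq_integral => a _; rewrite /H /=; under eq_integral do rewrite EFinM.
    by rewrite ge0_integralZl ?int_oneDsqrV//; first [exact/measurable_EFinP|by move=> x _; rewrite lee_fin|by rewrite lee_fin mulr_ge0].
  rewrite ge0_integralZr ?E2//; first [by rewrite -EFinM -exprSr|by rewrite lee_fin pi_ge0
    |by move=> ab _; rewrite lee_fin mulr_ge0].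
apply: ge0_le_integral => //.
- by move=> z _; rewrite lee_fin invr_ge0 exprn_ge0// jb_ge0.
- by apply/measurable_EFinP; exact: (meas3_continuous cj).
move=> z _; rewrite /H lee_fin /h -!invfM lef_pV2 ?posrE ?exprn_gt0 ?jb_gt0//.
have -> : jb (vec3 z) ^+ 6 = (jb (vec3 z) ^+ 2) ^+ 3 by rewrite -exprM.
rewrite jb_sqr vec3_0 vec3_1 vec3_2 /oneDsqr.
have := sqr_ge0 z.1.1; have := sqr_ge0 z.1.2; have := sqr_ge0 z.2.
move: (z.1.1 ^+ 2) (z.1.2 ^+ 2) (z.2 ^+ 2) => a b c c0 b0 a0.
rewrite 2!exprSr expr1; apply: ler_pM; rewrite ?mulr_ge0//; try lra.
by apply: ler_pM; lra.
Qed.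
End MeasureBounds.

(** * The maximum principle *)

Section Slices.
Variable R : realType.
Notation V := 'rV[R]_3.

Lemma pairl_continuous (U X : topologicalType) (u : U) : continuous (fun x : X => (u, x) : U * X).
Proof. by move=> x; apply: cvg_pair; [exact: cvg_cst|exact: cvg_id]. Qed.

Lemma pairr_continuous (U X : topologicalType) (u : U) : continuous (fun x : X => (x, u) : X * U).
Proof. by move=> x; apply: cvg_pair; [exact: cvg_id|exact: cvg_cst]. Qed.

Lemma within_comp_continuous (T U X : topologicalType) (S : set U) (g : U -> X) (h : T -> U) :
  {within S, continuous g} -> continuous h -> (forall x, S (h x)) -> continuous (g \o h).
Proof.
move=> /subspace_continuousP cg ch hS x.
apply: cvg_trans (cg (h x) (hS x)) => A /= hA.
suff : \forall y \near x, A (g (h y)) by [].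
have hA' : \forall y \near x, S (h y) -> A (g (h y)) := ch x _ hA.
by apply: (filterS _ hA') => y /= /(_ (hS y)).
Qed.

Lemma max_derive0 (F : V -> R) (x e : V) : (forall y, derivable F y e) ->
  (forall y, F y <= F x) -> 'D_e F x = 0.
Proof.
move=> dF mx; have E : x = 0 *: e + x by rewrite scale0r add0r.
have dg t : is_derive t (1:R) (fun s => F (s *: e + x)) ('D_e F (t *: e + x)).
  by apply: (is_derive_line F e x t _).1; exact: derivableP.
have [|||t|_ h] := @derive1_at_max _ (fun s => F (s *: e + x)) (- 1) 1 0.
- by lra.
- by move=> t _; case: (dg t).
- by rewrite in_itv /= oppr_lt0 ltr01.
- by move=> _; rewrite -E.
by have [_] := dg 0; rewrite -E h.
Qed.

(** One-sided: t may be the last time considered. *)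
Lemma left_max_derive (g : R -> R) (t d : R) : 0 < t -> is_derive t (1:R) g d ->
  (forall s, 0 <= s <= t -> g s <= g t) -> 0 <= d.
Proof.
move=> t0 [d1 d2] mx; rewrite leNgt; apply/negP => hd.
have cv : h^-1 *: ((g \o shift t) (h *: (1:R)) - g t) @[h --> (0:R)^'] --> d.
  by rewrite -d2; exact: d1.
have /nbhs_normP[r /= r0 hr] : \forall h \near (0:R)^', h^-1 *: ((g \o shift t) (h *: (1:R)) - g t) < 0.
  by move: cv => /cvgr_lt; apply.
pose s := Num.min (r / 2) (t / 2).
have s0 : 0 < s by rewrite lt_min !divr_gt0.
have sr : s < r by rewrite gt_min; apply/orP; left; lra.
have st : s < t by rewrite gt_min; apply/orP; right; lra.
have := hr (- s); rewrite /ball_ /= sub0r opprK gtr0_norm// => /(_ sr).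
rewrite oppr_eq0 gt_eqF// => /(_ isT).
rewrite -[_ *: _]/((- s)^-1 * (g (- s * 1 + t) - g t)) mulr1 ltNge => /negP; apply.
rewrite invrN mulNr oppr_ge0 pmulr_rle0 ?invr_gt0// subr_le0; apply: mx.
by apply/andP; split; lra.
Qed.

Variables (T : R) (f : R -> V -> V -> R).
Hypothesis hf : classical_solution T f.

Lemma slice_pair_continuous (t : R) (x : V) : continuous (fun p : V => ((t, x), p) : R * V * V).
Proof. exact: (@pairl_continuous _ _ (t, x)). Qed.

Lemma slice_continuous t x : 0 <= t <= T -> continuous (f t x).
Proof.
move=> ht; have := @within_comp_continuous _ _ _ _ (jointly f) (fun p => ((t, x), p))
  (cs_continuous hf) (@slice_pair_continuous t x).
by apply.
Qed.

Lemma slice_in (g : R -> V -> V -> R) t x :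
  {in [set w | 0 < w.1.1 < T], continuous (jointly g)} -> 0 < t < T -> continuous (g t x).
Proof.
move=> cg ht p; apply: (@continuous_comp _ _ _ (fun p : V => ((t, x), p) : R * V * V) (jointly g)).
  exact: slice_pair_continuous.
by apply: cg; rewrite inE.
Qed.

Lemma time_continuous x p : {within `[0, T], continuous (fun s => f s x p)}.
Proof.
apply/subspace_continuousP => t ht.
have /subspace_continuousP h := cs_continuous hf.
have St : [set w : R * V * V | 0 <= w.1.1 <= T] ((t, x), p) by move: ht; rewrite /= in_itv.
move=> A hA; have {}hA := h _ St A hA.
have c : {for t, continuous (fun s : R => ((s, x), p) : R * V * V)}.
  by apply: (@continuous_comp _ _ _ (fun t : R => (t, x)) (fun u => (u, p))); exact: pairr_continuous.
have hA' : \forall s \near t, 0 <= s <= T -> A (f s x p) := c _ hA.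
suff : \forall s \near t, `[0, T]%classic s -> A (f s x p) by [].
by apply: (filterS _ hA') => s /= hs; rewrite in_itv.
Qed.
End Slices.

Section TouchingPoint.
Variable R : realType.
Notation V := 'rV[R]_3.
Implicit Types (p q x : V) (i j k : 'I_3).
Local Notation jb := jbracket.

(** The coefficient of f p in [collision_at_maximum]. *)
Definition collision_rate (E B : R) : R := 12 * E + 256 * B + 120 * 432 * B.

Variables (T E0 F0 : R) (f : R -> V -> V -> R).
Hypothesis hb : bounded_solution T E0 F0 f.
Let hf : classical_solution T f := bs_solution hb.

Lemma solution_le t x p : 0 <= t <= T -> f t x p <= F0.
Proof.
move=> ht; apply: Linfty_pointwise (bs_Linfty hb x ht) p.
exact: slice_continuous hf _ _ ht.
Qed.

Lemma solution_energy t x : 0 <= t <= T ->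
  integ3 (fun q => jb q * f t x q) /\ int3 (fun q => jb q * f t x q) <= E0.
Proof.
move=> ht; apply: energy_bound (bs_energy hb x ht).
- exact: slice_continuous hf _ _ ht.
- by move=> q; exact: bs_ge0 hb _ _ _ ht.
Qed.

Variables W dW ddW D1 D2 : R -> R.
Hypothesis hW : forall r : R, 0 < r -> is_derive r (1:R) W (dW r).
Hypothesis hdW : forall r : R, 0 < r -> is_derive r (1:R) dW (ddW r).
Hypothesis cddW : forall r : R, 0 < r -> {for r, continuous ddW}.
Hypothesis W_ge0 : forall r, 1 <= r -> 0 <= W r.
Hypothesis hD1 : forall r, 1 <= r -> dW r <= D1 r /\ 0 <= D1 r.
Hypothesis hD2 : forall r, 1 <= r -> ddW r <= D2 r /\ 0 <= D2 r.

(** The equation at a maximum point in x and p. The barrier is c W + eps r, the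
linear term coming from the penalisation that forces the maximum to be attained.
The same penalisation makes the gradient in x of size eps, so the transport term
is at most eps, hence at most f - c W, and is absorbed like all other errors into
the factor of f - c W. *)
Lemma touching_time_derivative (t : R) x p (c dphi eps E B : R) :
  0 < t < T -> 0 <= c -> 0 < eps ->
  (forall y, f t y p - eps * jb y <= f t x p - eps * jb x) ->
  (forall q, f t x q - (c * W (jb q) + eps * jb q) <= f t x p - (c * W (jb p) + eps * jb p)) ->
  eps <= f t x p - c * W (jb p) ->
  int3 (fun q => jb q * f t x q) <= E ->
  (forall q, `|q - p| < 1 -> f t x q <= B) ->
  2 * D2 (jb p) * (3 * E + 64 * jb p * B) + 2 * D1 (jb p) * (6 * E + 256 * B)
    + W (jb p) * collision_rate E B <= dphi * W (jb p) ->
  dt f t x p <= dphi * (c * W (jb p))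
    + (f t x p - c * W (jb p)) * (2 * (6 * E + 256 * B) + collision_rate E B + 1).
Proof.
move=> ht c0 eps0 mx mp hm hE hB hG.
have ht' : 0 <= t <= T by case/andP: ht => ? ?; rewrite !ltW.
have P1 := jb_ge1 p; have P0 := jb_gt0 p; have X0 := jb_gt0 x.
have fge0 q : 0 <= f t x q by exact: bs_ge0 hb _ _ _ ht'.
have [iE _] := solution_energy x ht'.
have cf : continuous (f t x) by exact: slice_continuous hf _ _ ht'.
have dF q i : derivable (f t x) q (basis3 i) by exact: cs_derivable_p hf _ _ _ ht i.
have cdF i : continuous ('D_(basis3 i) (f t x)) by exact: (@slice_in _ T (dp i f) t x (@cs_continuous_dp _ _ _ hf i) ht).
have ddF q i j : derivable ('D_(basis3 j) (f t x)) q (basis3 i) by exact: cs_derivable_pp hf _ _ _ ht i j.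
have cddF i j : continuous ('D_(basis3 i) ('D_(basis3 j) (f t x))).
  exact: (@slice_in _ T (dp i (dp j f)) t x (@cs_continuous_dpp _ _ _ hf i j) ht).
have hQ := cs_collision hf x ht.
pose W' r := c * W r + eps * r.
have hW' (r : R) : 0 < r -> is_derive r (1:R) W' (c * dW r + eps).
  move=> r0; eapply is_derive_eq.
    by apply: dvD; apply: dvM; (exact: dvC || exact: hW || exact: is_derive_id).
  by rewrite /GRing.scale /=; ring.
have hdW' (r : R) : 0 < r -> is_derive r (1:R) (fun r => c * dW r + eps) (c * ddW r).
  move=> r0; eapply is_derive_eq.
    by apply: dvD; (exact: dvC || (apply: dvM; (exact: dvC || exact: hdW))).
  by rewrite /GRing.scale /=; ring.
have cddW' (r : R) : 0 < r -> {for r, continuous (fun r => c * ddW r)}.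
  by move=> r0; apply: cvgM; [exact: cvg_cst|exact: cddW].
have [a1 a2] := hD1 P1; have [b1 b2] := hD2 P1.
have mp' q : `|q - p| < 1 -> f t x q - W' (jb q) <= f t x p - W' (jb p) by move=> _; exact: mp.
have e1 : c * dW (jb p) + eps <= c * D1 (jb p) + eps by rewrite lerD2r ler_wpM2l.
have e2 : c * ddW (jb p) <= c * D2 (jb p) by rewrite ler_wpM2l.
have e3 : 0 <= c * D1 (jb p) + eps by rewrite addr_ge0 ?mulr_ge0// ltW.
have e4 : 0 <= c * D2 (jb p) by rewrite mulr_ge0.
have key := collision_at_maximum hW' hdW' cddW' cf dF cdF ddF cddF fge0 iE hQ ltr01 mp' hE hB e1 e2 e3 e4.
have eqn := cs_equation hf x p ht.
have E_0 : 0 <= E by apply: le_trans hE; apply: int3_ge0 => q; rewrite mulr_ge0// jb_ge0.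
have B_0 : 0 <= B by apply: le_trans (hB p _); rewrite ?subrr ?normr0.
have dxE i : dx i f t x p = eps * (x 0 i / jb x).
  have d1 y : is_derive y (basis3 i) (fun y => f t y p - eps * jb y) (dx i f t y p - eps * (y 0 i / jb y)).
    have h1 : is_derive y (basis3 i) (fun y => f t y p) (dx i f t y p).
      by apply: derivableP; exact: cs_derivable_x hf _ _ _ ht i.
    eapply is_derive_eq.
      by apply: (dvD h1); apply: dvN; apply: dvM; (exact: dvC || exact: jb_derive).
    by rewrite /GRing.scale /=; ring.
  have := max_derive0 (fun y => let: DeriveDef h _ := d1 y in h) mx.
  by case: (d1 x) => _ -> /eqP; rewrite subr_eq0 => /eqP.
have tr : - eps <= \sum_(i < 3) (p 0 i / jb p) * dx i f t x p.
  have -> : \sum_(i < 3) (p 0 i / jb p) * dx i f t x p = eps * (dotv p x / (jb p * jb x)).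
    rewrite /dotv mulr_suml mulr_sumr; apply: eq_bigr => i _; rewrite dxE.
    by field; rewrite !jb_neq0.
  have : `|dotv p x / (jb p * jb x)| <= 1.
    rewrite normrM normfV (gtr0_norm (mulr_gt0 P0 X0)) ler_pdivrMr ?mulr_gt0// mul1r.
    by apply: le_trans (dot_le_jb p x) _; rewrite gerBl.
  rewrite ler_norml => /andP[h _].
  by have := ler_wpM2l (ltW eps0) h; rewrite mulrN1.
have hGc := ler_wpM2l c0 hG.
set m := f t x p - c * W (jb p) in hm *.
have fm : f t x p = c * W (jb p) + m by rewrite /m addrC subrK.
have U0 : 0 <= 6 * E + 256 * B by rewrite addr_ge0 ?mulr_ge0.
have hU := ler_wpM2r U0 hm.
have q1 : QRL (f t x) (f t x) p <= dphi * (c * W (jb p)) + m * (2 * (6 * E + 256 * B) + collision_rate E B).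
  apply: le_trans key _; rewrite -/(collision_rate E B) fm.
  move: hGc hU; move: (collision_rate E B) (6 * E + 256 * B) (3 * E + 64 * jb p * B) => S U Z.
  by move: (D1 _) (D2 _) (W _) => z1 z2 w; lra.
have -> : dt f t x p = QRL (f t x) (f t x) p - \sum_(i < 3) (p 0 i / jb p) * dx i f t x p.
  by rewrite -eqn addrK.
move: (\sum_(i < 3) _) (QRL _ _ _) q1 tr => s Q; lra.
Qed.
End TouchingPoint.

Section MaximumPrinciple.
Variable R : realType.
Notation V := 'rV[R]_3.
Implicit Types (p q x : V) (i j k : 'I_3).
Local Notation jb := jbracket.

Lemma collision_rate_ge0 (E B : R) : 0 <= E -> 0 <= B -> 0 <= collision_rate E B.
Proof.
move=> E0' B0'; apply: addr_ge0; first by apply: addr_ge0; exact: mulr_ge0.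
by apply: mulr_ge0 => //; exact: mulr_ge0.
Qed.

Variables (T E0 F0 : R) (f : R -> V -> V -> R).
Hypothesis hb : bounded_solution T E0 F0 f.
Let hf : classical_solution T f := bs_solution hb.

Variables W dW ddW D1 D2 : R -> R.
Hypothesis hW : forall r : R, 0 < r -> is_derive r (1:R) W (dW r).
Hypothesis hdW : forall r : R, 0 < r -> is_derive r (1:R) dW (ddW r).
Hypothesis cddW : forall r : R, 0 < r -> {for r, continuous ddW}.
Hypothesis W_ge0 : forall r, 1 <= r -> 0 <= W r.
Hypothesis hD1 : forall r, 1 <= r -> dW r <= D1 r /\ 0 <= D1 r.
Hypothesis hD2 : forall r, 1 <= r -> ddW r <= D2 r /\ 0 <= D2 r.

Variables (phi dphi : R -> R).
Hypothesis hphi : forall t : R, is_derive t (1:R) phi (dphi t).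
Hypothesis init : forall x p, f 0 x p <= expR (phi 0) * W (jb p).

Variables (Et : R -> R) (Bt : R -> R -> R) (E1 B1 : R).
Hypothesis hEt : forall t x, 0 < t < T -> int3 (fun q => jb q * f t x q) <= Et t.
Hypothesis hBt : forall t x p q, 0 < t < T -> `|q - p| < 1 -> f t x q <= Bt t (jb p).
Hypothesis hE1 : forall t, 0 < t < T -> Et t <= E1.
Hypothesis hB1 : forall t r, 0 < t < T -> 1 <= r -> Bt t r <= B1.
Hypothesis hG : forall t r, 0 < t < T -> 1 <= r ->
  2 * D2 r * (3 * Et t + 64 * r * Bt t r) + 2 * D1 r * (6 * Et t + 256 * Bt t r)
    + W r * collision_rate (Et t) (Bt t r) <= dphi t * W r.

(** The function that is maximised in the comparison principle. *)
Definition mpt (lam eps : R) (w : R * V * V) : R :=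
  expR (- lam * w.1.1) * (jointly f w - expR (phi w.1.1) * W (jb w.2))
  - eps * (jb w.2 + jb w.1.2).

Lemma mpt_continuous lam eps (K : set (R * V * V)) :
  (forall w, K w -> 0 <= w.1.1 <= T) -> {within K, continuous (mpt lam eps)}.
Proof.
move=> KT; apply/subspace_continuousP => w Kw.
have cw (g : R * V * V -> R) : {for w, continuous g} -> g y @[y --> within K (nbhs w)] --> g w.
  by move=> h; apply: cvg_within_filter; exact: h.
have cft : f y.1.1 y.1.2 y.2 @[y --> within K (nbhs w)] --> f w.1.1 w.1.2 w.2.
  have sub : K `<=` [set w | 0 <= w.1.1 <= T] by move=> v /KT.
  have := continuous_subspaceW sub (cs_continuous hf).
  by move=> /subspace_continuousP/(_ w Kw).
have c1 : {for w, continuous (fun y : R * V * V => y.1.1)}.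
  by apply: (@continuous_comp _ _ _ (@fst (R * V) V) (@fst R V)); exact: cvg_fst.
have c12 : {for w, continuous (fun y : R * V * V => y.1.2)}.
  by apply: (@continuous_comp _ _ _ (@fst (R * V) V) (@snd R V)); [exact: cvg_fst|exact: cvg_snd].
have c2 : {for w, continuous (fun y : R * V * V => y.2)} by exact: cvg_snd.
have cexp (g : R * V * V -> R) : {for w, continuous g} -> {for w, continuous (fun y => expR (g y))}.
  by move=> cg; apply: (@continuous_comp _ _ _ g (@expR R)); [exact: cg|exact: continuous_expR].
have cjb (g : R * V * V -> V) : {for w, continuous g} -> {for w, continuous (fun y => jb (g y))}.
  by move=> cg; apply: (@continuous_comp _ _ _ g (@jbracket R)); [exact: cg|exact: ct_jb].
have cphi : {for w, continuous (fun y : R * V * V => phi y.1.1)}.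
  apply: (@continuous_comp _ _ _ (fun y : R * V * V => y.1.1) phi); first exact: c1.
  by apply/differentiable_continuous/derivable1_diffP; case: (hphi w.1.1).
have cW : {for w, continuous (fun y : R * V * V => W (jb y.2))}.
  apply: (@continuous_comp _ _ _ (fun y : R * V * V => jb y.2) W); first exact: (cjb _ c2).
  by apply/differentiable_continuous/derivable1_diffP; case: (hW (jb_gt0 w.2)).
have clam : {for w, continuous (fun y : R * V * V => - lam * y.1.1)}.
  by apply: cvgM; [exact: cvg_cst|exact: c1].
apply: cvgB; apply: cvgM.
- exact: cw (cexp _ clam).
- apply: cvgB; first exact: cft.
  by apply: cvgM; [exact: cw (cexp _ cphi)|exact: cw cW].
- exact: cvg_cst.
- by apply: cvgD; [exact: cw (cjb _ c2)|exact: cw (cjb _ c12)].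
Qed.

(** If the bound fails at (t, x, p), then [mpt] has a positive maximum over [0, t]
times momentum and position space, and [touching_time_derivative] contradicts the
sign of its time derivative there. *)
Lemma comparison_lt t x p : 0 <= t < T -> f t x p <= expR (phi t) * W (jb p).
Proof.
move=> /andP[t0 tT]; have [t_0|tn0] := eqVneq t 0; first by rewrite t_0; exact: init.
have {tn0}tp : 0 < t by rewrite lt_neqAle eq_sym tn0.
rewrite leNgt; apply/negP => hlt.
have T0 : 0 < T by exact: le_lt_trans tT.
have tT' : 0 < t < T by rewrite tp.
pose lam := 2 * (6 * E1 + 256 * B1) + collision_rate E1 B1 + 2.
have B10 : 0 <= B1.
  have := bs_ge0 hb (t := t) x p; rewrite (ltW tp) (ltW tT) => /(_ isT) h.
  apply: le_trans h (le_trans (hBt x (p := p) tT' _) (hB1 tT' (jb_ge1 p))).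
  by rewrite subrr normr0.
have E10 : 0 <= E1.
  apply: le_trans (le_trans (hEt x tT') (hE1 tT')); apply: int3_ge0 => q.
  by rewrite mulr_ge0 ?jb_ge0// (bs_ge0 hb)// (ltW tp) ltW.
have lam0 : 0 <= lam.
  have h1 : 0 <= 6 * E1 + 256 * B1 by apply: addr_ge0; exact: mulr_ge0.
  by apply: addr_ge0 => //; apply: addr_ge0; [exact: mulr_ge0|exact: collision_rate_ge0].
have P1 := jb_ge1 p; have X1 := jb_ge1 x.
pose del := expR (- lam * t) * (f t x p - expR (phi t) * W (jb p)).
have del0 : 0 < del by rewrite mulr_gt0 ?expR_gt0// subr_gt0.
(* small enough for the penalised function to stay positive at (t, x, p) *)
pose eps := del / 2 / (jb p + jb x).
have PX : 0 < jb p + jb x by lra.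
have eps0 : 0 < eps by rewrite !divr_gt0.
have H1 : 0 < mpt lam eps ((t, x), p).
  rewrite /mpt /= -/del /eps divfK ?gt_eqF//; lra.
(* beyond A the penalisation exceeds the sup bound on f *)
pose A := `|x| + `|p| + `|F0| / eps.
have A0 : 0 <= A by rewrite /A !addr_ge0// divr_ge0// ltW.
have xA : `|x| <= A by rewrite /A -addrA lerDl addr_ge0// divr_ge0// ltW.
have pA : `|p| <= A by rewrite /A addrAC lerDr addr_ge0// divr_ge0// ltW.
pose K := (`[0, t]%classic `*` [set y : V | `|y| <= A]) `*` [set q : V | `|q| <= A].
have inK s y q : 0 <= s <= t -> `|y| <= A -> `|q| <= A -> K ((s, y), q).
  by move=> hs hy hq; split=> //; split=> //=; rewrite in_itv.
have cK : compact K.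
  by apply: compact_setX; [apply: compact_setX; [exact: segment_compact|exact: compact_cube]|exact: compact_cube].
have KT w : K w -> 0 <= w.1.1 <= T.
  by move=> [[/=]]; rewrite in_itv /= => /andP[-> h] _ _; exact: le_trans h (ltW tT).
have K1 : K ((t, x), p) by apply: inK => //; rewrite t0 lexx.
have [[[t1 x1] p1] ] := compact_EVT_max (ex_intro _ _ K1) cK (@mpt_continuous lam eps K KT).
rewrite inE => Kw mxw.
have Hw0 : 0 < mpt lam eps ((t1, x1), p1).
  by apply: lt_le_trans H1 _; apply: mxw; rewrite inE.
have /= ht1 := KT _ Kw.
have t1t : t1 <= t by case: Kw => -[/=]; rewrite in_itv /= => /andP[_ ->].
have t1p : 0 < t1.
  rewrite lt_neqAle eq_sym (andP ht1).1 andbT; apply/eqP => t10.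
  move: Hw0; rewrite ltNge => /negP; apply; rewrite /mpt /= /jointly /= t10.
  rewrite mulr0 expR0 mul1r subr_le0; apply: (@le_trans _ _ 0).
    by rewrite subr_le0; exact: init.
  by rewrite mulr_ge0 ?addr_ge0 ?jb_ge0// ltW.
have ht1' : 0 < t1 < T by rewrite t1p (le_lt_trans t1t).
have mx s y q : 0 <= s <= t -> mpt lam eps ((s, y), q) <= mpt lam eps ((t1, x1), p1).
  move=> hs; have [/andP[hy hq]|far] := boolP ((`|y| <= A) && (`|q| <= A)).
    by apply: mxw; rewrite inE; exact: inK.
  have {}far : A <= jb q + jb y.
    have := vnorm_le_jb q; have := vnorm_le_jb y; have := jb_ge0 q; have := jb_ge0 y.
    by move: far; rewrite negb_and -!ltNge => /orP[]; lra.
  apply: (le_trans _ (ltW Hw0)); rewrite /mpt /= /jointly /= subr_le0.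
  have sT : 0 <= s <= T by case/andP: hs => -> h; exact: le_trans h (ltW tT).
  apply: (@le_trans _ _ `|F0|).
    apply: (@le_trans _ _ (expR (- lam * s) * `|F0|)).
      rewrite ler_wpM2l ?expR_ge0//; apply: le_trans (ler_norm _).
      apply: le_trans (solution_le hb y q sT).
      by rewrite gerBl mulr_ge0 ?expR_ge0// W_ge0// jb_ge1.
    by rewrite ler_piMl// -expR0 ler_expR mulNr oppr_le0 mulr_ge0//; case/andP: hs.
  rewrite mulrC -ler_pdivrMr//; apply: le_trans far.
  by rewrite /A lerDr addr_ge0.
pose a := expR (lam * t1).
have a0 : 0 < a by exact: expR_gt0.
have ia : expR (- lam * t1) = a^-1 by rewrite mulNr expRN.
pose c := expR (phi t1).
have c0 : 0 <= c by exact: expR_ge0.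
have P11 := jb_ge1 p1; have X11 := jb_ge1 x1.
have ts : 0 <= t1 <= t by rewrite t1t ltW.
have scale y q : a * mpt lam eps ((t1, y), q) = f t1 y q - c * W (jb q) - a * eps * (jb q + jb y).
  by rewrite /mpt /= /jointly /= ia -/c; field; rewrite gt_eqF.
have mxa y q : f t1 y q - c * W (jb q) - a * eps * (jb q + jb y) <=
    f t1 x1 p1 - c * W (jb p1) - a * eps * (jb p1 + jb x1).
  by rewrite -!scale ler_pM2l//; exact: mx.
have ae0 : 0 < a * eps by rewrite mulr_gt0.
have hpos : 0 < f t1 x1 p1 - c * W (jb p1) - a * eps * (jb p1 + jb x1).
  by rewrite -scale mulr_gt0.
have big : a * eps <= f t1 x1 p1 - c * W (jb p1).
  have : a * eps <= a * eps * (jb p1 + jb x1) by rewrite ler_peMr ?(ltW ae0)//; lra.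
  lra.
have Wp : 0 <= W (jb p1) by exact: W_ge0.
have mx1 y : f t1 y p1 - a * eps * jb y <= f t1 x1 p1 - a * eps * jb x1.
  by have := mxa y p1; lra.
have mx2 q : f t1 x1 q - (c * W (jb q) + a * eps * jb q) <=
    f t1 x1 p1 - (c * W (jb p1) + a * eps * jb p1).
  by have := mxa x1 q; lra.
have step := touching_time_derivative hb hW hdW cddW hD1 hD2 ht1' c0 ae0 mx1 mx2 big (hEt x1 ht1')
  (fun q => hBt x1 (p := p1) (q := q) ht1') (hG ht1' P11).
have tder : 0 <= a^-1 * (dt f t1 x1 p1 - dphi t1 * (c * W (jb p1)))
    - lam * a^-1 * (f t1 x1 p1 - c * W (jb p1)).
  have h1 : is_derive t1 (1:R) (fun s => f s x1 p1) (dt f t1 x1 p1).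
    by rewrite /dt derive1E; apply: derivableP; exact: (@cs_derivable_t _ _ _ hf t1 x1 p1 ht1').
  have h2 : is_derive t1 (1:R) (fun s => - lam * s) (- lam).
    eapply is_derive_eq; first by apply: dvM; (exact: dvC || exact: is_derive_id).
    by rewrite /GRing.scale /=; ring.
  have h3 := dv_comp h2 (is_derive_expR (- lam * t1)).
  have h4 := dv_comp (hphi t1) (is_derive_expR (phi t1)).
  have h5 : is_derive t1 (1:R) (fun s => mpt lam eps ((s, x1), p1))
      (a^-1 * (dt f t1 x1 p1 - dphi t1 * (c * W (jb p1)))
       - lam * a^-1 * (f t1 x1 p1 - c * W (jb p1))).
    rewrite /mpt /jointly /=; eapply is_derive_eq.
      exact: (dvD (dvM h3 (dvD h1 (dvN (dvM h4 (dvC _ _ (W (jb p1)))))))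
        (dvC _ _ (- (eps * (jb p1 + jb x1))))).
    by rewrite /= ia -/c; ring.
  apply: (left_max_derive t1p h5) => s /andP[hs1 hs2].
  by apply: mx; rewrite hs1 (le_trans hs2).
have Em : Et t1 <= E1 by exact: hE1.
have Bm : Bt t1 (jb p1) <= B1 by exact: hB1.
have m0 : 0 < f t1 x1 p1 - c * W (jb p1) by exact: lt_le_trans big.
set m := f t1 x1 p1 - c * W (jb p1) in m0 tder step *.
have tder2 : lam * m <= dt f t1 x1 p1 - dphi t1 * (c * W (jb p1)).
  move: tder; rewrite (mulrC lam) -mulrA -mulrBr pmulr_rge0 ?invr_gt0//.
  by rewrite subr_ge0.
have : lam * m <= m * (2 * (6 * Et t1 + 256 * Bt t1 (jb p1)) + collision_rate (Et t1) (Bt t1 (jb p1)) + 1).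
  by apply: le_trans tder2 _; rewrite lerBlDl.
rewrite mulrC ler_pM2l// leNgt => /negP; apply.
by rewrite /lam /collision_rate; lra.
Qed.

(** Extends [comparison_lt] to the final time, where the equation need not hold, by
continuity. [Et] and [Bt] are bounds on the energy and on f near p; the condition
on dphi is [collision_at_maximum] for the barrier. *)
Theorem comparison t x p : 0 <= t <= T -> f t x p <= expR (phi t) * W (jb p).
Proof.
move=> /andP[t0 tT]; have [tlt|Tt] := ltP t T; first by apply: comparison_lt; rewrite t0.
have {tT Tt} tT : t = T by apply/eqP; rewrite eq_le tT Tt.
rewrite {t}tT in t0 *; move: t0; rewrite le_eqVlt => /predU1P[T0|T0].
  by rewrite -T0; exact: init.
rewrite leNgt; apply/negP => hlt.
have /subspace_continuousP/(_ T) cft := @time_continuous _ _ _ hf x p.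
have cphi : {for T, continuous phi}.
  by apply/differentiable_continuous/derivable1_diffP; case: (hphi T).
have c1 : {for T, continuous (fun s => expR (phi s) * W (jb p))}.
  apply: cvgM; last exact: cvg_cst.
  by apply: (@continuous_comp _ _ _ phi (@expR R)); [exact: cphi|exact: continuous_expR].
have c2 : f s x p - expR (phi s) * W (jb p) @[s --> within `[0, T]%classic (nbhs T)] -->
    f T x p - expR (phi T) * W (jb p).
  apply: cvgB; last by apply: cvg_within_filter; exact: c1.
  by apply: cft; rewrite /= in_itv /= lexx ltW.
have : \forall s \near within `[0, T]%classic (nbhs T), 0 < f s x p - expR (phi s) * W (jb p).
  by move: c2 => /cvgr_gt; apply; rewrite subr_gt0.
rewrite near_withinE => /nbhs_normP[r /= r0 hr].
pose s := Num.max 0 (T - r / 2).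
have s0 : 0 <= s by rewrite le_max lexx.
have sT : s < T by rewrite gt_max T0 /= gtrBl divr_gt0.
have sr : ball_ Num.norm T r s.
  rewrite /ball_ /= gtr0_norm ?subr_gt0//.
  have : T - r / 2 <= s by rewrite le_max lexx orbT.
  by lra.
have := hr s sr; rewrite in_itv /= s0 (ltW sT) => /(_ isT).
by rewrite subr_gt0 ltNge comparison_lt ?s0.
Qed.
End MaximumPrinciple.

(** * Polynomial and exponential decay *)

Section PolynomialMoments.
Variable R : realType.
Notation V := 'rV[R]_3.
Implicit Types (p q x : V).
Local Notation jb := jbracket.
Variables (E0 F0 : R).
Hypothesis E0_gt0 : 0 < E0.
Hypothesis F0_gt0 : 0 < F0.

Lemma collision_rate_gt0 (E B : R) : 0 < E -> 0 <= B -> 0 < collision_rate E B.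
Proof.
move=> E0' B0'; apply: ltr_wpDr; first by apply: mulr_ge0 => //; exact: mulr_ge0.
by apply: ltr_wpDr; [exact: mulr_ge0|exact: mulr_gt0].
Qed.

Definition poly_rate (k : R) : R := 2 * (k * (k + 1)) * (3 * E0 + 64 * F0) + collision_rate E0 F0.

Lemma poly_rate_gt0 k : 0 < k -> 0 < poly_rate k.
Proof.
move=> k0; apply: ltr_wpDl; last by apply: collision_rate_gt0 => //; exact: ltW.
apply: mulr_ge0; last by apply: addr_ge0; apply: mulr_ge0 => //; exact: ltW.
by apply: mulr_ge0 => //; apply: mulr_ge0; lra.
Qed.

(** The barrier M r^(-k) is decreasing, and its second derivative is
k (k + 1) r^-2 times itself, which pays for the factor r that multiplies the sup
norm in [collision_at_maximum]. *)
Lemma poly_bound (k T M : R) (f : R -> V -> V -> R) : 0 < k -> 0 <= M ->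
  bounded_solution T E0 F0 f -> (forall x p, f 0 x p <= M * jb p `^ (- k)) ->
  forall t x p, 0 <= t <= T -> f t x p <= expR (poly_rate k * t) * (M * jb p `^ (- k)).
Proof.
move=> k0 M0 hb hin t x p ht.
pose W r : R := M * r `^ (- k).
pose dW r : R := M * (- k * r `^ (- k - 1)).
pose ddW r : R := M * (- k * ((- k - 1) * r `^ (- k - 1 - 1))).
pose D2 r : R := k * (k + 1) * W r / r ^+ 2.
have hW (r : R) : 0 < r -> is_derive r (1:R) W (dW r).
  move=> r0; eapply is_derive_eq; first exact: (dvM (dvC _ _ M) (is_derive1_powR (- k) r0)).
  by rewrite /= mulr0 addr0.
have hdW (r : R) : 0 < r -> is_derive r (1:R) dW (ddW r).
  move=> r0; eapply is_derive_eq.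
    exact: (dvM (dvC _ _ M) (dvM (dvC _ _ (- k)) (is_derive1_powR (- k - 1) r0))).
  by rewrite /= !mulr0 !addr0.
have cddW (r : R) : 0 < r -> {for r, continuous ddW}.
  move=> r0; have cp : {for r, continuous (fun r : R => r `^ (- k - 1 - 1))}.
    apply/differentiable_continuous/derivable1_diffP.
    by case: (is_derive1_powR (- k - 1 - 1) r0).
  apply: cvgM; first exact: cvg_cst.
  apply: cvgM; first exact: cvg_cst.
  apply: cvgM; [exact: cvg_cst|exact: cp].
have W0 r : 1 <= r -> 0 <= W r by move=> _; rewrite mulr_ge0// powR_ge0.
have ddWE r : 1 <= r -> ddW r = D2 r.
  move=> r1; have r0 : 0 < r by lra.
  have rn : r != 0 by rewrite gt_eqF.
  rewrite /ddW /D2 /W -addrA powRD ?rn ?implybT//.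
  have -> : r `^ (- 1 - 1) = r ^- 2.
    by rewrite (_ : - 1 - 1 = - 2%:R); [exact: powR_invn (ltW r0)|ring].
  by field.
have hD1 r : 1 <= r -> dW r <= 0 /\ (0 : R) <= 0.
  move=> r1; split => //; rewrite /dW mulr_ge0_le0// mulr_le0_ge0 ?powR_ge0//; lra.
have hD2 r : 1 <= r -> ddW r <= D2 r /\ 0 <= D2 r.
  move=> r1; rewrite ddWE//; split => //; rewrite /D2 divr_ge0 ?sqr_ge0//.
  by rewrite mulr_ge0 ?W0// mulr_ge0 ?addr_ge0// ltW.
pose b := poly_rate k.
have hphi (s : R) : is_derive s (1:R) (fun t => b * t) b.
  eapply is_derive_eq; first by apply: dvM; (exact: dvC || exact: is_derive_id).
  by rewrite /GRing.scale /=; ring.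
have init y q : f 0 y q <= expR (b * 0) * W (jb q) by rewrite mulr0 expR0 mul1r; exact: hin.
have tT (s : R) : 0 < s < T -> 0 <= s <= T by case/andP => ? ?; rewrite !ltW.
have hE (s : R) (y : V) : 0 < s < T -> int3 (fun q => jb q * f s y q) <= E0.
  by move=> /tT h; have [] := solution_energy hb y h.
have hB (s : R) (y q q' : V) : 0 < s < T -> `|q' - q| < 1 -> f s y q' <= F0.
  by move=> /tT h _; exact: (solution_le hb y q' h).
apply: (@comparison _ T E0 F0 f hb W dW ddW (fun=> 0) D2 hW hdW cddW W0 hD1 hD2
  (fun t => b * t) (fun=> b) hphi init (fun=> E0) (fun _ _ => F0) E0 F0 hE hB) => //.
move=> s r hs r1; rewrite mulr0 mul0r addr0 /b /poly_rate [leRHS]mulrDl [collision_rate _ _ * _]mulrC lerD2r.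
have r0 : 0 < r by lra.
have kk : 0 <= 2 * (k * (k + 1)) * W r.
  by rewrite mulr_ge0 ?W0// mulr_ge0// mulr_ge0 ?addr_ge0// ltW.
rewrite (_ : 2 * D2 r * _ = 2 * (k * (k + 1)) * W r * ((3 * E0 + 64 * r * F0) / r ^+ 2)); last first.
  by rewrite /D2; field; rewrite gt_eqF.
rewrite [leRHS]mulrAC; apply: ler_wpM2l => //.
rewrite ler_pdivrMr ?exprn_gt0//.
have r2 : r <= r ^+ 2 by rewrite expr2 ler_peMr// ltW.
have := ler_wpM2l (ltW F0_gt0) r2.
have : E0 <= E0 * r ^+ 2 by rewrite ler_peMr ?exprn_ege1// ltW.
by move: (r ^+ 2) => z; lra.
Qed.
End PolynomialMoments.

Section ExponentialMoments.
Variable R : realType.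
Notation V := 'rV[R]_3.
Implicit Types (p q x : V).
Local Notation jb := jbracket.

Lemma collision_rateZ (a E B : R) : collision_rate (a * E) (a * B) = a * collision_rate E B.
Proof. by rewrite /collision_rate; move: (120 * 432) => z; ring. Qed.

Lemma le_collision_rate (E B B' : R) : B <= B' -> collision_rate E B <= collision_rate E B'.
Proof.
move=> h; rewrite /collision_rate; apply: lerD; first by rewrite lerD2l ler_wpM2l.
by rewrite ler_wpM2l// mulr_ge0.
Qed.

Lemma exp_dominates (sigma : R) (n : nat) (r : R) : 0 < sigma -> 0 <= r ->
  r ^+ n.+1 <= n.+1`!%:R / sigma ^+ n.+1 * expR (sigma * r).
Proof.
move=> s0 r0; have := @expR_ge1Dxn R (sigma * r) n (mulr_ge0 (ltW s0) r0) => h.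
have f0 : 0 < n.+1`!%:R :> R by rewrite ltr0n fact_gt0.
have {}h : (sigma * r) ^+ n.+1 / n.+1`!%:R <= expR (sigma * r) by lra.
have := ler_wpM2l (ltW (divr_gt0 f0 (exprn_gt0 n.+1 s0))) h.
apply: le_trans; rewrite exprMn le_eqVlt; apply/orP; left; apply/eqP.
by field; rewrite expf_neq0 ?gt_eqF.
Qed.

Variables (E0 F0 : R).
Hypothesis E0_gt0 : 0 < E0.
Hypothesis F0_gt0 : 0 < F0.

(** The second derivative of N e^(- sigma r) is sigma^2 times itself without any
gain, so <p> f has to be bounded: this, and an energy proportional to N, follow
from [poly_bound] with k = 7. *)
Lemma exp_bound (sigma : R) : 0 < sigma -> exists2 C, 0 < C &
  forall (T N : R) (f : R -> V -> V -> R), 0 < N -> bounded_solution T E0 F0 f ->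
  (forall x p, f 0 x p <= N * expR (- sigma * jb p)) ->
  forall t x p, 0 <= t <= T ->
   f t x p <= expR (C * N * expR (C * t) * t) * (N * expR (- sigma * jb p)).
Proof.
move=> s0; have [I0 I00 [iI vI]] := integ3_jb6 R.
pose c : R := 7`!%:R / sigma ^+ 7.
have c0 : 0 < c by rewrite divr_gt0 ?exprn_gt0// ltr0n fact_gt0.
pose beta := poly_rate E0 F0 7.
have beta0 : 0 < beta by apply: poly_rate_gt0.
pose C1 := 2 * sigma ^+ 2 * (3 * (c * I0) + 64 * (3 * c)) + collision_rate (c * I0) (3 * c).
have cI : 0 <= c * I0 by rewrite mulr_ge0// ltW.
have c3 : 0 <= 3 * c by rewrite mulr_ge0// ltW.
have C10 : 0 <= C1.
  apply: addr_ge0; last exact: collision_rate_ge0.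
  apply: mulr_ge0; first by rewrite mulr_ge0// sqr_ge0.
  by apply: addr_ge0; exact: mulr_ge0.
exists (C1 + beta); first by rewrite ltr_wpDl.
move=> T N f N0 hb hin t x p ht.
have P7 q : jb q `^ (- 7%:R) = jb q ^- 7 by apply: powR_invn; exact: jb_ge0.
have pb s y q : 0 <= s <= T -> f s y q <= expR (beta * s) * (c * N) * jb q ^- 7.
  move=> hs; rewrite -mulrA -P7; apply: (poly_bound E0_gt0 F0_gt0 _ _ hb _ y q hs) => //.
    by rewrite mulr_ge0// ltW.
  move=> y' q'; rewrite P7; apply: le_trans (hin y' q') _.
  rewrite (_ : c * N * _ = N * (c * jb q' ^- 7)); last by rewrite mulrCA mulrA.
  rewrite ler_pM2l// ler_pdivlMr ?exprn_gt0 ?jb_gt0//.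
  have := ler_wpM2l (expR_ge0 (- sigma * jb q')) (exp_dominates 6 s0 (jb_ge0 q')).
  move/le_trans; apply; rewrite -/c mulrCA -expRD mulNr addNr expR0 mulr1; exact: lexx.
(* Up to constants, e bounds both the energy and <p> f. *)
pose e s := expR (beta * s) * N.
have e0 s : 0 < e s by rewrite mulr_gt0// expR_gt0.
have em s : 0 < s < T -> e s <= e T.
  by move=> /andP[_ sT]; rewrite ler_pM2r// ler_expR ler_pM2l// ltW.
have tT (s : R) : 0 < s < T -> 0 <= s <= T by case/andP => ? ?; rewrite !ltW.
pose W r : R := N * expR (- sigma * r).
have hlin (r : R) : is_derive r (1:R) (fun r => - sigma * r) (- sigma).
  eapply is_derive_eq; first by apply: dvM; (exact: dvC || exact: is_derive_id).
  by rewrite /GRing.scale /=; ring.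
have hexp (r : R) := dv_comp (hlin r) (is_derive_expR (- sigma * r)).
have hW (r : R) : 0 < r -> is_derive r (1:R) W (- sigma * W r).
  move=> _; eapply is_derive_eq; first exact: (dvM (dvC _ _ N) (hexp r)).
  by rewrite /W /=; ring.
have hdW (r : R) : 0 < r -> is_derive r (1:R) (fun r => - sigma * W r) (sigma ^+ 2 * W r).
  move=> r0; eapply is_derive_eq; first exact: (dvM (dvC _ _ (- sigma)) (hW r r0)).
  by rewrite /=; ring.
have cddW (r : R) : 0 < r -> {for r, continuous (fun r => sigma ^+ 2 * W r)}.
  move=> r0; apply: cvgM; first exact: cvg_cst.
  have cW : {for r, continuous W}.
    by apply/differentiable_continuous/derivable1_diffP; case: (hW r r0).
  exact: cW.
have W0 r : 1 <= r -> 0 <= W r by move=> _; rewrite mulr_ge0 ?expR_ge0// ltW.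
have hD1 r : 1 <= r -> - sigma * W r <= 0 /\ (0 : R) <= 0.
  by move=> r1; split => //; rewrite mulNr oppr_le0 mulr_ge0 ?W0// ltW.
have hD2 r : 1 <= r -> sigma ^+ 2 * W r <= sigma ^+ 2 * W r /\ 0 <= sigma ^+ 2 * W r.
  by move=> r1; split => //; apply: mulr_ge0; [exact: sqr_ge0|exact: W0].
pose phi s := C1 * N * (expR (beta * s) * s).
pose dphi s := C1 * N * (expR (beta * s) + s * (beta * expR (beta * s))).
have hphi (s : R) : is_derive s (1:R) phi (dphi s).
  have h1 : is_derive s (1:R) (fun s => beta * s) beta.
    eapply is_derive_eq; first by apply: dvM; (exact: dvC || exact: is_derive_id).
    by rewrite /GRing.scale /=; ring.
  have h2 := dv_comp h1 (is_derive_expR (beta * s)).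
  eapply is_derive_eq; first exact: (dvM (dvC _ _ (C1 * N)) (dvM h2 (is_derive_id s (1:R)))).
  by rewrite /dphi /=; ring.
have init y q : f 0 y q <= expR (phi 0) * W (jb q).
  by rewrite /phi !mulr0 expR0 mul1r; exact: hin.
have hE (s : R) (y : V) : 0 < s < T -> int3 (fun q => jb q * f s y q) <= e s * (c * I0).
  move=> /tT hs; have [iE _] := solution_energy hb y hs.
  apply: (@le_trans _ _ (int3 (fun q : V => e s * c * jb q ^- 6))).
    apply: le_int3 => //; first exact: integ3Z.
    move=> q; have q0 := jb_gt0 q.
    apply: le_trans (ler_wpM2l (jb_ge0 q) (pb s y q hs)) _.
    by rewrite le_eqVlt /e; apply/orP; left; apply/eqP; field; rewrite gt_eqF.
  by rewrite int3Z// -mulrA ler_pM2l// ler_pM2l.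
have hB (s : R) (y q q' : V) : 0 < s < T -> `|q' - q| < 1 -> f s y q' <= e s * (3 * c) / jb q.
  move=> /tT hs hq; apply: le_trans (pb s y q' hs) _.
  have q1 := jb_ge1 q; have q1' := jb_ge1 q'; have q0 := jb_gt0 q; have q0' := jb_gt0 q'.
  have l3 : jb q <= 3 * jb q' by have := jb_lip q q'; lra.
  rewrite (_ : e s * (3 * c) / jb q = expR (beta * s) * (c * N) * (3 / jb q)); last by rewrite /e; ring.
  apply: ler_wpM2l; first by rewrite mulr_ge0 ?expR_ge0// mulr_ge0// ltW.
  rewrite -[leLHS]div1r ler_pdivrMr ?exprn_gt0// mulrAC ler_pdivlMr// mul1r.
  apply: le_trans l3 _; rewrite ler_pM2l// exprS ler_peMr ?exprn_ege1//; exact: ltW.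
have B3 (r : R) : 1 <= r -> 3 * c / r <= 3 * c.
  by move=> r1; rewrite ler_pdivrMr ?ler_peMr//; lra.
have key := @comparison _ T E0 F0 f hb W (fun r => - sigma * W r) (fun r => sigma ^+ 2 * W r)
  (fun=> 0) (fun r => sigma ^+ 2 * W r) hW hdW cddW W0 hD1 hD2 phi dphi hphi init
  (fun s => e s * (c * I0)) (fun s r => e s * (3 * c) / r) (e T * (c * I0)) (e T * (3 * c)) hE hB.
have {}key : f t x p <= expR (phi t) * W (jb p).
  apply: key => //.
  - by move=> s hs; apply: ler_wpM2r => //; exact: em.
  - move=> s r hs r1; rewrite -mulrA; apply: ler_pM (em s hs) (B3 r r1); first exact: ltW.
    by apply: divr_ge0 => //; lra.
  move=> s r hs r1.
  have r0 : 0 < r by lra.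
  have sp : 0 <= s by case/andP: hs => /ltW.
  rewrite mulr0 mul0r addr0 -[e s * (3 * c) / r]mulrA collision_rateZ.
  have cc := le_collision_rate (c * I0) (B3 r r1).
  have e1 : 2 * (sigma ^+ 2 * W r) * (3 * (e s * (c * I0)) + 64 * r * (e s * (3 * c / r))) =
      W r * (e s * (2 * sigma ^+ 2 * (3 * (c * I0) + 64 * (3 * c)))).
    by field; rewrite gt_eqF.
  rewrite e1 -mulrDr mulrC; apply: ler_wpM2r; first exact: W0.
  rewrite -mulrDr.
  apply: (@le_trans _ _ (e s * C1)).
    by rewrite ler_pM2l// /C1 lerD2l.
  rewrite /dphi (_ : e s * C1 = C1 * N * expR (beta * s)); last by rewrite /e; ring.
  rewrite [leRHS]mulrDr lerDl; apply: mulr_ge0; first by apply: mulr_ge0 => //; exact: ltW.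
  by apply: mulr_ge0 => //; apply: mulr_ge0; [exact: ltW|exact: expR_ge0].
have t0 : 0 <= t by case/andP: ht.
apply: le_trans key _; apply: ler_wpM2r; first by rewrite mulr_ge0 ?expR_ge0// ltW.
rewrite ler_expR /phi -[leRHS]mulrA; apply: ler_pM.
- by rewrite mulr_ge0// ltW.
- by rewrite mulr_ge0 ?expR_ge0.
- by rewrite ler_pM2r// lerDl ltW.
by apply: ler_wpM2r => //; rewrite ler_expR; apply: ler_wpM2r => //; rewrite lerDr.
Qed.
End ExponentialMoments.

Theorem theorem1p1 (R : realType) (E0 F0 : R) (hE0 : 0 < E0) (hF0 : 0 < F0) :
  (forall k : R, 0 < k ->
     exists2 beta : R, 0 < beta &
       forall (T Mk : R) (f : R -> 'rV[R]_3 -> 'rV[R]_3 -> R),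
         0 < T -> 0 < Mk ->
         bounded_solution T E0 F0 f ->
         (forall x p : 'rV[R]_3, jbracket p `^ k * f 0 x p <= Mk) ->
         forall (t : R) (x p : 'rV[R]_3), 0 <= t <= T ->
           jbracket p `^ k * f t x p <= expR (beta * t) * Mk)
  /\
  (forall sigma : R, 0 < sigma ->
     exists2 C : R, 0 < C &
       forall (T k Mk N : R) (f : R -> 'rV[R]_3 -> 'rV[R]_3 -> R),
         0 < T -> 0 < k -> 0 < Mk -> 0 < N ->
         bounded_solution T E0 F0 f ->
         (forall x p : 'rV[R]_3, jbracket p `^ k * f 0 x p <= Mk) ->
         (forall x p : 'rV[R]_3, expR (sigma * jbracket p) * f 0 x p <= N) ->
         forall (t : R) (x p : 'rV[R]_3), 0 <= t <= T ->
           expR (sigma * jbracket p) * f t x p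
             <= N * expR (C * N * expR (C * t) * t)).
Proof.
have wt (k : R) (p : 'rV[R]_3) (y M : R) : (jbracket p `^ k * y <= M) = (y <= M * jbracket p `^ (- k)).
  by rewrite powRN ler_pdivlMr ?powR_gt0 ?jb_gt0// mulrC.
split=> [k k0|sigma s0].
  exists (poly_rate E0 F0 k); first exact: poly_rate_gt0.
  move=> T Mk f T0 M0 hb hin t x p ht; rewrite wt -mulrA.
  apply: (poly_bound hE0 hF0 k0 (ltW M0) hb) => // y q.
  by rewrite -wt.
have [C C0 hC] := exp_bound hE0 hF0 s0.
have we (p : 'rV[R]_3) (y M : R) : (expR (sigma * jbracket p) * y <= M) = (y <= M * expR (- sigma * jbracket p)).
  by rewrite mulNr expRN ler_pdivlMr ?expR_gt0// mulrC.
exists C => // T k Mk N f _ _ _ N0 hb _ hin t x p ht.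
rewrite we -mulrA mulrCA; apply: (hC T N f N0 hb) => // y q.
by rewrite -we.
Qed.
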